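(* On the general prime Fano threefold $V_8\subset\mathbb{P}^6$ of genus $5$ there exists a projectively normal elliptic curve of degree $4$. Moreover, any elliptic quartic $C$ on $V_8$ is cut out on $V_8$ by a $3$-space (i.e. $C=V_8\cap\mathbb{P}^3$ for some linear subspace $\mathbb{P}^3\subset\mathbb{P}^6$) which lies in a quadric of rank $6$ containing $V_8$.
   Context: We work over $\mathbb{C}$. A prime Fano threefold is a smooth projective threefold $V$ with $-K_V$ ample and $\mathrm{Pic}(V)=\mathbb{Z}[-K_V]$; its genus $g$ is defined by $(-K_V)^3=2g-2$. A prime Fano threefold $V_8$ of genus $5$ is a smooth complete intersection of three quadrics in $\mathbb{P}^6$. An elliptic quartic on $V_8$ is a curve of degree $4$ contained in $V_8$ which is a complete intersection of two quadrics in a $3$-dimensional linear subspace of $\mathbb{P}^6$. *)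

(* Defs.v *)
From mathcomp Require Import all_boot all_order all_algebra.
From mathcomp Require Export mpoly.
From mathcomp Require Export reals complex.

Set Implicit Arguments.
Unset Strict Implicit.
Unset Printing Implicit Defensive.

Import GRing.Theory.
Local Open Scope ring_scope.

Section ProjectiveSchemes.
Variables (K : fieldType) (n : nat).
Local Notation S := {mpoly K[n]}.
Implicit Types (I J : S -> Prop) (f g : S).

(* Closed subschemes of P^(n-1) are given by homogeneous ideals of the         *)
(* polynomial ring S in n variables; two ideals give the same subscheme when  *)
(* their saturations agree.                                                   *)

Definition is_ideal I : Prop :=
  [/\ I 0, forall f g, I f -> I g -> I (f + g) & forall f g, I g -> I (f * g)].

Definition homogeneous_ideal I : Prop :=
  is_ideal I /\ forall d f, I f -> I (pihomog mdeg d f).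

Definition prime_ideal I : Prop :=
  [/\ is_ideal I, ~ I 1 & forall f g, I (f * g) -> I f \/ I g].

Definition ideal_gen (s : seq S) : S -> Prop :=
  fun f => exists c : nat -> S, f = \sum_(i < size s) c i * s`_i.

Definition saturation I : S -> Prop :=
  fun f => exists k : nat, forall g, g \is k.-homog -> I (g * f).

(* The scheme of I is contained in the scheme of J.                           *)
Definition subscheme I J : Prop :=
  forall f, saturation J f -> saturation I f.

Definition same_scheme I J : Prop :=
  forall f, saturation I f <-> saturation J f.

(* The scheme-theoretic intersection has ideal I + J.                         *)
Definition scheme_inter I J : S -> Prop :=
  fun f => exists g h, [/\ I g, J h & f = g + h].

Definition regular_seq (s : seq S) : Prop :=
  ~ ideal_gen s 1 /\
  forall i, (i < size s)%N ->
    forall f, ideal_gen (take i s) (f * s`_i) -> ideal_gen (take i s) f.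

Definition peval (f : S) (p : 'rV[K]_n) : K := f.@[fun i => p 0 i].

Definition jacobian (c : nat) (f : 'I_c -> S) (p : 'rV[K]_n) : 'M[K]_(c, n) :=
  \matrix_(i < c, j < n) peval ((f i)^`M(j)) p.

(* Jacobian criterion for a scheme of pure codimension c over an              *)
(* algebraically closed field; p ranges over homogeneous coordinates.         *)
Definition smooth_of_codim (c : nat) I : Prop :=
  forall p : 'rV[K]_n, p != 0 -> (forall f, I f -> peval f p = 0) ->
    exists f : 'I_c -> S, (forall i, I (f i)) /\ \rank (jacobian f p) = c.

(* dim_K (S / I)_d = m: some m forms of degree d are a basis of S_d mod I_d.   *)
Definition hilbert_fun I (d m : nat) : Prop :=
  exists b : 'I_m -> S,
    (forall i, b i \is d.-homog) /\
    forall f, f \is d.-homog ->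
      exists! c : 'rV[K]_m, I (f - \sum_(i < m) c 0 i *: b i).

(* The Hilbert polynomial is d t + 1 - g: a one-dimensional scheme of degree  *)
(* d and arithmetic genus g.                                                  *)
Definition curve_of_degree_genus I (d : nat) (g : int) : Prop :=
  (0 < d)%N /\
  exists t0 : nat, forall t : nat, (t0 <= t)%N ->
    exists m : nat, hilbert_fun I t m /\ m%:Z = d%:Z * t%:Z + 1 - g.

Definition curve_of_degree I (d : nat) : Prop :=
  exists g : int, curve_of_degree_genus I d g.

(* For I prime: S / I is integrally closed in its field of fractions.  The    *)
(* fraction is a / b, and the hypothesis is an equation of integral           *)
(* dependence multiplied by b ^+ m.                                           *)
Definition projectively_normal I : Prop :=
  forall (a b : S) (m : nat) (c : nat -> S), ~ I b ->
    I (a ^+ m + \sum_(i < m) c i * a ^+ i * b ^+ (m - i)) ->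
    exists r : S, I (a - r * b).

Definition linform (l : 'rV[K]_n) : S := \sum_(j < n) l 0 j *: 'X_j.

(* The linear subspace of codimension c cut out by the rows of L, for L of     *)
(* rank c.                                                                    *)
Definition linforms (c : nat) (L : 'M[K]_(c, n)) : seq S :=
  [seq linform (row i L) | i <- enum 'I_c].

(* The quadratic form x A x^T; for A symmetric, the rank of the quadric is    *)
(* the rank of A.                                                             *)
Definition qform (A : 'M[K]_n) : S :=
  \sum_(i < n) \sum_(j < n) A i j *: ('X_i * 'X_j).

Definition symmetric_mx (A : 'M[K]_n) : Prop := A^T = A.

End ProjectiveSchemes.

Section General.
Variables (K : fieldType) (N : nat).

Definition zariski_open (U : 'rV[K]_N -> Prop) : Prop :=
  exists F : {mpoly K[N]} -> Prop,
    forall x, U x <-> exists2 f, F f & peval f x != 0.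

(* P holds for the general member of the family M, with coords embedding the  *)
(* parameter space T in an affine space: P holds on a nonempty, dense,        *)
(* relatively Zariski open subset of M.                                       *)
Definition general_member (T : Type) (coords : T -> 'rV[K]_N)
    (M P : T -> Prop) : Prop :=
  exists U : 'rV[K]_N -> Prop,
    [/\ zariski_open U,
        exists x, M x /\ U (coords x),
        forall U' : 'rV[K]_N -> Prop, zariski_open U' ->
          (exists x, M x /\ U' (coords x)) ->
          exists x, [/\ M x, U (coords x) & U' (coords x)]
      & forall x, M x -> U (coords x) -> P x].

End General.

Section Genus5.
Variable K : fieldType.
Local Notation S := {mpoly K[7]}.

(* A V_8 is given by a basis of its net of quadrics, as three symmetric         *)
(* matrices; the symmetric triples carry the topology induced from all        *)
(* triples of matrices.                                                       *)
Definition net_coords (A : 'I_3 -> 'M[K]_7) : 'rV[K]_(3 * (7 * 7)) :=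
  mxvec (\matrix_(k < 3) mxvec (A k)).

Definition net_forms (A : 'I_3 -> 'M[K]_7) : seq S :=
  [seq qform (A k) | k <- enum 'I_3].

Definition V8_ideal (A : 'I_3 -> 'M[K]_7) : S -> Prop :=
  ideal_gen (net_forms A).

Definition is_V8 (A : 'I_3 -> 'M[K]_7) : Prop :=
  [/\ forall k, symmetric_mx (A k),
      regular_seq (net_forms A)
    & smooth_of_codim 3 (V8_ideal A)].

(* A smooth integral curve of degree d in P^6 whose arithmetic genus, equal   *)
(* to its geometric genus by smoothness, is 1.                                *)
Definition elliptic_curve (C : S -> Prop) (d : nat) : Prop :=
  [/\ homogeneous_ideal C, prime_ideal C,
      curve_of_degree_genus C d 1 & smooth_of_codim 5 C].

(* The linear forms L define a 3-space, on which A and B define quadrics.     *)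
(* The curve may be singular, reducible or nonreduced.                        *)
Definition elliptic_quartic_on (V C : S -> Prop) : Prop :=
  [/\ homogeneous_ideal C, curve_of_degree C 4, subscheme C V
    & exists (L : 'M[K]_(3, 7)) (A B : 'M[K]_7),
        let s := linforms L ++ [:: qform A; qform B] in
        [/\ \rank L = 3%N, symmetric_mx A, symmetric_mx B,
            regular_seq s & same_scheme C (ideal_gen s)]].

End Genus5.

(* Main.v *)
Require Import Defs.
From HB Require Import structures.
From mathcomp Require Import all_boot all_order all_algebra.
From mathcomp Require Import mpoly reals complex.
From mathcomp Require Import perm separable ring zify.

Set Implicit Arguments.
Unset Strict Implicit.
Unset Printing Implicit Defensive.

Import Order.TTheory GRing.Theory Num.Theory.
Local Open Scope ring_scope.

(** The general member is described by finitely many conditions, each of which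
    is shown to hold on a nonempty principal open subset of the irreducible space
    of symmetric triples ([generic], [net_irreducible]): the three quadrics form a
    regular sequence ([generic_regular]) with smooth intersection
    ([generic_smooth]), every quadric of the net has rank at least 6
    ([generic_rank]), and the threefold contains a projectively normal elliptic
    quartic ([generic_curve]). A condition is spread from one explicit net to a
    neighbourhood by elementary forms of properness: [elimination] for the
    emptiness of a family of projective varieties, and [lift_eigenvalue] for the
    choice of a root of a polynomial with regular coefficients.

    Existence of the curve: some quadric [q] of the pencil spanned by the first
    two is a cone, and contains 3-spaces; one of them is found by solving
    successively three quadratic equations ([frame]). On such a 3-space the net
    cuts only the pencil spanned by two quadrics, and if this pencil is general it
    is [sum x_i^2, sum c_i x_i^2] in suitable coordinates, with distinct [c_i]
    ([simultaneous_diag]). The curve with these equations is parametrised by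
    quadratic polynomials and a square root: with [h] a product of four linear
    forms in [s], [t], the first three coordinates are proportional to
    [s^2 + t^2], [s^2 - t^2], [2 s t] and the last one is [sqrt h]. So its ideal is
    the kernel of a ring morphism [theta] to the domain [K[s, t][sqrt h]], whose
    image consists of the elements of even degree. Integral closedness of this
    image is the statement that if [a + b * sqrt h] is integral over [K[s, t]],
    then [a] and [b] are polynomials, [h] being squarefree; it is proved one
    variable at a time. The Hilbert function and the Jacobian criterion are
    explicit.

    The 3-space of an elliptic quartic [C]: let [f], [g] be the two quadrics that
    cut [C] in its 3-space [Lambda]. The ideal [(f, g)] of the coordinate ring of
    [Lambda] is saturated ([ci_saturated]), so each quadric of the net restricts to
    a combination of [f] and [g]. Restriction thus maps a space of dimension 3 to
    one of dimension 2, and a nonzero quadric [Q] of the net contains [Lambda]. It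
    has rank at most 6 because it contains a 3-space, hence exactly 6. If the
    kernel had dimension 2, then the singular point [v] of some member of a pencil
    of quadrics containing [Lambda] would lie on the third quadric, since the
    adjugate of a quadric of corank 1 is [v^T v] up to a scalar, and the condition
    is a binary form in the pencil ([pencil_root]). The threefold would be singular
    at [v] ([no_isotropic_pencil]). So [f] and [g] are restrictions of quadrics of
    the net, and [C] is the intersection of the threefold with [Lambda]. *)

(** * Regular functions and Zariski-open conditions *)

(** A subalgebra of the [K]-valued functions on a parameter space [X]; its
    members are called regular. *)
Record falg (K : fieldType) (X : Type) := FAlg {
  freg :> (X -> K) -> Prop;
  freg_ext : forall f g, freg f -> f =1 g -> freg g;
  freg_cst : forall c, freg (fun=> c);
  freg_add : forall f g, freg f -> freg g -> freg (fun x => f x + g x);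
  freg_mul : forall f g, freg f -> freg g -> freg (fun x => f x * g x) }.

Section RegularFunctions.
Variables (K : fieldType) (X : Type) (O : falg K X).

Lemma freg_sum (I : Type) (r : seq I) (P : pred I) (F : I -> X -> K) :
  (forall i, O (F i)) -> O (fun x => \sum_(i <- r | P i) F i x).
Proof.
move=> hF; elim: r => [|i r IH].
  by apply: freg_ext (freg_cst O 0) _ => x; rewrite big_nil.
have [Pi|nPi] := boolP (P i).
  by apply: freg_ext (freg_add (hF i) IH) _ => x; rewrite big_cons Pi.
by apply: freg_ext IH _ => x; rewrite big_cons (negbTE nPi).
Qed.

Lemma freg_prod (I : Type) (r : seq I) (P : pred I) (F : I -> X -> K) :
  (forall i, O (F i)) -> O (fun x => \prod_(i <- r | P i) F i x).
Proof.
move=> hF; elim: r => [|i r IH].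
  by apply: freg_ext (freg_cst O 1) _ => x; rewrite big_nil.
have [Pi|nPi] := boolP (P i).
  by apply: freg_ext (freg_mul (hF i) IH) _ => x; rewrite big_cons Pi.
by apply: freg_ext IH _ => x; rewrite big_cons (negbTE nPi).
Qed.

Lemma freg_opp f : O f -> O (fun x => - f x).
Proof.
move=> hf; apply: freg_ext (freg_mul (freg_cst O (-1)) hf) _ => x.
by rewrite mulN1r.
Qed.

Lemma freg_sub f g : O f -> O g -> O (fun x => f x - g x).
Proof. by move=> hf hg; apply: freg_add hf (freg_opp hg). Qed.

Lemma freg_scale c f : O f -> O (fun x => c * f x).
Proof. by move=> hf; apply: freg_mul (freg_cst O c) hf. Qed.

Lemma freg_exp k f : O f -> O (fun x => f x ^+ k).
Proof.
move=> hf; elim: k => [|k IH].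
  by apply: freg_ext (freg_cst O 1) _ => x.
by apply: freg_ext (freg_mul hf IH) _ => x; rewrite exprS.
Qed.

(** Matrices with regular entries. *)
Definition mreg m n (M : X -> 'M[K]_(m, n)) := forall i j, O (fun x => M x i j).

Lemma mreg_mul m n p (A : X -> 'M[K]_(m, n)) (B : X -> 'M[K]_(n, p)) :
  mreg A -> mreg B -> mreg (fun x => A x *m B x).
Proof.
move=> hA hB i j.
apply: (@freg_ext _ _ _ (fun x => \sum_k A x i k * B x k j)); last first.
  by move=> x; rewrite mxE.
by apply: freg_sum => k; apply: freg_mul.
Qed.

Lemma mreg_add m n (A B : X -> 'M[K]_(m, n)) :
  mreg A -> mreg B -> mreg (fun x => A x + B x).
Proof.
move=> hA hB i j.
by apply: freg_ext (freg_add (hA i j) (hB i j)) _ => x; rewrite mxE.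
Qed.

Lemma mreg_scale m n (f : X -> K) (A : X -> 'M[K]_(m, n)) :
  O f -> mreg A -> mreg (fun x => f x *: A x).
Proof.
by move=> hf hA i j; apply: freg_ext (freg_mul hf (hA i j)) _ => x; rewrite mxE.
Qed.

Lemma mreg_cst m n (A : 'M[K]_(m, n)) : mreg (fun=> A).
Proof. by move=> i j; apply: freg_cst. Qed.

Lemma mreg_sub m n (A B : X -> 'M[K]_(m, n)) :
  mreg A -> mreg B -> mreg (fun x => A x - B x).
Proof.
move=> hA hB i j.
by apply: freg_ext (freg_sub (hA i j) (hB i j)) _ => x; rewrite !mxE.
Qed.

Lemma mreg_tr m n (A : X -> 'M[K]_(m, n)) : mreg A -> mreg (fun x => (A x)^T).
Proof. by move=> hA i j; apply: freg_ext (hA j i) _ => x; rewrite mxE. Qed.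

Lemma mreg_row m n (A : X -> 'M[K]_(m, n)) i :
  mreg A -> mreg (fun x => row i (A x)).
Proof. by move=> hA k j; apply: freg_ext (hA i j) _ => x; rewrite mxE. Qed.

Lemma mreg_det n (A : X -> 'M[K]_n) : mreg A -> O (fun x => \det (A x)).
Proof.
move=> hA; apply: freg_sum => s; apply: freg_mul; first exact: freg_cst.
by apply: freg_prod => i; apply: hA.
Qed.

Lemma mreg_adj n (A : X -> 'M[K]_n) : mreg A -> mreg (fun x => \adj (A x)).
Proof.
move=> hA i j.
apply: (@freg_ext _ _ _ (fun x => (-1) ^+ (j + i) *
          \det (row' j (col' i (A x))))); last by move=> x; rewrite mxE.
apply: freg_scale; apply: mreg_det => k l.
by apply: freg_ext (hA (lift j k) (lift i l)) _ => x; rewrite !mxE.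
Qed.

Lemma mreg_exp n (A : X -> 'M[K]_n.+1) k :
  mreg A -> mreg (fun x => A x ^+ k).
Proof.
move=> hA; elim: k => [|k IH].
  exact: mreg_cst.
move=> i j; apply: freg_ext (mreg_mul hA IH i j) _ => x.
by rewrite exprS.
Qed.

(** Univariate polynomials of bounded degree with regular coefficients. *)
Definition preg (P : X -> {poly K}) :=
  (exists n, forall x, (size (P x) <= n)%N) /\
  forall i, O (fun x => (P x)`_i).

Lemma preg_ext P Q : preg P -> P =1 Q -> preg Q.
Proof.
move=> [[n hn] hP] e; split; first by exists n => x; rewrite -e.
by move=> i; apply: freg_ext (hP i) _ => x; rewrite e.
Qed.

Lemma preg_C f : O f -> preg (fun x => (f x)%:P).
Proof.
move=> hf; split; first by exists 1%N => x; rewrite size_polyC; case: eqP.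
move=> [|i].
  by apply: freg_ext hf _ => x; rewrite coefC.
by apply: freg_ext (freg_cst O 0) _ => x; rewrite coefC.
Qed.

Lemma preg_X : preg (fun=> 'X).
Proof.
split; first by exists 2%N => x; rewrite size_polyX.
by move=> i; apply: freg_cst.
Qed.

Lemma preg_add P Q : preg P -> preg Q -> preg (fun x => P x + Q x).
Proof.
move=> [[n hn] hP] [[m hm] hQ]; split.
  exists (maxn n m) => x; apply: leq_trans (size_polyD _ _) _.
  by rewrite geq_max !leq_max hn hm orbT.
by move=> i; apply: freg_ext (freg_add (hP i) (hQ i)) _ => x; rewrite coefD.
Qed.

Lemma preg_mul P Q : preg P -> preg Q -> preg (fun x => P x * Q x).
Proof.
move=> [[n hn] hP] [[m hm] hQ]; split.
  exists (n + m)%N => x; apply: leq_trans (size_polyMleq _ _) _.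
  by apply: leq_trans (leq_pred _) _; apply: leq_add.
move=> i; apply: (@freg_ext _ _ _
   (fun x => \sum_(j < i.+1) (P x)`_j * (Q x)`_(i - j))); last first.
  by move=> x; rewrite coefM.
by apply: freg_sum => j; apply: freg_mul.
Qed.

Lemma preg_sum (I : Type) (r : seq I) (P : pred I) (F : I -> X -> {poly K}) :
  (forall i, preg (F i)) -> preg (fun x => \sum_(i <- r | P i) F i x).
Proof.
move=> hF; elim: r => [|i r IH].
  by apply: preg_ext (preg_C (freg_cst O 0)) _ => x; rewrite big_nil.
have [Pi|nPi] := boolP (P i).
  by apply: preg_ext (preg_add (hF i) IH) _ => x; rewrite big_cons Pi.
by apply: preg_ext IH _ => x; rewrite big_cons (negbTE nPi).
Qed.

Lemma preg_prod (I : Type) (r : seq I) (P : pred I) (F : I -> X -> {poly K}) :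
  (forall i, preg (F i)) -> preg (fun x => \prod_(i <- r | P i) F i x).
Proof.
move=> hF; elim: r => [|i r IH].
  by apply: preg_ext (preg_C (freg_cst O 1)) _ => x; rewrite big_nil.
have [Pi|nPi] := boolP (P i).
  by apply: preg_ext (preg_mul (hF i) IH) _ => x; rewrite big_cons Pi.
by apply: preg_ext IH _ => x; rewrite big_cons (negbTE nPi).
Qed.

Lemma preg_deriv P : preg P -> preg (fun x => (P x)^`()).
Proof.
move=> [[n hn] hP]; split.
  exists n => x; apply: leq_trans (hn x); rewrite /deriv.
  by apply: leq_trans (size_poly _ _) _; apply: leq_pred.
move=> i; apply: freg_ext (freg_mul (hP i.+1) (freg_cst O i.+1%:R)) _ => x.
by rewrite coef_deriv mulr_natr.
Qed.

(** The characteristic polynomial of a matrix with regular entries. *)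
Lemma preg_char n (A : X -> 'M[K]_n) :
  mreg A -> preg (fun x => char_poly (A x)).
Proof.
move=> hA; rewrite /char_poly /determinant; apply: preg_sum => s.
apply: preg_mul.
  have h := preg_C (freg_cst O ((-1) ^+ perm.odd_perm s)).
  by apply: preg_ext h _ => x; rewrite rmorphXn /= polyCN.
apply: preg_prod => i.
have h1 : preg (fun=> (i == (s : {perm _}) i)%:R * 'X).
  have h := preg_mul (preg_C (freg_cst O (i == (s : {perm _}) i)%:R)) preg_X.
  by apply: preg_ext h _ => x; rewrite polyC_natr.
apply: preg_ext (preg_add h1 (preg_C (freg_opp (hA i ((s : {perm _}) i))))) _ => x.
by rewrite /char_poly_mx !mxE polyCN mulr_natl.
Qed.

(** Substituting a matrix with regular entries into a polynomial family. *)
Lemma mreg_horner n (A : X -> 'M[K]_n.+1) P :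
  mreg A -> preg P -> mreg (fun x => horner_mx (A x) (P x)).
Proof.
move=> hA [[m hm] hP] i j.
apply: (@freg_ext _ _ _ (fun x => \sum_(k < m) (P x)`_k * (A x ^+ k) i j)).
  by apply: freg_sum => k; apply: freg_mul => //; apply: mreg_exp.
move=> x; rewrite /horner_mx /horner_morph.
rewrite (@horner_coef_wide _ m); last first.
  by rewrite (leq_trans _ (hm x)) // size_poly.
rewrite summxE; apply: eq_bigr => k _.
by rewrite coef_map /= -[_%:M * _]/(_ *m _) mul_scalar_mx mxE.
Qed.

End RegularFunctions.

(** The regular functions on [X * K]: polynomials in the second coordinate. *)
Section ProductAlgebra.
Variables (K : fieldType) (X : Type) (O : falg K X).

Definition prod_reg (F : X * K -> K) :=
  exists2 P, preg O P & forall z, F z = (P z.1).[z.2].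

Lemma prod_reg_ext F G : prod_reg F -> F =1 G -> prod_reg G.
Proof. by move=> [P hP e] FG; exists P => // z; rewrite -FG. Qed.

Lemma prod_reg_cst c : prod_reg (fun=> c).
Proof.
exists (fun=> c%:P); first exact/preg_C/freg_cst.
by move=> z; rewrite hornerC.
Qed.

Lemma prod_reg_add F G :
  prod_reg F -> prod_reg G -> prod_reg (fun z => F z + G z).
Proof.
move=> [P hP e] [Q hQ e']; exists (fun x => P x + Q x); first exact: preg_add.
by move=> z; rewrite hornerD e e'.
Qed.

Lemma prod_reg_mul F G :
  prod_reg F -> prod_reg G -> prod_reg (fun z => F z * G z).
Proof.
move=> [P hP e] [Q hQ e']; exists (fun x => P x * Q x); first exact: preg_mul.
by move=> z; rewrite hornerM e e'.
Qed.

Definition falg_prod : falg K (X * K) :=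
  FAlg prod_reg_ext prod_reg_cst prod_reg_add prod_reg_mul.

Lemma falg_prod_fst f : O f -> falg_prod (fun z => f z.1).
Proof.
move=> hf; exists (fun x => (f x)%:P); first exact: preg_C.
by move=> z; rewrite hornerC.
Qed.

Lemma falg_prod_snd : falg_prod (fun z => z.2).
Proof. by exists (fun=> 'X); [apply: preg_X | move=> z; rewrite hornerX]. Qed.

Lemma mreg_fst m n (A : X -> 'M[K]_(m, n)) :
  mreg O A -> mreg falg_prod (fun z => A z.1).
Proof. by move=> hA i j; exact: falg_prod_fst (hA i j). Qed.

End ProductAlgebra.

Lemma matrix_neq0P (K : fieldType) m n (A : 'M[K]_(m, n)) :
  A != 0 -> exists i j, A i j != 0.
Proof.
move=> A0; have: [exists i, [exists j, A i j != 0]].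
  apply: contraR A0 => h; apply/eqP/matrixP => i j; rewrite mxE.
  move: h; rewrite negb_exists => /forallP/(_ i).
  by rewrite negb_exists => /forallP/(_ j); rewrite negbK => /eqP.
by case/existsP => i /existsP[j h]; exists i, j.
Qed.

(** If a regular function on [X * K] is nonzero at an eigenvalue of [M x0], then
    for [x] in an open neighbourhood of [x0] it is nonzero at some eigenvalue of
    [M x]. A polynomial vanishing at all eigenvalues of a matrix of size [n] has
    its [n]-th power divisible by the characteristic polynomial, so the entries
    of the [n]-th power of the value of the polynomial at [M x] are the functions
    wanted. *)
Lemma lift_eigenvalue (K : closedFieldType) (X : Type) (O : falg K X) n
    (M : X -> 'M[K]_n.+1) (F : X * K -> K) x0 t0 :
  mreg O M -> falg_prod O F -> eigenvalue (M x0) t0 -> F (x0, t0) != 0 ->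
  exists E, [/\ O E, E x0 != 0 &
    forall x, E x != 0 -> exists2 t, eigenvalue (M x) t & F (x, t) != 0].
Proof.
move=> hM [P hP eF] /eigenvalueP[v vM v0] F0.
pose G x := horner_mx (M x) (P x) ^+ n.+1.
have hG : mreg O G by apply/mreg_exp/mreg_horner.
have vG k : v *m horner_mx (M x0) (P x0) ^+ k = (P x0).[t0] ^+ k *: v.
  elim: k => [|k IH]; first by rewrite !expr0 mulmx1 scale1r.
  rewrite exprSr -[_ * _]/(_ *m _) mulmxA IH -scalemxAl.
  rewrite (_ : v *m _ = (P x0).[t0] *: v) ?scalerA ?exprSr //.
  clear IH.
  elim/poly_ind: (P x0) => [|p c IH].
    by rewrite rmorph0 mulmx0 horner0 scale0r.
  rewrite rmorphD rmorphM /= horner_mx_X horner_mx_C mulmxDr mulmxA IH.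
  by rewrite -scalemxAl vM mul_mx_scalar hornerMXaddC scalerA scalerDl.
have G0 : G x0 != 0.
  apply/eqP => G0; have := vG n.+1; rewrite -/(G x0) G0 mulmx0.
  move/esym/eqP; rewrite scalemx_eq0 (negbTE v0) orbF expf_eq0 /=.
  by move: F0; rewrite eF => /negbTE ->.
have [i [j Gij]] := matrix_neq0P G0.
exists (fun x => G x i j); split => // x Gx.
have [rs ers] := closed_field_poly_normal (char_poly (M x)).
move: ers; rewrite (monicP (char_poly_monic _)) scale1r => ers.
have [/hasP[t trs Ft]|/hasPn h] := boolP (has (fun t => (P x).[t] != 0) rs).
  exists t; last by rewrite eF.
  by rewrite eigenvalue_root_char ers root_prod_XsubC.
suff /dvdpP[q eq] : char_poly (M x) %| P x ^+ n.+1.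
  have : G x = 0.
    by rewrite /G -rmorphXn eq /= rmorphM /= Cayley_Hamilton mulr0.
  by move=> G00; rewrite G00 mxE eqxx in Gx.
have szr : size rs = n.+1.
  by have := size_char_poly (M x); rewrite ers size_prod_XsubC => -[].
rewrite ers -szr; elim: rs h {ers szr} => [|t rs IH] h.
  by rewrite big_nil expr0 dvdpp.
rewrite big_cons exprS dvdp_mul //.
  by rewrite dvdp_XsubCl; have := h t (mem_head _ _); rewrite negbK.
by apply: IH => u urs; apply: h; rewrite inE urs orbT.
Qed.

(** * Elimination of projective variables *)

Section Forms.
Variables (K : fieldType) (X : Type) (O : falg K X) (n : nat).
Implicit Types g : X -> 'rV[K]_n -> K.

(** Families of forms of degree [d] in [p], with regular coefficients. They are
    written as linear combinations of words in the coordinates of [p]; equal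
    monomials need not be collected. *)
Definition rform d g := exists (T : finType) (w : T -> d.-tuple 'I_n)
    (c : T -> X -> K),
  (forall k, O (c k)) /\
  forall x p, g x p = \sum_k c k x * \prod_(i <- w k) p 0 i.

Lemma rform_ext d g g' : rform d g -> (forall x p, g x p = g' x p) -> rform d g'.
Proof.
by move=> [T [w [c [hc e]]]] e'; exists T, w, c; split => // x p; rewrite -e'.
Qed.

Lemma rform_deg d d' g : rform d g -> d = d' -> rform d' g.
Proof. by move=> h <-. Qed.

Lemma rform_cst f : O f -> rform 0 (fun x _ => f x).
Proof.
move=> hf; exists unit, (fun=> [tuple]), (fun=> f); split => // x p.
by rewrite big_const card_unit /= big_nil mulr1 addr0.
Qed.

Lemma rform_X i : rform 1 (fun _ p => p 0 i).
Proof.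
exists unit, (fun=> [tuple i]), (fun=> fun=> 1); split => [_|x p].
  exact: freg_cst.
by rewrite big_const card_unit /= big_seq1 mul1r addr0.
Qed.

Lemma rform_0 d : rform d (fun _ _ => 0).
Proof.
exists void, (of_void _), (of_void _); split => [[]|x p].
by rewrite big_pred0 // => -[].
Qed.

Lemma rform_add d g g' :
  rform d g -> rform d g' -> rform d (fun x p => g x p + g' x p).
Proof.
move=> [T [w [c [hc e]]]] [T' [w' [c' [hc' e']]]].
exists (T + T')%type,
  (fun k => match k with inl k => w k | inr k => w' k end),
  (fun k => match k with inl k => c k | inr k => c' k end).
split => [[k|k] //|x p].
by rewrite big_sumType /= e e'.
Qed.

Lemma rform_mul d d' g g' : rform d g -> rform d' g' ->
  rform (d + d') (fun x p => g x p * g' x p).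
Proof.
move=> [T [w [c [hc e]]]] [T' [w' [c' [hc' e']]]].
exists (T * T')%type, (fun k => [tuple of w k.1 ++ w' k.2]),
  (fun k x => c k.1 x * c' k.2 x); split => [k|x p].
  exact: freg_mul.
rewrite e e' big_distrlr /= pair_bigA /=; apply: eq_bigr => k _.
by rewrite big_cat /= mulrACA.
Qed.

Lemma rform_scale d f g : O f -> rform d g -> rform d (fun x p => f x * g x p).
Proof. by move=> hf hg; apply: rform_mul (rform_cst hf) hg. Qed.

Lemma rform_sum d (I : Type) (r : seq I) (P : pred I) F :
  (forall i, rform d (F i)) -> rform d (fun x p => \sum_(i <- r | P i) F i x p).
Proof.
move=> hF; elim: r => [|i r IH].
  by apply: rform_ext (rform_0 d) _ => x p; rewrite big_nil.
have [Pi|nPi] := boolP (P i).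
  by apply: rform_ext (rform_add (hF i) IH) _ => x p; rewrite big_cons Pi.
by apply: rform_ext IH _ => x p; rewrite big_cons (negbTE nPi).
Qed.

Lemma rform_prod d (I : Type) (r : seq I) F :
  (forall i, rform d (F i)) ->
  rform (size r * d) (fun x p => \prod_(i <- r) F i x p).
Proof.
move=> hF; elim: r => [|i r IH].
  by apply: rform_ext (rform_cst (freg_cst O 1)) _ => x p; rewrite big_nil.
by apply: rform_ext (rform_mul (hF i) IH) _ => x p; rewrite big_cons.
Qed.

Lemma rform_exp d k g : rform d g -> rform (k * d) (fun x p => g x p ^+ k).
Proof.
move=> hg; elim: k => [|k IH].
  by apply: rform_ext (rform_cst (freg_cst O 1)) _.
by apply: rform_ext (rform_mul hg IH) _ => x p; rewrite exprS.
Qed.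

Lemma rform_det d k (M : X -> 'rV[K]_n -> 'M[K]_k) :
  (forall i j, rform d (fun x p => M x p i j)) ->
  rform (k * d) (fun x p => \det (M x p)).
Proof.
move=> hM; apply: rform_sum => s; apply: rform_scale; first exact: freg_cst.
apply: rform_deg (rform_prod _ _) _ => [i|]; first exact: hM.
by rewrite -[in RHS](size_enum_ord k) /index_enum -enumT.
Qed.

Variables (bad : X -> 'rV[K]_n -> Prop) (x0 : X).

(** [lifted d f]: the form [f] of degree [d] is the value at [x0] of a family of
    forms vanishing wherever [bad] holds. *)
Definition lifted d (f : 'rV[K]_n -> K) := exists g,
  [/\ rform d g, forall x p, bad x p -> g x p = 0 & forall p, g x0 p = f p].

Lemma lifted_ext d f f' : lifted d f -> f =1 f' -> lifted d f'.
Proof. by move=> [g [h1 h2 h3]] e; exists g; split => // p; rewrite -e. Qed.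

Lemma lifted_add d f f' :
  lifted d f -> lifted d f' -> lifted d (fun p => f p + f' p).
Proof.
move=> [g [h1 h2 h3]] [g' [h1' h2' h3']]; exists (fun x p => g x p + g' x p).
split; first exact: rform_add.
  by move=> x p b; rewrite h2 // h2' // addr0.
by move=> p; rewrite h3 h3'.
Qed.

Lemma lifted_0 d : lifted d (fun=> 0).
Proof. by exists (fun _ _ => 0); split => //; apply: rform_0. Qed.

(** A form with constant coefficients. *)
Definition cform d (f : 'rV[K]_n -> K) := rform d (fun=> f).

Lemma lifted_mul d d' f f' : cform d f -> lifted d' f' ->
  lifted (d + d') (fun p => f p * f' p).
Proof.
move=> hf [g' [h1' h2' h3']]; exists (fun x p => f p * g' x p).
split; first exact: rform_mul.
  by move=> x p b; rewrite h2' // mulr0.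
by move=> p; rewrite h3'.
Qed.

Lemma lifted_scale d c f : lifted d f -> lifted d (fun p => c * f p).
Proof. by move=> hf; apply: lifted_mul (rform_cst (freg_cst O c)) hf. Qed.

Lemma lifted_sub d f f' :
  lifted d f -> lifted d f' -> lifted d (fun p => f p - f' p).
Proof.
move=> h h'; apply: lifted_ext (lifted_add h (lifted_scale (-1) h')) _ => p.
by rewrite mulN1r.
Qed.

Lemma lifted_sum d (I : Type) (r : seq I) (P : pred I) F :
  (forall i, P i -> lifted d (F i)) ->
  lifted d (fun p => \sum_(i <- r | P i) F i p).
Proof.
move=> hF; elim: r => [|i r IH].
  by apply: lifted_ext (lifted_0 d) _ => p; rewrite big_nil.
have [Pi|nPi] := boolP (P i).
  by apply: lifted_ext (lifted_add (hF i Pi) IH) _ => p; rewrite big_cons Pi.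
by apply: lifted_ext IH _ => p; rewrite big_cons (negbTE nPi).
Qed.

(** A word with more than [n * d] letters contains some letter [d] times. *)
Lemma word_pigeonhole d (u : (n * d + d.+1).-tuple 'I_n) :
  exists i (v : (n * d + 1).-tuple 'I_n), forall p : 'rV[K]_n,
    \prod_(j <- u) p 0 j = p 0 i ^+ d * \prod_(j <- v) p 0 j.
Proof.
have [i hi] : exists i : 'I_n, (d <= count_mem i u)%N.
  have [/existsP[i hi]|h] := boolP [exists i : 'I_n, (d <= count_mem i u)%N].
    by exists i.
  have {}h i : (count_mem i u < d)%N.
    by rewrite ltnNge; apply: contra h => hi; apply/existsP; exists i.
  exfalso.
  have : (\sum_(i < n) count_mem i u <= \sum_(i < n) d)%N.
    by apply: leq_sum => i _; apply: ltnW.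
  rewrite sum_nat_const card_ord.
  rewrite (_ : (\sum_(i < n) _)%N = size u); last first.
    rewrite (eq_bigr (fun i => \sum_(j <- u) (j == i))%N); last first.
      by move=> i _; rewrite -sum1_count big_mkcond.
    rewrite exchange_big /= (eq_bigr (fun=> 1%N)) ?sum1_size // => j _.
    rewrite (bigD1 j) //= eqxx big1 ?addn0 // => k.
    by rewrite eq_sym => /negbTE ->.
  by rewrite size_tuple leqNgt addnS ltnS leq_addr.
have szv : size (nseq (count_mem i u - d) i ++ filter (predC1 i) u)
   == (n * d + 1)%N.
  rewrite size_cat size_nseq size_filter -(eqn_add2l d) addnA subnKC //.
  by rewrite count_predC size_tuple addnS addn1 addnS addnC.
exists i, (Tuple szv) => p /=.
rewrite big_cat /= big_nseq mulrA.
have -> : iter (count_mem i u - d) ( *%R (p 0 i)) 1 = p 0 i ^+ (count_mem i u - d).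
  by elim: (_ - _)%N => [|k IH] //=; rewrite IH exprS.
rewrite -exprD subnKC // big_filter (bigID (pred1 i)) /=; congr (_ * _).
rewrite (eq_bigr (fun=> p 0 i)) => [|j /eqP-> //].
by rewrite big_const_seq -Monoid.iteropE.
Qed.

End Forms.

(** Properness of projective space in the form needed: if the forms vanishing on
    [bad] specialise at [x0] to a power of every coordinate, then [bad] has no
    nonzero point over an open neighbourhood of [x0]. A word of length
    [n * d + d + 1] contains some letter [d] times; the form that specialises to
    this power, multiplied by the other letters, gives the row of the word in a
    matrix [C x]. On the vector of all words of this length, evaluated at a point
    of [bad] over [x], the matrix [C x] is zero and [C x0] is the identity, so
    [1 + C x - C x0] is singular. *)
Lemma elimination (K : fieldType) (X : Type) (O : falg K X) n
    (bad : X -> 'rV[K]_n -> Prop) x0 d :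
  (forall i, lifted O bad x0 d (fun p => p 0 i ^+ d)) ->
  exists E, [/\ O E, E x0 != 0 & forall x p, E x != 0 -> bad x p -> p = 0].
Proof.
move=> /fin_all_exists[g hg].
have /fin_all_exists[T] := fun i => let: And3 h _ _ := hg i in h.
move=> /fin_all_exists[w] /fin_all_exists[c hc].
have /fin_all_exists[l] := @word_pigeonhole K n d.
move=> /fin_all_exists[v hv].
pose W : finType := (n * d + d.+1).-tuple 'I_n.
have szW (i : 'I_n) (k : T i) (u : W) : size (w i k ++ v u) == (n * d + d.+1)%N.
  by rewrite size_cat !size_tuple addnC -addnA add1n.
pose sub i k u : W := Tuple (szW i k u).
pose C x : 'M[K]_#|W| := \matrix_(a, b) \sum_(k : T (l (enum_val a)))
  c _ k x * (enum_val b == sub _ k (enum_val a))%:R.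
have hC : mreg O C.
  move=> a b; apply: (@freg_ext _ _ _ (fun x => \sum_(k : T (l (enum_val a)))
    c _ k x * (enum_val b == sub _ k (enum_val a))%:R)); last first.
    by move=> x; rewrite mxE.
  apply: freg_sum => k; apply: freg_mul; last exact: freg_cst.
  by case: (hc (l (enum_val a))).
pose vec (p : 'rV[K]_n) : 'cV[K]_#|W| :=
  \col_a \prod_(j <- (enum_val a : W)) p 0 j.
have Cvec x p a : (C x *m vec p) a 0
   = g (l (enum_val a)) x p * \prod_(j <- v (enum_val a)) p 0 j.
  case: (hc (l (enum_val a))) => _ ->.
  rewrite mxE (eq_bigr (fun b => \sum_(k : T (l (enum_val a)))
    c _ k x * ((enum_val b == sub _ k (enum_val a))%:R *
      \prod_(j <- (enum_val b : W)) p 0 j))); last first.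
    by move=> b _; rewrite !mxE mulr_suml; apply: eq_bigr => k _; rewrite mulrA.
  rewrite exchange_big mulr_suml; apply: eq_bigr => k _ /=.
  rewrite -mulr_sumr -mulrA -big_cat /=; congr (_ * _).
  rewrite (bigD1 (enum_rank (sub _ k (enum_val a)))) //= enum_rankK eqxx mul1r.
  rewrite [X in _ + X]big1 ?addr0 // => b hb; case: eqP => [eb|_]; last by rewrite mul0r.
  by rewrite -eb enum_valK eqxx in hb.
exists (fun x => \det (1%:M + (C x - C x0))); split.
- apply: mreg_det; apply: mreg_add; first exact: mreg_cst.
  by apply: mreg_sub => //; apply: mreg_cst.
- by rewrite subrr addr0 det1 oner_neq0.
move=> x p Ex bp; apply/eqP; apply: contraR Ex => p0.
have [i0 [i pi]] := matrix_neq0P p0; rewrite ord1 in pi => {i0}.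
have vec0 : vec p != 0.
  apply/eqP => /matrixP/(_ (enum_rank (nseq_tuple _ i : W)) 0).
  rewrite !mxE enum_rankK /= big_nseq -Monoid.iteropE => /eqP.
  by rewrite expf_eq0 (negbTE pi) andbF.
have : (1%:M + (C x - C x0)) *m vec p = 0.
  apply/matrixP => a b; rewrite ord1 mulmxDl mulmxBl mul1mx.
  rewrite mxE [X in _ + X]mxE [X in _ + (_ + X)]mxE !Cvec.
  case: (hg (l (enum_val a))) => _ -> // ->.
  by rewrite mul0r add0r -hv !mxE subrr.
rewrite -[_ *m _]trmxK trmx_mul => /(congr1 trmx); rewrite trmxK trmx0 => h.
rewrite -det_tr; apply/det0P; exists (vec p)^T => //.
by apply: contra vec0 => /eqP e; rewrite -[vec p]trmxK e trmx0.
Qed.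

(** * Quadratic extensions *)

(** The ring [R[sqrt h]], free over [R] with basis [1, sqrt h]; the pair [(a, b)]
    stands for [a + b * sqrt h]. *)
Definition quad (R : comNzRingType) (h : R) : Type := (R * R)%type.

Section Quad.
Variables (R : comNzRingType) (h : R).
Local Notation Q := (quad h).

HB.instance Definition _ := GRing.Zmodule.copy Q (R * R)%type.

Definition qpair (a b : R) : Q := (a, b).
Definition quad_mul (x y : Q) : Q :=
  qpair (x.1 * y.1 + h * (x.2 * y.2)) (x.1 * y.2 + x.2 * y.1).

Lemma qpairP (x y : Q) : x.1 = y.1 -> x.2 = y.2 -> x = y.
Proof. by case: x y => [a b] [c d] /= -> ->. Qed.

Lemma quad_mulA : associative quad_mul.
Proof. by move=> x y z; apply: qpairP => /=; ring. Qed.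
Lemma quad_mulC : commutative quad_mul.
Proof. by move=> x y; apply: qpairP => /=; ring. Qed.
Lemma quad_mul1 : left_id (qpair 1 0) quad_mul.
Proof. by move=> x; apply: qpairP => /=; ring. Qed.
Lemma quad_mulD : left_distributive quad_mul +%R.
Proof. by move=> x y z; apply: qpairP => /=; ring. Qed.
Lemma quad_1neq0 : qpair 1 0 != 0 :> Q.
Proof. by apply/eqP => /(congr1 fst)/eqP; rewrite oner_eq0. Qed.

HB.instance Definition _ := GRing.Zmodule_isComNzRing.Build Q
  quad_mulA quad_mulC quad_mul1 quad_mulD quad_1neq0.

Lemma quad_fst0 : (0 : Q).1 = 0. Proof. by []. Qed.
Lemma quad_snd0 : (0 : Q).2 = 0. Proof. by []. Qed.
Lemma quad_fst1 : (1 : Q).1 = 1. Proof. by []. Qed.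
Lemma quad_snd1 : (1 : Q).2 = 0. Proof. by []. Qed.
Lemma quad_fstD (x y : Q) : (x + y).1 = x.1 + y.1. Proof. by []. Qed.
Lemma quad_sndD (x y : Q) : (x + y).2 = x.2 + y.2. Proof. by []. Qed.
Lemma quad_fstN (x : Q) : (- x).1 = - x.1. Proof. by []. Qed.
Lemma quad_sndN (x : Q) : (- x).2 = - x.2. Proof. by []. Qed.
Lemma quad_fstM (x y : Q) : (x * y).1 = x.1 * y.1 + h * (x.2 * y.2).
Proof. by []. Qed.
Lemma quad_sndM (x y : Q) : (x * y).2 = x.1 * y.2 + x.2 * y.1.
Proof. by []. Qed.
Definition quadE := (quad_fst0, quad_snd0, quad_fst1, quad_snd1, quad_fstD,
  quad_sndD, quad_fstN, quad_sndN, quad_fstM, quad_sndM).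

(** The embedding of [R], the element [sqrt h], the conjugation and the norm. *)
Definition qconst (a : R) : Q := qpair a 0.
Definition qroot : Q := qpair 0 1.
Definition qconj (x : Q) : Q := qpair x.1 (- x.2).
Definition qnorm (x : Q) : R := x.1 ^+ 2 - h * x.2 ^+ 2.

Lemma qconst_is_additive : additive qconst.
Proof. by move=> a b; apply: qpairP; rewrite /= ?quadE /= ?subr0. Qed.
HB.instance Definition _ := GRing.isAdditive.Build R Q qconst qconst_is_additive.
Lemma qconst_is_multiplicative : multiplicative qconst.
Proof. by split => // a b; apply: qpairP; rewrite /= ?quadE /=; ring. Qed.
HB.instance Definition _ :=
  GRing.isMultiplicative.Build R Q qconst qconst_is_multiplicative.

Lemma mul_qconj x : x * qconj x = qconst (qnorm x).
Proof. by apply: qpairP; rewrite !quadE /= /qnorm; ring. Qed.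

Lemma qnormM x y : qnorm (x * y) = qnorm x * qnorm y.
Proof. by rewrite /qnorm !quadE; ring. Qed.

Lemma qroot_sqr : qroot * qroot = qconst h.
Proof. by apply: qpairP; rewrite !quadE /=; ring. Qed.

Lemma qconstM a x : qconst a * x = qpair (a * x.1) (a * x.2).
Proof. by apply: qpairP; rewrite !quadE /=; ring. Qed.

End Quad.

(** Functoriality of [quad]. *)
Section QuadMap.
Variables (R R' : comNzRingType) (f : {rmorphism R -> R'}) (h : R).

Definition qmap (x : quad h) : quad (f h) := qpair (f h) (f x.1) (f x.2).

Lemma qmap_is_additive : additive qmap.
Proof. by move=> x y; apply: qpairP; rewrite /= rmorphB. Qed.
HB.instance Definition _ :=
  GRing.isAdditive.Build (quad h) (quad (f h)) qmap qmap_is_additive.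
Lemma qmap_is_multiplicative : multiplicative qmap.
Proof.
split=> [x y|]; apply: qpairP; rewrite /= ?rmorph1 ?rmorph0 //.
  by rewrite rmorphD !rmorphM.
by rewrite rmorphD !rmorphM.
Qed.
HB.instance Definition _ :=
  GRing.isMultiplicative.Build (quad h) (quad (f h)) qmap qmap_is_multiplicative.
End QuadMap.

Section QuadDomain.
Variables (R : idomainType) (h : R).

Lemma qconst_reg (a : R) (x : quad h) : a != 0 -> qconst h a * x = 0 -> x = 0.
Proof.
move=> a0 e; have := congr1 fst e; have := congr1 snd e.
rewrite qconstM /= => /eqP; rewrite mulf_eq0 (negbTE a0) => /= /eqP e2.
by move/eqP; rewrite mulf_eq0 (negbTE a0) => /= /eqP e1; apply: qpairP.
Qed.

(** An element of nonzero norm is not a zero divisor. *)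
Lemma qnorm_reg (x y : quad h) : qnorm x != 0 -> x * y = 0 -> y = 0.
Proof.
move=> nx e; apply: (qconst_reg nx).
by rewrite -mul_qconj mulrAC e mul0r.
Qed.

End QuadDomain.

(** ** Integral closure over a polynomial ring in one variable *)

Section UnivariateNormality.
Variables (K : numClosedFieldType) (h : {poly K}).
Hypothesis hsep : forall a, root h a -> ~~ root h^`() a.

Let pE := (hornerD, hornerN, hornerM, hornerC, hornerX, horner_exp).

(** Evaluation at a point [(a, b)] of the curve [b ^+ 2 = h a]. *)
Definition qeval (a b : K) (x : quad h) : K := x.1.[a] + b * x.2.[a].

Section Eval.
Variables (a b : K).
Hypothesis hb : b ^+ 2 = h.[a].

Lemma qevalD x y : qeval a b (x + y) = qeval a b x + qeval a b y.
Proof. rewrite /qeval !quadE !pE; ring. Qed.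
Lemma qevalM x y : qeval a b (x * y) = qeval a b x * qeval a b y.
Proof. by rewrite /qeval !quadE !pE -hb; ring. Qed.
Lemma qeval1 : qeval a b 1 = 1.
Proof. rewrite /qeval !quadE !pE; ring. Qed.
Lemma qeval0 : qeval a b 0 = 0.
Proof. rewrite /qeval !quadE !pE; ring. Qed.
Lemma qevalX x n : qeval a b (x ^+ n) = qeval a b x ^+ n.
Proof. by elim: n => [|n IH]; rewrite ?qeval1 // !exprS qevalM IH. Qed.
Lemma qeval_const p : qeval a b (qconst h p) = p.[a].
Proof. by rewrite /qeval /= horner0 mulr0 addr0. Qed.
Lemma qeval_sum n (F : nat -> quad h) :
  qeval a b (\sum_(i < n) F i) = \sum_(i < n) qeval a b (F i).
Proof.
elim: n => [|n IH]; first by rewrite !big_ord0 qeval0.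
by rewrite !big_ord_recr /= qevalD IH.
Qed.
End Eval.

(** [integral_eq x N]: the fraction [x / N] is integral over [K[t][sqrt h]]. *)
Definition integral_eq (x : quad h) (N : {poly K}) := exists m
    (c : nat -> quad h),
  x ^+ m + \sum_(i < m) c i * x ^+ i * qconst h N ^+ (m - i) = 0.

(** The numerator of an integral fraction vanishes with the denominator [N]. This
    is seen by evaluation at the two points over [a], if [a] is not a root of [h].
    Otherwise [sqrt h] is a local parameter at the only point over [a]: if [x.2]
    did not vanish there, [x] would have order 1, while [N] has order at least 2. *)
Lemma integral_eq_root x N a :
  integral_eq x N -> root N a -> root x.1 a && root x.2 a.
Proof.
move=> [m [c e]] Na.
have ev0 b : b ^+ 2 = h.[a] -> x.1.[a] + b * x.2.[a] = 0.
  move=> hb; have := congr1 (qeval a b) e.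
  rewrite qevalD (qevalX hb) (qeval_sum a b m
    (fun i => c i * x ^+ i * qconst h N ^+ (m - i))) qeval0.
  rewrite big1 ?addr0 => [/eqP|i _].
    by rewrite expf_eq0 => /andP[_ /eqP].
  rewrite !qevalM // !qevalX // qeval_const (rootP Na) expr0n subn_eq0.
  by rewrite leqNgt ltn_ord mulr0.
have hb := sqrtCK h.[a].
have e1 := ev0 _ hb.
have hb' : (- sqrtC h.[a]) ^+ 2 = h.[a] by rewrite sqrrN.
have e2 := ev0 _ hb'.
have p0 : x.1.[a] = 0.
  have : 2 * x.1.[a] = 0 by rewrite -[RHS]addr0 -{1}e1 -e2; ring.
  by move/eqP; rewrite mulf_eq0 pnatr_eq0 => /eqP.
rewrite /root p0 eqxx /=.
have [ha|ha] := eqVneq h.[a] 0; last first.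
  move/eqP: e1; rewrite p0 add0r mulf_eq0 sqrtC_eq0 (negbTE ha).
  by [].
have /factor_theorem[h1 eh] : root h a by rewrite /root ha.
have h1a : h1.[a] != 0.
  have := hsep; move/(_ a); rewrite /root ha eqxx => /(_ isT).
  by rewrite eh derivM derivXsubC mulr1 /root !pE subrr mulr0 add0r.
have /factor_theorem[p1 ep] : root x.1 a by rewrite /root p0.
have /factor_theorem[N1 eN] := Na.
set pi := 'X - a%:P in eh ep eN.
(* [x ^+ 2] is divisible by [pi]; the integral equation, multiplied by [x ^+ m],
   can be divided by [pi ^+ m]. *)
pose x' : quad h := qpair h (pi * p1 ^+ 2 + h1 * x.2 ^+ 2) (2%:R * p1 * x.2).
have ex' : x ^+ 2 = qconst h pi * x'.
  by apply: qpairP; rewrite expr2 !quadE /= ep ?eh; ring.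
pose E k := x' ^+ k./2 * x ^+ odd k.
have eE k : x ^+ k = qconst h pi ^+ k./2 * E k.
  rewrite -{1}(odd_double_half k) exprD -mul2n exprM ex' exprMn /E.
  by rewrite mulrC -!mulrA.
have pi0 : qconst h pi ^+ m = qconst h (pi ^+ m) by rewrite rmorphXn.
have : x' ^+ m + \sum_(i < m) c i * E (i + m)%N *
    (qconst h pi ^+ ((i + m)./2 - i) * qconst h N1 ^+ (m - i)) = 0.
  apply: (@qconst_reg _ _ (pi ^+ m)); first by rewrite expf_neq0 ?polyXsubC_eq0.
  rewrite -pi0 mulrDr -exprMn -ex' -exprM mulnC exprM.
  transitivity (x ^+ m * 0); last exact: mulr0.
  rewrite -[in RHS]e mulrDr -exprM.
  rewrite muln2 -addnn exprD; congr (_ + _); rewrite !mulr_sumr.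
  apply: eq_bigr => i _; rewrite eN rmorphM exprMn.
  transitivity (c i * E (i + m)%N * qconst h N1 ^+ (m - i) *
    (qconst h pi ^+ m * qconst h pi ^+ ((i + m)./2 - i))); first by ring.
  transitivity (c i * x ^+ (i + m) * (qconst h N1 ^+ (m - i) *
    qconst h pi ^+ (m - i))); last by rewrite exprD; ring.
  rewrite eE; transitivity (c i * E (i + m)%N * qconst h N1 ^+ (m - i) *
     (qconst h pi ^+ (i + m)./2 * qconst h pi ^+ (m - i))); last by ring.
  rewrite -!exprD; congr (_ * _ ^+ _).
  by have := ltn_ord i; lia.
have h0 : 0 ^+ 2 = h.[a] by rewrite ha expr0n.
move/(congr1 (qeval a 0)).
rewrite qevalD (qevalX h0) (qeval_sum a 0 m (fun i => c i * E (i + m)%N *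
    (qconst h pi ^+ ((i + m)./2 - i) * qconst h N1 ^+ (m - i)))) qeval0.
rewrite big1 ?addr0 => [/eqP|i _].
  rewrite expf_eq0 /qeval /= mul0r addr0 => /andP[_].
  rewrite !pE subrr mul0r add0r mulf_eq0 (negbTE h1a) /=.
  by rewrite mulf_eq0 orbb.
rewrite !(qevalM h0) !(qevalX h0) !qeval_const.
have -> : qeval a 0 x = 0 by rewrite /qeval p0; ring.
rewrite !pE subrr !expr0n.
have := ltn_ord i; case: (boolP (odd (i + m))) => [_ _|]; first by rewrite /=; ring.
move=> od im; have -> : ((i + m)./2 - i == 0)%N = false by lia.
by rewrite /=; ring.
Qed.

(** [K[t][sqrt h]] is integrally closed: the roots of the denominator are
    cancelled one by one. *)
Lemma quad_normal x N : N != 0 -> integral_eq x N -> (N %| x.1) && (N %| x.2).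
Proof.
move: {2}(size N) (leqnn (size N)) => n.
elim: n N x => [|n IH] N x sN N0 hx.
  by rewrite leqn0 size_poly_eq0 (negbTE N0) in sN.
have [s1|s1] := eqVneq (size N) 1%N.
  have N1 : N %= 1 by rewrite -size_poly_eq1 s1.
  by rewrite !(eqp_dvdl _ N1) !dvd1p.
have /closed_rootP[a Na] := s1.
have /andP[/factor_theorem[p ep] /factor_theorem[q eq]] := integral_eq_root hx Na.
have /factor_theorem[N1 eN] := Na.
have pi0 : 'X - a%:P != 0 :> {poly K} by rewrite polyXsubC_eq0.
have N10 : N1 != 0 by apply: contraNneq N0 => z; rewrite eN z mul0r.
have sN1 : (size N1 <= n)%N.
  by move: sN; rewrite eN size_Mmonic ?monicXsubC // size_XsubC addn2 /= ltnS.
have hx1 : integral_eq (qpair h p q) N1.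
  case: hx => m [c e]; exists m, c.
  apply: (@qconst_reg _ _ (('X - a%:P) ^+ m)); first exact: expf_neq0.
  have ex : x = qconst h ('X - a%:P) * qpair h p q.
    by apply: qpairP; rewrite !quadE /= ?ep ?eq; ring.
  rewrite -[RHS]e rmorphXn /= mulrDr -exprMn -ex; congr (_ + _).
  rewrite mulr_sumr; apply: eq_bigr => i _; rewrite eN rmorphM ex !exprMn.
  have em : (m = i + (m - i))%N by rewrite subnKC // ltnW.
  by rewrite {1}em exprD; ring.
have /andP[/= h1 h2] := IH _ _ sN1 N10 hx1.
by rewrite ep eq eN !dvdp_mul2r ?h1.
Qed.

(** [h] is not a square in [K(t)], as soon as it has a root. *)
Lemma sep_nonsquare (p q : {poly K}) a :
  root h a -> p ^+ 2 = h * q ^+ 2 -> q = 0.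
Proof.
move=> ha e; apply/eqP; apply: contraT => q0.
have /andP[/dvdpP[s es] _] : (q %| p) && (q %| 0).
  apply: (@quad_normal (qpair h p 0)) => //.
  exists 2, (fun i => if i == 0%N then - qconst h h else 0).
  rewrite !big_ord_recl big_ord0 /= -!rmorphXn.
  apply: qpairP; rewrite !(expr2, expr0, subn0, quadE) /= -?expr2 ?e; ring.
have es2 : s ^+ 2 = h.
  by apply: (mulIf (expf_neq0 2 q0)); rewrite -e es exprMn.
have sa : root s a by move: ha; rewrite -es2 /root horner_exp expf_eq0.
have := hsep ha; rewrite -es2 expr2 derivM /root !pE (rootP sa).
by rewrite mulr0 mul0r addr0 eqxx.
Qed.

End UnivariateNormality.

(** ** Integral closure over a polynomial ring in two variables *)

Lemma poly_nonroot (K : numFieldType) (p : {poly K}) :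
  p != 0 -> exists c, p.[c] != 0.
Proof.
move=> p0; pose s := [seq (i%:R : K) | i <- iota 0 (size p)].
have us : uniq s by rewrite map_inj_uniq ?iota_uniq // => i j /eqP; rewrite eqr_nat => /eqP.
have [/(max_poly_roots p0)/(_ us)|/allPn[c _ hc]] := boolP (all (root p) s).
  by rewrite size_map size_iota ltnn.
by exists c.
Qed.

(** The substitution of values in a commutative [K]-algebra [S] for the
    variables. *)
Section Substitution.
Variables (K : fieldType) (n : nat) (S : comNzRingType).
Variables (f : {rmorphism K -> S}) (v : 'I_n -> S).

Lemma rmorph_mpoly_eq (g g' : {rmorphism {mpoly K[n]} -> S}) :
  (forall c, g c%:MP = g' c%:MP) -> (forall i, g 'X_i = g' 'X_i) -> g =1 g'.
Proof.
move=> hc hX p; rewrite (mpolyE p) !rmorph_sum; apply: eq_bigr => m _.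
rewrite -mul_mpolyC !rmorphM hc; congr (_ * _).
rewrite mpolyXE_id !rmorph_prod; apply: eq_bigr => i _.
by rewrite !rmorphXn hX.
Qed.

Lemma mmapXU i : mmap f v 'X_i = v i.
Proof. by rewrite mmapX mmap1U. Qed.

End Substitution.

Lemma mpoly_alg_ind (K : fieldType) n (P : {mpoly K[n]} -> Prop) :
  (forall c, P c%:MP) -> (forall i, P 'X_i) ->
  (forall f g, P f -> P g -> P (f + g)) -> (forall f g, P f -> P g -> P (f * g)) ->
  forall p, P p.
Proof.
move=> hC hX hD hM p; rewrite (mpolyE p).
have h0 : P 0 by rewrite -(mpolyC0 n K).
have h1 : P 1 by rewrite -(mpolyC1 n K).
elim/big_ind: _ => //.
move=> m _; rewrite -mul_mpolyC mpolyXE_id; apply: (hM) => //.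
elim/big_ind: _ => // i _.
by elim: (m i) => [|k IH]; rewrite ?expr0 // exprS; apply: (hM).
Qed.

Section BivariateNormality.
Variables (K : numClosedFieldType).
Local Notation P2 := {mpoly K[2]}.
Local Notation KK := {poly {poly K}}.

(** The family of [a] and [b], indexed by the two variables. *)
Definition var2 (S : Type) (a b : S) (i : 'I_2) : S := if i == 0 then a else b.

(** The line [s = sigma + c * tau], [t = tau] in the plane, for one value of
    [sigma] and for [sigma] the inner variable. *)
Definition line (c sigma : K) : P2 -> {poly K} :=
  mmap (@polyC K) (var2 (sigma%:P + c *: 'X) 'X).
HB.instance Definition _ c sigma := GRing.RMorphism.on (line c sigma).

(** The change of variables [s = sigma + c * tau], [t = tau]; in [{poly {poly K}}]
    the inner variable is [sigma] and the outer one is [tau]. *)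
Definition shear (c : K) : P2 -> KK :=
  mmap (@polyC {poly K} \o @polyC K) (var2 ('X%:P + c%:P *: 'X) 'X).
HB.instance Definition _ c := GRing.RMorphism.on (shear c).

Definition unshear (c : K) : KK -> P2 :=
  horner_eval ('X_1 : P2) \o map_poly (horner_eval ('X_0 - c *: 'X_1 : P2) \o
    map_poly (@mpolyC 2 K)).
HB.instance Definition _ c := GRing.RMorphism.on (unshear c).

Lemma unshearC c (p : {poly K}) :
  unshear c p%:P = (map_poly (@mpolyC 2 K) p).['X_0 - c *: 'X_1].
Proof. by rewrite /unshear /= map_polyC /horner_eval hornerC. Qed.

Lemma unshearX c : unshear c 'X = 'X_1.
Proof. by rewrite /unshear /= map_polyX /horner_eval hornerX. Qed.

Lemma shearK c : cancel (shear c) (unshear c).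
Proof.
apply: (@rmorph_mpoly_eq K 2 P2 (unshear c \o shear c) idfun) => [k|i] /=.
  by rewrite /shear mmapC /= unshearC map_polyC hornerC.
rewrite /shear mmapXU /var2.
have [->|] := eqVneq i 0.
  rewrite -mul_polyC rmorphD rmorphM /= !unshearC unshearX map_polyC map_polyX.
  by rewrite hornerX hornerC -mul_mpolyC subrK.
move=> i0; rewrite unshearX; congr ('X_ _).
by apply/val_inj; case: i i0 => [[|[|]]].
Qed.

Lemma shear_line c sigma p :
  map_poly (horner_eval sigma) (shear c p) = line c sigma p.
Proof.
move: p.
apply: (@rmorph_mpoly_eq K 2 _ (map_poly (horner_eval sigma) \o shear c)
  (line c sigma)) => [k|i] /=.
  by rewrite /shear /line !mmapC /= map_polyC /= /horner_eval hornerC.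
rewrite /shear /line !mmapXU /var2; case: ifP => _; last by rewrite map_polyX.
rewrite rmorphD /= linearZ /= map_polyC map_polyX /= /horner_eval.
by rewrite hornerX hornerC.
Qed.

Lemma coef_top_mul (R : comNzRingType) (p q : {poly R}) a b :
  (size p <= a.+1)%N -> (size q <= b.+1)%N ->
  (size (p * q)%R <= (a + b).+1)%N /\ (p * q)`_(a + b) = p`_a * q`_b.
Proof.
move=> sp sq; split.
  by rewrite (leq_trans (size_polyMleq _ _)) //; lia.
rewrite coefM (bigD1 (inord a)) //= inordK ?ltnS ?leq_addr // addKn.
rewrite big1 ?addr0 // => i; rewrite -val_eqE /= inordK ?ltnS ?leq_addr // => ia.
have [lt|gt|e] := ltngtP i a; last by rewrite e eqxx in ia.
  by rewrite [q`__]nth_default ?mulr0 // (leq_trans sq) //; lia.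
by rewrite [p`__]nth_default ?mul0r // (leq_trans sp).
Qed.

Lemma line_neq0 c p : p != 0 -> exists2 sigma, sigma != 0 & line c sigma p != 0.
Proof.
move=> p0; have q0 : shear c p != 0.
  by apply: contraNneq p0 => z; rewrite -(shearK c p) z rmorph0.
have /poly_nonroot[sg] : 'X * lead_coef (shear c p) != 0.
  by rewrite mulf_neq0 ?polyX_eq0 ?lead_coef_eq0.
rewrite hornerM hornerX mulf_eq0 negb_or => /andP[sg0 h]; exists sg => //.
rewrite -shear_line -size_poly_eq0 size_map_poly_id0 ?size_poly_eq0 //.
Qed.

(** After a general shear, a nonzero polynomial has constant leading
    coefficient in the second variable. *)
Lemma shear_lead p : p != 0 -> exists c k,
  k != 0 /\ lead_coef (shear c p) = k%:P.
Proof.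
(* The coefficient of [tau ^+ d] is the value at [c] of a nonzero polynomial. *)
move=> p0; pose d := (msize p).-1.
have em : (mdeg (mlead p)).+1 = msize p by apply: mlead_deg.
pose T c := \sum_(m <- msupp p | mdeg m == d) p@_m * c ^+ m 0.
pose q : {poly K} := \sum_(m <- msupp p | mdeg m == d) p@_m *: 'X^(m 0).
have /poly_nonroot[c] : q != 0.
  apply/eqP => /(congr1 (fun q : {poly K} => q`_(mlead p 0))).
  rewrite coef0 coef_sumMXn (eq_bigl (pred1 (mlead p))) => [|m].
    rewrite big_mkcond (bigD1_seq (mlead p)) ?msupp_uniq ?mlead_supp //=.
    rewrite eqxx big1 => [|m /negbTE -> //]; rewrite addr0.
    by move/eqP; rewrite mleadc_eq0 (negbTE p0).
  rewrite /d -em /=; apply/andP/eqP => [[/eqP dm /eqP e0]|->]; last by rewrite !eqxx.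
  apply/mnmP => i; move: dm.
  rewrite !mdegE !big_ord_recl !big_ord0 -e0 !addn0 => /addnI e1.
  case: i => [[|[|i]] hi] //.
    by rewrite (_ : Ordinal hi = 0) ?e0 //; apply: val_inj.
  by rewrite (_ : Ordinal hi = lift ord0 ord0) //; apply: val_inj.
have -> : q.[c] = T c.
  by rewrite horner_sum; apply: eq_bigr => m _; rewrite hornerZ hornerXn.
move=> Tc; exists c, (T c); split => //.
pose l : KK := 'X%:P + c%:P *: 'X.
have sl : (size l <= 2)%N.
  rewrite (leq_trans (size_polyD _ _)) // geq_max size_polyC.
  rewrite (leq_trans (leq_b1 _)) //=.
  by rewrite (leq_trans (size_scale_leq _ _)) // size_polyX.
have hl k : (size (l ^+ k)%R <= k.+1)%N /\ (l ^+ k)`_k = (c ^+ k)%:P.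
  elim: k => [|k [IH1 IH2]]; first by rewrite expr0 size_poly1 coef1.
  have [h1 h2] := coef_top_mul sl IH1.
  rewrite exprS h1 h2 IH2 coefD coefC add0r coefZ coefX mulr1.
  by rewrite -rmorphM exprS.
have hm m : (size (shear c 'X_[m]) <= (mdeg m).+1)%N /\
    (shear c 'X_[m])`_(mdeg m) = (c ^+ m 0)%:P.
  rewrite /shear mmapX /mmap1 !big_ord_recl big_ord0 mulr1 mdegE.
  rewrite !big_ord_recl big_ord0 addn0 /var2 /=.
  have [h1 h2] := hl (m 0).
  have h3 : (size ('X^(m (lift ord0 ord0)) : KK) <= (m (lift ord0 ord0)).+1)%N.
    by rewrite size_polyXn.
  have [h4 h5] := coef_top_mul h1 h3.
  by rewrite h4 h5 h2 coefXn eqxx mulr1.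
have esh : shear c p = \sum_(m <- msupp p) (p@_m)%:P *: shear c 'X_[m].
  rewrite {1}(mpolyE p) rmorph_sum; apply: eq_bigr => m _.
  by rewrite -mul_mpolyC rmorphM /= {1}/shear mmapC /= mul_polyC.
have sz : (size (shear c p) <= d.+1)%N.
  rewrite esh (leq_trans (size_sum _ _ _)) //.
  apply/bigmax_leqP_seq => m hm' _.
  rewrite (leq_trans (size_scale_leq _ _)) // (leq_trans (hm m).1) //.
  by rewrite ltnS /d -ltnS -em /= em; apply: msize_mdeg_lt.
have ctop : (shear c p)`_d = (T c)%:P.
  rewrite esh coef_sum /T rmorph_sum [RHS]big_mkcond; apply: eq_big_seq => m mp.
  rewrite coefZ; case: eqP => [<-|/eqP dm]; first by rewrite (hm m).2 -rmorphM.
  rewrite nth_default ?mulr0 // (leq_trans (hm m).1) //.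
  rewrite ltn_neqAle dm /= /d -ltnS -em /= em; exact: msize_mdeg_lt.
have -> : lead_coef (shear c p) = (shear c p)`_d; last by [].
rewrite lead_coefE; congr (_`_ _).
have dz : (d < size (shear c p))%N.
  rewrite ltnNge; apply: contra Tc => le; have := ctop.
  by rewrite nth_default // => /esym/eqP; rewrite polyC_eq0.
by move: sz dz; set z := size _; lia.
Qed.

Variable h : P2.
Hypothesis hsep : forall c sigma a, sigma != 0 ->
  root (line c sigma h) a -> ~~ root (line c sigma h)^`() a.

(** [K[s, t][sqrt h]] is integrally closed. With the denominator [N] monic in
    [tau] after a shear, the remainders of the division by [N] vanish on the
    lines [sigma = const], where they are governed by the univariate case. *)
Lemma quad_normal2 (x : quad h) (N : P2) m (c : nat -> quad h) : N != 0 ->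
  x ^+ m + \sum_(i < m) c i * x ^+ i * qconst h N ^+ (m - i) = 0 ->
  exists y, x = qconst h N * y.
Proof.
move=> N0 e; have [k [u [u0 lN]]] := shear_lead N0.
have [M mM NM] : exists2 M, M \is monic & shear k N = u%:P *: M.
  exists ((u^-1)%:P *: shear k N); last first.
    by rewrite scalerA -rmorphM divff // scale1r.
  rewrite monicE lead_coefE size_scale; last by rewrite polyC_eq0 invr_eq0.
  by rewrite coefZ -lead_coefE lN -rmorphM mulVf.
have dvd (p : P2) : (forall sigma, sigma != 0 ->
    line k sigma N %| line k sigma p) -> exists q, p = N * q.
  move=> hp; pose r := Pdiv.Ring.rmodp (shear k p) M.
  pose D := Pdiv.Ring.rdivp (shear k p) M.
  have er : shear k p = D * M + r by apply: Pdiv.RingMonic.rdivp_eq.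
  have [r0|r0] := eqVneq r 0.
    exists (unshear k (u^-1%:P *: D)).
    rewrite -{1}(shearK k p) -{1}(shearK k N) -rmorphM er r0 addr0 NM.
    by rewrite -scalerAl -scalerAr scalerA -rmorphM divff // scale1r mulrC.
  have sr : (size r < size M)%N by rewrite Pdiv.Ring.ltn_rmodpN0 ?monic_neq0.
  have /poly_nonroot[sg] : 'X * lead_coef r != 0.
    by rewrite mulf_neq0 ?polyX_eq0 ?lead_coef_eq0.
  rewrite hornerM hornerX mulf_eq0 negb_or => /andP[sg0 lr].
  have := hp sg sg0; rewrite -!shear_line er NM rmorphD rmorphM /=.
  rewrite linearZ /= /horner_eval hornerC -/(horner_eval sg).
  rewrite dvdpZl // dvdp_addr ?dvdp_mull ?dvdpp // => /dvdp_leq.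
  rewrite -size_poly_eq0 size_map_poly_id0 // size_poly_eq0 => /(_ r0).
  rewrite size_map_poly_id0; last first.
    by rewrite (monicP mM) /horner_eval hornerC oner_neq0.
  by rewrite leqNgt sr.
have line0 sg : sg != 0 -> line k sg N != 0.
  move=> sg0; rewrite -shear_line -size_poly_eq0 size_map_poly_id0.
    by rewrite size_poly_eq0; apply: contraNneq N0 => z; rewrite -(shearK k N) z rmorph0.
  by rewrite lN /horner_eval hornerC.
have hx sg : sg != 0 ->
    (line k sg N %| line k sg x.1) && (line k sg N %| line k sg x.2).
  move=> sg0; pose q := @qmap _ _ (line k sg) h.
  apply: (@quad_normal _ _ _ (q x) _ (line0 sg sg0)).
    by move=> a; apply: hsep.
  exists m, (q \o c); have := congr1 q e; rewrite /q rmorph0 rmorphD rmorphXn.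
  move=> eq0; rewrite -[RHS]eq0; congr (_ + _); rewrite [RHS]rmorph_sum.
  apply: eq_bigr => i _ /=.
  rewrite !rmorphM !rmorphXn /=; congr (_ * _ ^+ _).
  by apply: qpairP; rewrite //= rmorph0.
have [q1 e1] := dvd x.1 (fun sg sg0 => proj1 (andP (hx sg sg0))).
have [q2 e2] := dvd x.2 (fun sg sg0 => proj2 (andP (hx sg sg0))).
by exists (qpair h q1 q2); rewrite qconstM -e1 -e2; apply: qpairP.
Qed.

(** [K[s, t][sqrt h]] is a domain, because [h] is not a square in [K(s, t)]. *)
Lemma quad_domain2 (x y : quad h) :
  (forall sigma, sigma != 0 -> exists a, root (line 0 sigma h) a) ->
  x * y = 0 -> x = 0 \/ y = 0.
Proof.
move=> hroot e.
have nz (z : quad h) : qnorm z = 0 -> z = 0.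
  move/eqP; rewrite subr_eq0 => /eqP nz.
  have z2 : z.2 = 0.
    apply/eqP; apply: contraT => /(line_neq0 0)[sg sg0].
    have [a ha] := hroot sg sg0.
    have := congr1 (line 0 sg) nz; rewrite rmorphXn rmorphM rmorphXn /=.
    by move/(sep_nonsquare (fun a => hsep sg0 (a := a)) ha) => ->; rewrite eqxx.
  apply: qpairP => //; move/eqP: nz; rewrite z2 expr0n mulr0.
  by rewrite expf_eq0 => /eqP.
have := congr1 (@qnorm _ h) e; rewrite qnormM.
have -> : qnorm (0 : quad h) = 0 by rewrite /qnorm !quadE; ring.
by move/eqP; rewrite mulf_eq0 => /orP[] /eqP /nz; [left|right].
Qed.
End BivariateNormality.

(** ** The coordinate ring of the elliptic quartic *)

Section EllipticRing.
Variables (K : numClosedFieldType) (c : 'I_4 -> K).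
Hypothesis c_inj : injective c.
Local Notation P2 := {mpoly K[2]}.
Local Notation s := ('X_0 : P2).
Local Notation t := ('X_1 : P2).

Let i0 : 'I_4 := inord 0.
Let i1 : 'I_4 := inord 1.
Let i2 : 'I_4 := inord 2.
Let i3 : 'I_4 := inord 3.

(** The equations [sum y_i ^+ 2 = sum c_i * y_i ^+ 2 = 0] amount to the conic
    [sum_(i < 3) (c_i - c_3) * y_i ^+ 2 = 0] and [y_3 ^+ 2 = - sum_(i < 3) y_i ^+
    2]. The conic is parametrised by [e_0 * (s ^+ 2 + t ^+ 2)], [e_1 * (s ^+ 2 - t
    ^+ 2)], [2 * e_2 * s * t], with [(c_i - c_3) * e_i ^+ 2] equal to 1, -1, -1,
    and the curve is the double cover [y_3 ^+ 2 = ell_h s t] of the line. *)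
Definition ell_E (i : 'I_4) : K := (c i - c i3)^-1.
Definition ell_e0 := sqrtC (ell_E i0).
Definition ell_e1 := sqrtC (- ell_E i1).
Definition ell_e2 := sqrtC (- ell_E i2).
Definition ell_k := ell_E i1 - ell_E i0.
Definition ell_n := ell_E i2 - ell_E i0.

Definition ell_h : P2 := ell_k%:MP * (s ^+ 2 - t ^+ 2) ^+ 2 +
  (4%:R * ell_n)%:MP * (s * t) ^+ 2.

(** The coordinates of the curve. *)
Definition ell_Y (i : 'I_4) : quad ell_h :=
  if i == i0 then qconst _ (ell_e0%:MP * (s ^+ 2 + t ^+ 2))
  else if i == i1 then qconst _ (ell_e1%:MP * (s ^+ 2 - t ^+ 2))
  else if i == i2 then qconst _ ((2%:R * ell_e2)%:MP * (s * t))
  else qroot _.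

Let neq_ij (i j : nat) : (i < 4)%N -> (j < 4)%N -> i != j ->
  inord i != inord j :> 'I_4.
Proof. by move=> hi hj; rewrite -val_eqE /= !inordK. Qed.

Lemma ell_E_neq0 i : (i < 3)%N -> ell_E (inord i) != 0.
Proof.
move=> hi; rewrite invr_eq0 subr_eq0; apply/eqP => /c_inj/eqP.
by apply/negP/neq_ij; lia.
Qed.

Lemma ell_E_inj i j : (i < 3)%N -> (j < 3)%N -> i != j ->
  ell_E (inord i) - ell_E (inord j) != 0.
Proof.
move=> hi hj ij; rewrite subr_eq0; apply/eqP => /invr_inj/addIr/c_inj/eqP.
by apply/negP/neq_ij; lia.
Qed.

Lemma ell_Y0 : ell_Y i0 = qconst _ (ell_e0%:MP * (s ^+ 2 + t ^+ 2)).
Proof. by rewrite /ell_Y eqxx. Qed.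
Lemma ell_Y1 : ell_Y i1 = qconst _ (ell_e1%:MP * (s ^+ 2 - t ^+ 2)).
Proof. by rewrite /ell_Y eqxx (negbTE (neq_ij _ _ _)). Qed.
Lemma ell_Y2 : ell_Y i2 = qconst _ ((2%:R * ell_e2)%:MP * (s * t)).
Proof. by rewrite /ell_Y eqxx !(negbTE (neq_ij _ _ _)). Qed.
Lemma ell_Y3 : ell_Y i3 = qroot _.
Proof. by rewrite /ell_Y !(negbTE (neq_ij _ _ _)). Qed.

Let sum4 (V : nmodType) (F : 'I_4 -> V) :
  \sum_i F i = F i0 + F i1 + F i2 + F i3.
Proof.
rewrite !big_ord_recl big_ord0 addr0 !addrA.
by congr (_ + _ + _ + _); congr F; apply: val_inj; rewrite /= inordK.
Qed.

Lemma ell_rel1 : \sum_i ell_Y i * ell_Y i = 0.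
Proof.
rewrite sum4 ell_Y0 ell_Y1 ell_Y2 ell_Y3 qroot_sqr -!rmorphM -!rmorphD /=.
rewrite (_ : _ + _ = 0) ?rmorph0 // /ell_h.
have -> : ell_k%:MP = (ell_e0 ^+ 2)%:MP * (-1) - (ell_e1 ^+ 2)%:MP :> P2.
  by rewrite !sqrtCK /ell_k mpolyCB mpolyCN; ring.
have -> : (4%:R * ell_n)%:MP = - 4%:R * ((ell_e2 ^+ 2)%:MP + (ell_e0 ^+ 2)%:MP) :> P2.
  rewrite !sqrtCK /ell_n mpolyCM mpolyCB mpolyCN mpolyC_nat; ring.
rewrite !mpolyCM !mpolyC_nat; ring.
Qed.

Lemma ell_rel2 : \sum_i qconst _ (c i)%:MP * (ell_Y i * ell_Y i) = 0.
Proof.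
have -> : \sum_i qconst _ (c i)%:MP * (ell_Y i * ell_Y i) =
  \sum_i qconst _ (c i - c i3)%:MP * (ell_Y i * ell_Y i).
  rewrite [RHS](eq_bigr (fun i => qconst _ (c i)%:MP * (ell_Y i * ell_Y i) -
    qconst _ (c i3)%:MP * (ell_Y i * ell_Y i))) => [|i _].
    by rewrite sumrB -mulr_sumr ell_rel1 mulr0 subr0.
  by rewrite mpolyCB rmorphB /= mulrBl.
rewrite sum4 ell_Y0 ell_Y1 ell_Y2 subrr !rmorph0 mul0r addr0.
rewrite -!rmorphM -!rmorphD /= (_ : _ + _ = 0) ?rmorph0 //.
have eE i (hi : (i < 3)%N) : c (inord i) - c i3 = (ell_E (inord i))^-1.
  by rewrite invrK.
have h0 : (c i0 - c i3) * ell_e0 ^+ 2 = 1.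
  by rewrite sqrtCK eE // mulVf // ell_E_neq0.
have h1 : (c i1 - c i3) * ell_e1 ^+ 2 = -1.
  by rewrite sqrtCK eE // mulrN mulVf // ell_E_neq0.
have h2 : (c i2 - c i3) * ell_e2 ^+ 2 = -1.
  by rewrite sqrtCK eE // mulrN mulVf // ell_E_neq0.
transitivity (((c i0 - c i3) * ell_e0 ^+ 2)%:MP * (s ^+ 2 + t ^+ 2) ^+ 2 +
  ((c i1 - c i3) * ell_e1 ^+ 2)%:MP * (s ^+ 2 - t ^+ 2) ^+ 2 + 4%:R *
  ((c i2 - c i3) * ell_e2 ^+ 2)%:MP * (s * t) ^+ 2).
  rewrite !mpolyCM mpolyC_nat; ring.
by rewrite h0 h1 h2 !mpolyCN; ring.
Qed.

Lemma line_ellE k sigma : line k sigma ell_h = let x := sigma%:P + k *: 'X in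
  ell_k%:P * (x ^+ 2 - 'X ^+ 2) ^+ 2 + (4%:R * ell_n)%:P * (x * 'X) ^+ 2.
Proof.
pose f : {rmorphism P2 -> {poly K}} := line k sigma.
rewrite -[line _ _ _]/(f _) /ell_h (rmorphD f) !(rmorphM f).
rewrite (rmorphB f) !(rmorphM f) /f /= /line.
by rewrite !mmapC !mmapXU.
Qed.

Lemma line_ell k sigma a : (line k sigma ell_h).[a] =
  let x := sigma + k * a in
  ell_k * (x ^+ 2 - a ^+ 2) ^+ 2 + 4%:R * ell_n * (x * a) ^+ 2.
Proof.
rewrite line_ellE /=.
by rewrite !(hornerD, hornerN, hornerM, horner_exp, hornerX, hornerC, hornerZ).
Qed.

Lemma line_ell_deriv k sigma a : (line k sigma ell_h)^`().[a] =
  let x := sigma + k * a in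
  4%:R * ell_k * (x ^+ 2 - a ^+ 2) * (k * x - a) +
  8%:R * ell_n * (x * a) * (k * a + x).
Proof.
rewrite line_ellE /= !(derivD, derivB, derivN, derivM, derivC, derivX, derivZ, expr2).
rewrite !(hornerD, hornerN, hornerM, horner_exp, hornerX, hornerC, hornerZ).
by rewrite /=; ring.
Qed.

(** The roots of [ell_h] on a line that avoids the origin are simple: at a double
    root the derivative along the line vanishes, so by Euler's relation both
    partial derivatives [hs], [ht] of [ell_h] vanish. *)
Lemma ell_sep k sigma a : sigma != 0 ->
  root (line k sigma ell_h) a -> ~~ root (line k sigma ell_h)^`() a.
Proof.
move=> sg0; rewrite /root line_ell line_ell_deriv /=; set x := sigma + k * a.
move=> /eqP g0; apply/eqP => g1.
have k0 : ell_k != 0 by apply: ell_E_inj.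
have n0 : ell_n != 0 by apply: ell_E_inj.
have kn : ell_n - ell_k != 0.
  have := @ell_E_inj 2 1 isT isT isT; congr (_ != 0); rewrite /ell_n /ell_k; ring.
pose hs := 4%:R * x * (ell_k * (x ^+ 2 - a ^+ 2) + 2%:R * ell_n * a ^+ 2).
pose ht := 4%:R * a * (- ell_k * (x ^+ 2 - a ^+ 2) + 2%:R * ell_n * x ^+ 2).
have hs0 : hs = 0.
  apply/(mulfI sg0); rewrite mulr0.
  transitivity (4%:R * 0 - a * 0 : K); last by ring.
  by rewrite -{1}g0 -g1 /hs /x; ring.
have ht0 : ht = 0.
  transitivity (0 - k * 0 : K); last by ring.
  by rewrite -{1}g1 -hs0 /hs /ht; ring.
have xa0 : x * a != 0.
  rewrite mulf_neq0 //; apply/eqP => z; move: g0; rewrite z.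
    move=> g0; have : ell_k * a ^+ 4 = 0 by rewrite -g0; ring.
    move/eqP; rewrite mulf_eq0 (negbTE k0) expf_eq0 /= => /eqP a0.
    by move: z; rewrite /x a0 mulr0 addr0 => /eqP; apply/negP.
  move=> g0; have : ell_k * x ^+ 4 = 0 by rewrite -g0; ring.
  move/eqP; rewrite mulf_eq0 (negbTE k0) expf_eq0 /= /x z mulr0 addr0.
  by apply/negP.
move: (xa0); rewrite mulf_eq0 negb_or => /andP[x0 a0].
have n4 : 4%:R != 0 :> K by rewrite pnatr_eq0.
have n2 : 2%:R != 0 :> K by rewrite pnatr_eq0.
have e1 : ell_k * (x ^+ 2 - a ^+ 2) + 2%:R * ell_n * a ^+ 2 = 0.
  by apply: (mulfI (mulf_neq0 n4 x0)); rewrite mulr0.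
have e2 : - ell_k * (x ^+ 2 - a ^+ 2) + 2%:R * ell_n * x ^+ 2 = 0.
  by apply: (mulfI (mulf_neq0 n4 a0)); rewrite mulr0.
have e3 : x ^+ 2 + a ^+ 2 = 0.
  apply: (mulfI (mulf_neq0 n2 n0)); rewrite mulr0 -[RHS]addr0 -{1}e1 -e2; ring.
have : (ell_n - ell_k) * (2%:R * a ^+ 2) = 0.
  rewrite -[RHS](subr0 0) -{1}e1 -(mulr0 ell_k) -e3; ring.
by apply/eqP; rewrite !mulf_neq0 ?expf_neq0.
Qed.

Lemma ell_root sigma : sigma != 0 -> exists a, root (line 0 sigma ell_h) a.
Proof.
move=> sg0; apply/closed_rootP/negP => /size_poly1P[b b0 e].
have ev a := line_ell 0 sigma a.
have := ev 0; have := ev sigma; have := ev (2%:R * sigma).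
rewrite e !hornerC /= => e2 e1 e0.
have : 12%:R * ell_k * sigma ^+ 4 = 0.
  transitivity (b + 3%:R * b - 4%:R * b); last by ring.
  by rewrite {1}e2 {1}e0 e1; ring.
move/eqP; rewrite mulf_eq0 (negbTE (expf_neq0 4 sg0)) orbF mulf_eq0 pnatr_eq0.
by apply/negP; apply: ell_E_inj.
Qed.

Lemma ell_domain (x y : quad ell_h) : x * y = 0 -> x = 0 \/ y = 0.
Proof.
by apply: quad_domain2 => [k sg a|sg]; [apply: ell_sep | apply: ell_root].
Qed.

End EllipticRing.

(** ** The homogeneous ideal of the elliptic quartic *)

Section HomogeneousPolynomials.
Variable K : fieldType.

Lemma homogMe (m : nat) d e f (p q : {mpoly K[m]}) : p \is d.-homog ->
  q \is e.-homog -> (d + e)%N = f -> p * q \is f.-homog.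
Proof. by move=> hp hq <-; apply: dhomogM. Qed.

Lemma homogXU m i : ('X_i : {mpoly K[m]}) \is 1.-homog.
Proof. by rewrite dhomogX /= mdeg1. Qed.

Lemma homogC m (k : K) : (k%:MP : {mpoly K[m]}) \is 0.-homog.
Proof. by rewrite -[k]mulr1 mpolyCM mul_mpolyC; apply/dhomogZ/dhomog1. Qed.

Lemma homogXn m d e f (p : {mpoly K[m]}) : p \is d.-homog -> (d * e)%N = f ->
  p ^+ e \is f.-homog.
Proof. by move=> hp <-; apply: dhomogMn. Qed.

End HomogeneousPolynomials.

Section EllipticCurve.
Variables (K : numClosedFieldType) (c : 'I_4 -> K).
Hypothesis c_inj : injective c.
Variables (n : nat) (W V : 'M[K]_(4, n)).
Hypothesis VW : V *m W^T = 1%:M.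
Local Notation P2 := {mpoly K[2]}.
Local Notation S := {mpoly K[n]}.
Local Notation h := (ell_h c).
Local Notation s := ('X_0 : P2).
Local Notation t := ('X_1 : P2).
Local Notation Y := (ell_Y c).

(** The parametrisation of the curve: [y |-> y *m W] maps the coordinates [Y]
    into the span of the rows of [W]. *)
Definition theta : S -> quad h := mmap (@qconst P2 h \o @mpolyC 2 K)
  (fun j => \sum_i qconst h (W i j)%:MP * Y i).
HB.instance Definition _ := GRing.RMorphism.on theta.

(** The ideal of the curve. *)
Definition ell_ideal (f : S) : Prop := theta f = 0.

Lemma theta_C k : theta k%:MP = qconst h k%:MP.
Proof. by rewrite /theta mmapC. Qed.

Lemma theta_Z k f : theta (k *: f) = qconst h k%:MP * theta f.
Proof. by rewrite -mul_mpolyC rmorphM /= theta_C. Qed.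

Lemma theta_linform (v : 'rV_n) :
  theta (linform v) = \sum_i qconst h ((v *m W^T) 0 i)%:MP * Y i.
Proof.
rewrite rmorph_sum /=.
rewrite (eq_bigr (fun j => \sum_i qconst h (v 0 j * W i j)%:MP * Y i)); last first.
  move=> j _; rewrite theta_Z /theta mmapXU mulr_sumr; apply: eq_bigr => i _.
  by rewrite mpolyCM rmorphM /= mulrA.
rewrite exchange_big; apply: eq_bigr => i _ /=.
rewrite -mulr_suml -!rmorph_sum mxE; congr (qconst _ _%:MP * _).
by apply: eq_bigr => j _; rewrite mxE.
Qed.

Lemma theta_qform (A : 'M_n) : theta (qform A) =
  \sum_i \sum_j qconst h ((W *m A *m W^T) i j)%:MP * (Y i * Y j).
Proof.
rewrite /qform rmorph_sum /=.
transitivity (\sum_a \sum_b \sum_i \sum_j qconst h (W i a * A a b * W j b)%:MP *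
    (Y i * Y j)).
  apply: eq_bigr => a _; rewrite rmorph_sum; apply: eq_bigr => b _ /=.
  rewrite theta_Z rmorphM /= /theta !mmapXU mulr_suml mulr_sumr.
  apply: eq_bigr => i _; rewrite !mulr_sumr; apply: eq_bigr => j _.
  rewrite !mpolyCM !rmorphM /=; ring.
rewrite (eq_bigr (fun a => \sum_i \sum_b \sum_j
   qconst h (W i a * A a b * W j b)%:MP * (Y i * Y j))); last first.
  by move=> a _; rewrite exchange_big.
rewrite exchange_big; apply: eq_bigr => i _ /=.
rewrite (eq_bigr (fun a => \sum_j \sum_b
   qconst h (W i a * A a b * W j b)%:MP * (Y i * Y j))); last first.
  by move=> a _; rewrite exchange_big.
rewrite exchange_big; apply: eq_bigr => j _ /=.
rewrite exchange_big /=.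
under eq_bigr => b _ do rewrite -mulr_suml.
rewrite -mulr_suml; congr (_ * _).
rewrite mxE !rmorph_sum; apply: eq_bigr => b _ /=.
by rewrite !mxE mulr_suml !rmorph_sum.
Qed.

(** *** Grading *)

(** Homogeneity in degree [2 * d] of a multiple [p * sqrt h], where [sqrt h] has
    weight 2. *)
Definition homog2 d (p : P2) : Prop :=
  if d is d'.+1 then p \is (2 * d')%N.-homog else p = 0.

(** Elements of weighted degree [2 * d], the variables [s], [t], [sqrt h] having
    weights 1, 1, 2. *)
Definition qhomog d (x : quad h) : Prop :=
  x.1 \is (2 * d)%N.-homog /\ homog2 d x.2.

Lemma ell_h_homog : h \is 4.-homog.
Proof.
have hs := @homogXU K 2 0; have ht := @homogXU K 2 1.
apply: dhomogD.
  apply: homogMe (homogC _ _) _ (add0n 4); apply: (@homogXn _ _ 2) => //.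
  by apply: rpredB; apply: (@homogXn _ _ 1).
apply: homogMe (homogC _ _) _ (add0n 4); apply: (@homogXn _ _ 2) => //.
exact: homogMe hs ht _.
Qed.

Lemma qhomog1 : qhomog 0 1.
Proof. by split; first exact: dhomog1. Qed.

Lemma qhomogD d x y : qhomog d x -> qhomog d y -> qhomog d (x + y).
Proof.
move=> [h1 h2] [h3 h4]; split; first exact: dhomogD.
by case: d h2 h4 {h1 h3} => [|d] /=; [move=> -> ->; rewrite addr0|exact: dhomogD].
Qed.

Lemma qhomog0 d : qhomog d 0.
Proof. by split; [apply: dhomog0 | case: d => [|d] //=; apply: dhomog0]. Qed.

Lemma qhomogM d e x y : qhomog d x -> qhomog e y -> qhomog (d + e) (x * y).
Proof.
move=> [h1 h2] [h3 h4]; split; rewrite quadE.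
  apply: dhomogD; first by apply: homogMe h1 h3 _; lia.
  case: d h2 {h1} => [|d] /= h2; first by rewrite h2 mul0r mulr0 dhomog0.
  case: e h4 {h3} => [|e] /= h4; first by rewrite h4 !mulr0 dhomog0.
  apply: homogMe ell_h_homog (homogMe h2 h4 (erefl _)) _; lia.
have e1 : homog2 (d + e) (x.1 * y.2).
  case: e h4 {h3} => [|e] /= h4.
    by rewrite h4 mulr0; case: (d + 0)%N => [|k] //=; apply: dhomog0.
  by rewrite addnS /=; apply: homogMe h1 h4 _; lia.
have e2 : homog2 (d + e) (x.2 * y.1).
  case: d h2 {h1 e1} => [|d] /= h2.
    by rewrite h2 mul0r; case: e {h3 h4} => [|k] //=; apply: dhomog0.
  by apply: homogMe h2 h3 _; lia.
case: (d + e)%N e1 e2 => [|k] /=; first by move=> -> ->; rewrite addr0.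
exact: dhomogD.
Qed.

Lemma qhomogX d x k : qhomog d x -> qhomog (d * k) (x ^+ k).
Proof.
move=> hx; elim: k => [|k IH]; first by rewrite muln0; apply: qhomog1.
by rewrite exprS mulnS; apply: qhomogM.
Qed.

Lemma qhomog_const k : qhomog 0 (qconst h k%:MP).
Proof. by split => //; apply: homogC. Qed.

Lemma qhomog_Y i : qhomog 1 (Y i).
Proof.
have hs := @homogXU K 2 0; have ht := @homogXU K 2 1.
have hst : forall e, e = 2%N -> s ^+ 2 \is e.-homog /\ t ^+ 2 \is e.-homog.
  by move=> e ->; split; apply: (@homogXn _ _ 1).
have [hs2 ht2] := hst _ (erefl _).
rewrite /ell_Y; case: ifP => _; last case: ifP => _; last case: ifP => _.
- split; last exact: dhomog0.
  by apply: homogMe (homogC _ _) _ (erefl _); apply: dhomogD.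
- split; last exact: dhomog0.
  by apply: homogMe (homogC _ _) _ (erefl _); apply: rpredB.
- split; last exact: dhomog0.
  by apply: homogMe (homogC _ _) _ (erefl _); exact: homogMe hs ht _.
by split; [apply: dhomog0 | apply: dhomog1].
Qed.

Lemma qhomog_sum d (I : Type) (r : seq I) (P : pred I) F :
  (forall i, P i -> qhomog d (F i)) -> qhomog d (\sum_(i <- r | P i) F i).
Proof.
move=> hF; elim/big_ind: _ => //; [exact: qhomog0 | exact: qhomogD].
Qed.

Lemma theta_monomial m : qhomog (mdeg m) (theta 'X_[m]).
Proof.
rewrite /theta mmapX /mmap1 mdegE.
elim/big_ind2: _ => [|? ? ? ? ? ?|i _]; [exact: qhomog1|exact: qhomogM|].
rewrite -[X in qhomog X _]mul1n; apply: qhomogX; apply: qhomog_sum => j _.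
by apply: (@qhomogM 0 1); [apply: qhomog_const | apply: qhomog_Y].
Qed.

Lemma theta_homog d f : f \is d.-homog -> qhomog d (theta f).
Proof.
move=> hf; rewrite (mpolyE f) rmorph_sum big_seq; apply: qhomog_sum => m mf.
rewrite /= theta_Z; apply: (@qhomogM 0 d); first exact: qhomog_const.
by rewrite -(dhomog_mf hf mf); apply: theta_monomial.
Qed.

(** The component of weighted degree [2 * d]. *)
Definition qpi d (x : quad h) : quad h := qpair h (pihomog mdeg (2 * d) x.1)
  (if d is d'.+1 then pihomog mdeg (2 * d') x.2 else 0).

Lemma qpiD d x y : qpi d (x + y) = qpi d x + qpi d y.
Proof.
by apply: qpairP => /=; case: d => [|d]; rewrite ?quadE ?pihomogD ?addr0.
Qed.

Lemma qpiZ d k x : qpi d (qconst h k%:MP * x) = qconst h k%:MP * qpi d x.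
Proof.
rewrite !qconstM; apply: qpairP; rewrite /= ?mul_mpolyC ?linearZ //.
by case: d => [|d]; rewrite ?scaler0 //= linearZ.
Qed.

Lemma qpi_homog d e x : qhomog e x -> qpi d x = if e == d then x else 0.
Proof.
move=> [h1 h2]; case: eqP => [<-|/eqP ed]; apply: qpairP => /=.
- exact: pihomog_dE.
- by case: e h2 {h1} => [-> //|e h2]; apply: pihomog_dE.
- by apply: pihomog_ne0 h1; lia.
case: d ed => [|d] // ed; case: e h2 ed {h1} => [->|e h2] ed; first exact: raddf0.
by apply: pihomog_ne0 h2; lia.
Qed.

Lemma theta_pihomog d f : theta (pihomog mdeg d f) = qpi d (theta f).
Proof.
have q0 : qpi d 0 = 0.
  by rewrite (@qpi_homog d d) ?eqxx //; apply: qhomog0.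
have eq_sum (r : seq 'X_{1..n}) : theta (pihomog mdeg d (\sum_(m <- r) f@_m *: 'X_[m]))
    = qpi d (theta (\sum_(m <- r) f@_m *: 'X_[m])).
  elim: r => [|m r IH]; first by rewrite !big_nil raddf0 rmorph0 q0.
  rewrite !big_cons raddfD !rmorphD qpiD /= IH; congr (_ + _).
  rewrite linearZ /= !theta_Z qpiZ; congr (_ * _).
  rewrite pihomogX (qpi_homog _ (theta_monomial m)).
  by case: ifP => _; rewrite ?rmorph0.
by rewrite {1}(mpolyE f) eq_sum -mpolyE.
Qed.

Lemma ell_ideal_ideal : is_ideal ell_ideal.
Proof.
rewrite /ell_ideal; split => [|f g ef eg|f g eg].
- exact: rmorph0.
- by rewrite rmorphD /= ef eg addr0.
- by rewrite rmorphM /= eg mulr0.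
Qed.

Lemma ell_ideal_homog : homogeneous_ideal ell_ideal.
Proof.
split; first exact: ell_ideal_ideal.
move=> d f ef; rewrite /ell_ideal theta_pihomog ef (@qpi_homog d d) ?eqxx //.
exact: qhomog0.
Qed.

Lemma ell_ideal_prime : prime_ideal ell_ideal.
Proof.
split; first exact: ell_ideal_ideal.
  by rewrite /ell_ideal rmorph1 => /eqP; rewrite oner_eq0.
by move=> f g; rewrite /ell_ideal rmorphM /=; apply: ell_domain.
Qed.
End EllipticCurve.

Section LinearForms.
Variables (K : fieldType) (n : nat).

Lemma linformD (u v : 'rV[K]_n) : linform (u + v) = linform u + linform v.
Proof.
by rewrite /linform -big_split; apply: eq_bigr => j _; rewrite mxE scalerDl.
Qed.

Lemma linformZ k (v : 'rV[K]_n) : linform (k *: v) = k *: linform v.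
Proof.
by rewrite /linform scaler_sumr; apply: eq_bigr => j _; rewrite mxE scalerA.
Qed.

Lemma linform_homog (v : 'rV[K]_n) : linform v \is 1.-homog.
Proof. by apply: rpred_sum => j _; rewrite rpredZ ?dhomogX /= ?mdeg1. Qed.

End LinearForms.

Section BinaryForms.
Variables (K : fieldType).
Local Notation P2 := {mpoly K[2]}.

(** The exponent of [X_0 ^+ i * X_1 ^+ j]. *)
Definition mon2 (i j : nat) : 'X_{1..2} :=
  let u : 'I_2 -> 'X_{1..2} := @mnm1 2 in (u 0%R *+ i + u 1%R *+ j)%MM.

Lemma mon2E i j : 'X_[mon2 i j] = 'X_0 ^+ i * 'X_1 ^+ j :> P2.
Proof. by rewrite mpolyXD !mpolyXn. Qed.

Lemma mon2_0 i j : mon2 i j 0 = i.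
Proof. by rewrite mnmDE !mulmnE !mnm1E /= mul1n mul0n addn0. Qed.

Lemma mdeg_mon2 i j : mdeg (mon2 i j) = (i + j)%N.
Proof. by rewrite mdegD !mdegMn !mdeg1 !mul1n. Qed.

Lemma mon2P (m : 'X_{1..2}) : m = mon2 (m 0) (m 1).
Proof.
apply/mnmP => i; rewrite mnmDE !mulmnE !mnm1E.
case: i => [[|[|i]] hi] //=.
  by rewrite mul1n mul0n addn0; congr (m _); apply: val_inj.
by rewrite mul1n mul0n add0n; congr (m _); apply: val_inj.
Qed.

Lemma mcoeff_binary D (F : 'I_D.+1 -> K) (i : 'I_D.+1) :
  (\sum_j F j *: ('X_0 ^+ j * 'X_1 ^+ (D - j)) : P2)@_(mon2 i (D - i)) = F i.
Proof.
rewrite raddf_sum (bigD1 i) //= mcoeffZ -mon2E mcoeffX eqxx mulr1.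
rewrite big1 ?addr0 // => j ji; rewrite mcoeffZ -mon2E mcoeffX.
case: eqP => [e|]; last by rewrite mulr0.
by case/eqP: ji; apply: val_inj; rewrite /= -(mon2_0 j (D - j)) e mon2_0.
Qed.

Lemma binary_form D (p : P2) : p \is D.-homog -> p =
  \sum_(j < D.+1) p@_(mon2 j (D - j)) *: ('X_0 ^+ j * 'X_1 ^+ (D - j)).
Proof.
move=> hp; apply/mpolyP => m.
have [dm|dm] := eqVneq (mdeg m) D.
  have dm' : (m 0%R + m 1%R)%N = D by rewrite -mdeg_mon2 -mon2P.
  have mD : (m 0%R < D.+1)%N by rewrite -dm' ltnS leq_addr.
  have em : m = mon2 (Ordinal mD) (D - Ordinal mD).
    by rewrite {1}(mon2P m) /= -dm' addKn.
  by rewrite {2}em (mcoeff_binary (fun j => p@_(mon2 j (D - j)))) -em.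
rewrite (dhomog_nemf_coeff hp dm) raddf_sum big1 // => j _.
rewrite /= mcoeffZ -mon2E mcoeffX; case: eqP => [e|]; last by rewrite mulr0.
by case/eqP: dm; rewrite -e mdeg_mon2 subnKC // -ltnS.
Qed.

(** The involution [s, t |-> -s, -t]. *)
Definition negvar : P2 -> P2 := mmap (@mpolyC 2 K) (fun i => - 'X_i).
HB.instance Definition _ := GRing.RMorphism.on negvar.

Lemma negvarC k : negvar k%:MP = k%:MP.
Proof. exact: mmapC. Qed.

Lemma negvarX i : negvar 'X_i = - 'X_i.
Proof. exact: mmapXU. Qed.

Lemma mcoeff_negvar p m : (negvar p)@_m = (-1) ^+ mdeg m * p@_m.
Proof.
have e m' : negvar 'X_[m'] = (-1) ^+ mdeg m' *: 'X_[m'].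
  rewrite (mon2P m') mon2E rmorphM !rmorphXn /= !negvarX mdeg_mon2 exprD.
  by rewrite -[- 'X_0]mulN1r -[- 'X_1]mulN1r !exprMn -mul_mpolyC
    rmorphM !rmorphXn /= mpolyCN; ring.
rewrite {1 2}(mpolyE p) rmorph_sum !raddf_sum mulr_sumr; apply: eq_bigr => k _ /=.
rewrite -!mul_mpolyC rmorphM /= negvarC e !mul_mpolyC !mcoeffZ mcoeffX.
by case: eqP => [->|]; rewrite ?mulr0 // mulrCA.
Qed.

End BinaryForms.

Section EllipticCurve2.
Variables (K : numClosedFieldType) (c : 'I_4 -> K).
Hypothesis c_inj : injective c.
Variables (n : nat) (W V : 'M[K]_(4, n)).
Hypothesis VW : V *m W^T = 1%:M.
Local Notation P2 := {mpoly K[2]}.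
Local Notation S := {mpoly K[n]}.
Local Notation h := (ell_h c).
Local Notation s := ('X_0 : P2).
Local Notation t := ('X_1 : P2).
Local Notation Y := (ell_Y c).
Local Notation th := (theta c W).

Lemma theta_lin k i :
  th (linform (k *: (delta_mx 0 i *m V))) = qconst h k%:MP * Y i.
Proof.
rewrite linformZ theta_Z theta_linform -mulmxA VW mulmx1; congr (_ * _).
rewrite (bigD1 i) //= mxE !eqxx mul1r big1 ?addr0 // => j ji.
by rewrite mxE eqxx (negbTE ji) rmorph0 mul0r.
Qed.

Let e0_neq0 : ell_e0 c != 0.
Proof. by rewrite sqrtC_eq0; apply: ell_E_neq0. Qed.
Let e1_neq0 : ell_e1 c != 0.
Proof. by rewrite sqrtC_eq0 oppr_eq0; apply: ell_E_neq0. Qed.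
Let e2_neq0 : ell_e2 c != 0.
Proof. by rewrite sqrtC_eq0 oppr_eq0; apply: ell_E_neq0. Qed.

(** The squares and the product of [s] and [t], and [sqrt h], are values of linear
    forms. *)
Lemma theta_gens : exists a b z w : S,
  [/\ a \is 1.-homog, b \is 1.-homog, z \is 1.-homog & w \is 1.-homog] /\
  [/\ th a = qconst h (s ^+ 2), th b = qconst h (t ^+ 2),
      th z = qconst h (s * t) & th w = qroot h].
Proof.
pose l k i := linform (k *: (delta_mx 0 i *m V)).
exists (l (2%:R * ell_e0 c)^-1 (inord 0) + l (2%:R * ell_e1 c)^-1 (inord 1)).
exists (l (2%:R * ell_e0 c)^-1 (inord 0) - l (2%:R * ell_e1 c)^-1 (inord 1)).
exists (l (2%:R * ell_e2 c)^-1 (inord 2)), (l 1 (inord 3)).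
have hl k i : l k i \is 1.-homog by apply: linform_homog.
split; first by split; [apply: dhomogD|apply: rpredB| |]; apply: hl.
have n2 : 2%:R != 0 :> K by rewrite pnatr_eq0.
have k0 : (2%:R * ell_e0 c)^-1 * ell_e0 c = 2%:R^-1.
  by rewrite invfM -mulrA mulVf ?mulr1.
have k1 : (2%:R * ell_e1 c)^-1 * ell_e1 c = 2%:R^-1.
  by rewrite invfM -mulrA mulVf ?mulr1.
have half : (2%:R^-1 : K)%:MP * 2%:R = 1 :> P2.
  by rewrite -mpolyC_nat -mpolyCM mulVf.
split; rewrite ?rmorphB ?rmorphD /= ?theta_lin ?ell_Y0 ?ell_Y1 ?ell_Y2 ?ell_Y3 //.
- rewrite -!rmorphM -rmorphD /= !mulrA -!mpolyCM k0 k1; congr (qconst _ _).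
  by rewrite -[RHS]mul1r -half; ring.
- rewrite -!rmorphM -rmorphB /= !mulrA -!mpolyCM k0 k1; congr (qconst _ _).
  by rewrite -[RHS]mul1r -half; ring.
- rewrite -rmorphM; congr (qconst _ _); rewrite [LHS]mulrA -mpolyCM mulVf ?mul1r //.
  by rewrite mulf_neq0.
by rewrite rmorph1 mul1r.
Qed.

(** The monomials of even degree in [s], [t] are values of [theta], and so are
    their products by [sqrt h]. *)
Lemma theta_even i j d : (i + j = 2 * d)%N -> exists2 f, f \is d.-homog &
  th f = qconst h (s ^+ i * t ^+ j).
Proof.
move=> ij; have [a [b [z [w [[ha hb hz hw] [ea eb ez ew]]]]]] := theta_gens.
exists (a ^+ i./2 * z ^+ odd i * b ^+ j./2).
  apply: homogMe (homogMe (homogXn ha (erefl _)) (homogXn hz (erefl _)) (erefl _))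
    (homogXn hb (erefl _)) _; lia.
rewrite !rmorphM !rmorphXn /= ea eb ez -!rmorphXn -!rmorphM; congr (qconst _ _).
rewrite -!exprM [(s * t) ^+ _]exprMn.
transitivity (s ^+ (2 * i./2 + odd i) * t ^+ (odd i + 2 * j./2)).
  have mulACA (x1 x2 x3 x4 : P2) : x1 * (x2 * x3) * x4 = (x1 * x2) * (x3 * x4) by ring.
  by rewrite mulACA -!exprD.
by congr (_ ^+ _ * _ ^+ _); lia.
Qed.

Lemma theta_even_root i j d : (i + j = 2 * d)%N -> exists2 f, f \is d.+1.-homog &
  th f = qpair h 0 (s ^+ i * t ^+ j).
Proof.
move=> /theta_even[f hf ef].
have [a [b [z [w [[_ _ _ hw] [_ _ _ ew]]]]]] := theta_gens.
exists (f * w); first by apply: homogMe hf hw _; rewrite addn1.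
by rewrite rmorphM /= ef ew qconstM /=; apply: qpairP; rewrite /= ?mulr0 ?mulr1.
Qed.

(** A basis in degree [d]: the monomials of degree [2 * d] in [s], [t], and the
    multiples by [sqrt h] of those of degree [2 * d - 2]. *)
Lemma ell_hilbert d : (0 < d)%N -> hilbert_fun (ell_ideal c W) d (4 * d).
Proof.
move=> d0.
pose D1 := (2 * d)%N; pose D2 := (2 * d.-1)%N.
have -> : (4 * d = D1.+1 + D2.+1)%N by rewrite /D1 /D2; lia.
pose T (k : 'I_(D1.+1 + D2.+1)) : quad h := match split k with
  | inl i => qpair h (s ^+ i * t ^+ (D1 - i)) 0
  | inr j => qpair h 0 (s ^+ j * t ^+ (D2 - j)) end.
have /fin_all_exists[b hb] k : exists f, f \is d.-homog /\ th f = T k.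
  rewrite /T; case: (split k) => [i|j].
    have [f hf ef] : exists2 f, f \is d.-homog &
        th f = qconst h (s ^+ i * t ^+ (D1 - i)).
      by apply: theta_even; rewrite subnKC // -ltnS.
    by exists f.
  have [f hf ef] : exists2 f, f \is d.-1.+1.-homog &
      th f = qpair h 0 (s ^+ j * t ^+ (D2 - j)).
    by apply: theta_even_root; rewrite subnKC // -ltnS.
  by exists f; rewrite prednK // in hf.
exists b; split => [k|f hf]; first by case: (hb k).
have thE (u : 'rV_(D1.+1 + D2.+1)) : th (f - \sum_k u 0 k *: b k) =
    th f - qpair h (\sum_i u 0 (lshift _ i) *: (s ^+ i * t ^+ (D1 - i)))
                   (\sum_j u 0 (rshift _ j) *: (s ^+ j * t ^+ (D2 - j))).
  rewrite rmorphB rmorph_sum big_split_ord /=; congr (_ - _).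
  rewrite (eq_bigr (fun i => qpair h (u 0 (lshift _ i) *:
      (s ^+ i * t ^+ (D1 - i))) 0)) => [|i _]; last first.
    rewrite /= theta_Z; case: (hb (lshift _ i)) => _ ->.
    rewrite /T -[lshift _ _]/(unsplit (inl i)) unsplitK qconstM.
    by rewrite mul_mpolyC mulr0.
  rewrite [X in _ + X](eq_bigr (fun j => qpair h 0 (u 0 (rshift _ j) *:
      (s ^+ j * t ^+ (D2 - j))))) => [|j _]; last first.
    rewrite /= theta_Z; case: (hb (rshift _ j)) => _ ->.
    rewrite /T -[rshift _ _]/(unsplit (inr j)) unsplitK qconstM.
    by rewrite mulr0 mul_mpolyC.
  have sumq (I : finType) (F G : I -> P2) : \sum_i qpair h (F i) (G i) =
      qpair h (\sum_i F i) (\sum_i G i).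
    elim/big_rec3: _ => //= i a1 a2 a3 _ ->.
    by apply: qpairP.
  by rewrite !sumq; apply: qpairP; rewrite !quadE /= !big1_eq ?addr0 ?add0r.
have [h1 h2] := theta_homog c W hf.
have h2' : (th f).2 \is D2.-homog by case: (d) d0 h2 @D2 @T b hb thE.
pose u : 'rV_(D1.+1 + D2.+1) := row_mx
  (\row_i (th f).1@_(mon2 i (D1 - i))) (\row_j (th f).2@_(mon2 j (D2 - j))).
exists u; split => [|u' ].
  rewrite /ell_ideal thE; apply/eqP; rewrite subr_eq0; apply/eqP.
  apply: qpairP => /=.
    rewrite {1}(binary_form h1); apply: eq_bigr => i _.
    by rewrite row_mxEl mxE.
  rewrite {1}(binary_form h2'); apply: eq_bigr => i _.
  by rewrite row_mxEr mxE.
rewrite /ell_ideal thE => /eqP; rewrite subr_eq0 => /eqP e.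
apply/rowP => k; rewrite -[k]splitK; case: (split k) => i /=.
  by rewrite row_mxEl mxE e mcoeff_binary.
by rewrite row_mxEr mxE e mcoeff_binary.
Qed.

Lemma ell_curve : curve_of_degree_genus (ell_ideal c W) 4 1.
Proof.
split => //; exists 1%N => d d0; exists (4 * d)%N; split; first exact: ell_hilbert.
by rewrite PoszM addrK.
Qed.

(** *** Projective normality *)

(** The extension to [K[s, t][sqrt h]] of the involution [s, t |-> -s, -t]; its
    invariants are the values of [theta]. *)
Definition qneg (x : quad h) : quad h := qpair h (negvar x.1) (negvar x.2).

Lemma negvar_h : negvar h = h.
Proof.
pose f : {rmorphism P2 -> P2} := @negvar K.
rewrite -[LHS]/(f _) /ell_h (rmorphD f) !(rmorphM f) (rmorphB f) !(rmorphM f).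
rewrite /f /= !negvarC !negvarX; ring.
Qed.

Lemma qnegD x y : qneg (x + y) = qneg x + qneg y.
Proof. by apply: qpairP; rewrite /qneg /= rmorphD. Qed.

Lemma qnegM x y : qneg (x * y) = qneg x * qneg y.
Proof.
apply: qpairP; rewrite /qneg /= ?quadE !rmorphD !rmorphM //=.
by rewrite negvar_h.
Qed.

Lemma qneg_const p : qneg (qconst h p) = qconst h (negvar p).
Proof. by apply: qpairP; rewrite /= ?rmorph0. Qed.

Lemma qneg1 : qneg 1 = 1.
Proof. by apply: qpairP; rewrite /= ?rmorph1 ?rmorph0. Qed.

Lemma qnegY i : qneg (Y i) = Y i.
Proof.
rewrite /ell_Y; do 3?case: ifP => _; rewrite ?qneg_const; last first.
  by apply: qpairP; rewrite /= ?rmorph0 ?rmorph1.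
all: congr (qconst _ _); rewrite rmorphM /= negvarC; congr (_ * _).
- by rewrite rmorphM /= !negvarX mulrNN.
- by rewrite rmorphB !rmorphXn /= !negvarX !sqrrN.
by rewrite rmorphD !rmorphXn /= !negvarX !sqrrN.
Qed.

Lemma qneg_theta f : qneg (th f) = th f.
Proof.
have q0 : qneg 0 = 0 by apply: qpairP; rewrite /= rmorph0.
have qsum (I : Type) (r : seq I) (F : I -> quad h) :
    (forall i, qneg (F i) = F i) -> qneg (\sum_(i <- r) F i) = \sum_(i <- r) F i.
  move=> hF; elim/big_ind: _ => // x y ex ey; by rewrite qnegD ex ey.
have qexp x k : qneg x = x -> qneg (x ^+ k) = x ^+ k.
  by move=> ex; elim: k => [|k IH]; rewrite ?qneg1 // exprS qnegM ex IH.
rewrite (mpolyE f) rmorph_sum; apply: (@qsum) => m /=.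
rewrite theta_Z qnegM qneg_const negvarC; congr (_ * _).
rewrite /theta mmapX /mmap1; elim/big_ind: _ => [|x y ex ey|i _].
- exact: qneg1.
- by rewrite qnegM ex ey.
apply: qexp; apply: (@qsum) => j; rewrite qnegM qnegY qneg_const.
by rewrite negvarC.
Qed.

Lemma qneg_image x : qneg x = x -> exists f, th f = x.
Proof.
move=> ex.
have ev (p : P2) (m : 'X_{1..2}) : negvar p = p -> m \in msupp p ->
    exists d, (m 0%R + m 1%R = 2 * d)%N.
  move=> ep mp; have := congr1 (mcoeff m) ep; rewrite mcoeff_negvar.
  move: mp; rewrite mcoeff_msupp => pm.
  rewrite {1}(mon2P m) mdeg_mon2 -signr_odd.
  have [od|] := boolP (odd (m 0%R + m 1%R)); last by exists ((m 0%R + m 1%R)./2); lia.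
  rewrite expr1 mulN1r => /eqP; rewrite eq_sym -addr_eq0 -mulr2n mulrn_eq0 /=.
  by rewrite (negbTE pm).
have sumE (p : P2) (F : P2 -> quad h) : (forall a b, F (a + b) = F a + F b) ->
    F 0 = 0 -> (forall k a, F (k *: a) = qconst h k%:MP * F a) ->
    (forall m, m \in msupp p -> exists f, th f = F 'X_[m]) ->
    exists f, th f = F p.
  move=> hD h0 hZ hm; rewrite {1}(mpolyE p).
  have : {subset msupp p <= msupp p} by [].
  elim: {1 3}(msupp p) => [|m r IH] hr.
    by exists 0; rewrite big_nil h0 rmorph0.
  have [|f ef] := IH; first by move=> k kr; apply: hr; rewrite inE kr orbT.
  have [g eg] := hm m (hr m (mem_head _ _)).
  exists (p@_m *: g + f); rewrite big_cons hD hZ -ef -eg rmorphD /=.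
  by rewrite theta_Z.
have [f1 e1] : exists f, th f = qconst h x.1.
  apply: (sumE x.1 (qconst h)) => [a b||k a|m mx].
  - exact: rmorphD.
  - exact: rmorph0.
  - by rewrite -mul_mpolyC rmorphM.
  have [|d hd] := ev _ _ _ mx; first by have := congr1 fst ex.
  by have [f _ ef] := theta_even hd; exists f; rewrite (mon2P m) mon2E.
have [f2 e2] : exists f, th f = qpair h 0 x.2.
  apply: (sumE x.2 (qpair h 0)) => [a b||k a|m mx] //.
  - by apply: qpairP; rewrite /= ?quadE /= ?addr0.
  - by rewrite qconstM /= mulr0 mul_mpolyC.
  have [|d hd] := ev _ _ _ mx; first by have := congr1 snd ex.
  by have [f _ ef] := theta_even_root hd; exists f; rewrite (mon2P m) mon2E.
exists (f1 + f2); rewrite rmorphD /= e1 e2; apply: qpairP; rewrite quadE /=.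
  by rewrite addr0.
by rewrite add0r.
Qed.

(** An integral equation of [a / b], as an equation of [a * b' / N]. *)
Lemma rationalize_integral_eq (R : comNzRingType) (a b b' N : R) m (k : nat -> R) :
  N = b * b' -> a ^+ m + \sum_(i < m) k i * a ^+ i * b ^+ (m - i) = 0 ->
  (a * b') ^+ m + \sum_(i < m) k i * (a * b') ^+ i * N ^+ (m - i) = 0.
Proof.
move=> -> e; have := congr1 (fun x => x * b' ^+ m) e; rewrite /= mul0r => e2.
rewrite -[RHS]e2 mulrDl exprMn mulr_suml; congr (_ + _); apply: eq_bigr => i _.
have -> : b' ^+ m = b' ^+ i * b' ^+ (m - i) by rewrite -exprD subnKC // ltnW.
by rewrite !exprMn; ring.
Qed.

Lemma rationalize_quotient (R : comNzRingType) (a b b' N y : R) :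
  a * b' = N * y -> b * b' = N -> (a - b * y) * b' = 0.
Proof. by move=> e1 e2; rewrite mulrBl e1 -e2 mulrAC subrr. Qed.

(** After multiplication by the conjugate of its denominator, an integral fraction
    lies in [K[s, t][sqrt h]] by [quad_normal2]; it is invariant under the
    involution, hence a value of [theta]. *)
Lemma ell_normal : projectively_normal (ell_ideal c W).
Proof.
move=> a b m k; rewrite /ell_ideal => tb0; have dom := ell_domain c_inj.
have cb0 : qconj (th b) <> 0.
  move=> z; apply: tb0; have := congr1 (@qconj _ h) z.
  by move=> e; apply: qpairP; have := congr1 fst e; have := congr1 snd e => //=;
     rewrite ?opprK ?oppr0.
have N0 : qnorm (th b) != 0.
  apply/eqP => z; have := mul_qconj (th b); rewrite z rmorph0.
  by case/dom.
move=> e.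
have e' : (th a * qconj (th b)) ^+ m + \sum_(i < m) th (k i) *
    (th a * qconj (th b)) ^+ i * qconst h (qnorm (th b)) ^+ (m - i) = 0.
  apply: (@rationalize_integral_eq _ _ _ _ _ m (fun i => th (k i))
    (esym (mul_qconj (th b)))).
  move: e; rewrite rmorphD rmorph_sum rmorphXn /= => e.
  rewrite -[RHS]e; congr (_ + _); apply: eq_bigr => i _.
  by rewrite !rmorphM !rmorphXn.
have hs := @ell_sep _ _ c_inj.
have [y ey] := @quad_normal2 _ h hs (th a * qconj (th b)) (qnorm (th b)) m
  (fun i => th (k i)) N0 e'.
have ay : th a = th b * y.
  apply/eqP; rewrite -subr_eq0; apply/eqP.
  have : (th a - th b * y) * qconj (th b) = 0.
    by move: ey (mul_qconj (th b)); apply: rationalize_quotient.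
  by case/dom.
have [r er] : exists r, th r = y.
  apply: qneg_image.
  have : th b * (qneg y - y) = 0.
    by rewrite mulrBr -{1}(qneg_theta b) -qnegM -ay qneg_theta subrr.
  by case/dom => [//|/eqP]; rewrite subr_eq0 => /eqP.
by exists r; rewrite rmorphB rmorphM /= er ay mulrC subrr.
Qed.

End EllipticCurve2.

(** ** Smoothness of the elliptic quartic *)

Section Jacobian.
Variables (K : fieldType) (n : nat).

Lemma pevalD (f g : {mpoly K[n]}) p : peval (f + g) p = peval f p + peval g p.
Proof. exact: mevalD. Qed.
Lemma pevalM (f g : {mpoly K[n]}) p : peval (f * g) p = peval f p * peval g p.
Proof. exact: mevalM. Qed.
Lemma peval0 (p : 'rV[K]_n) : peval 0 p = 0.
Proof. exact: meval0. Qed.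
Lemma pevalZ k (f : {mpoly K[n]}) p : peval (k *: f) p = k * peval f p.
Proof. exact: mevalZ. Qed.
Lemma pevalX i (p : 'rV[K]_n) : peval 'X_i p = p 0 i.
Proof. exact: mevalXU. Qed.
Lemma peval_sum (I : Type) (r : seq I) (P : pred I) (F : I -> {mpoly K[n]}) p :
  peval (\sum_(i <- r | P i) F i) p = \sum_(i <- r | P i) peval (F i) p.
Proof. by elim/big_rec2: _ => [|i a b _ <-]; rewrite ?peval0 ?pevalD. Qed.

Lemma peval_linform (v p : 'rV[K]_n) : peval (linform v) p = (p *m v^T) 0 0.
Proof.
rewrite peval_sum mxE; apply: eq_bigr => j _.
by rewrite pevalZ pevalX mxE mulrC.
Qed.

Lemma peval_qform (A : 'M[K]_n) p : peval (qform A) p = (p *m A *m p^T) 0 0.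
Proof.
rewrite peval_sum mxE.
rewrite (eq_bigr (fun i => \sum_j A i j * (p 0 i * p 0 j))); last first.
  by move=> i _; rewrite peval_sum; apply: eq_bigr => j _; rewrite pevalZ pevalM !pevalX.
rewrite exchange_big; apply: eq_bigr => j _; rewrite !mxE mulr_suml.
by apply: eq_bigr => i _; ring.
Qed.

Lemma mderiv_sum i (I : Type) (r : seq I) (P : pred I) (F : I -> {mpoly K[n]}) :
  (\sum_(k <- r | P k) F k)^`M(i) = \sum_(k <- r | P k) (F k)^`M(i).
Proof. by elim/big_rec2: _ => [|k a b _ <-]; rewrite ?mderiv0 ?mderivD. Qed.

Lemma mderivXU i j : ('X_j : {mpoly K[n]})^`M(i) = (j == i)%:R%:MP.
Proof.
rewrite mderivX mnm1E; case: eqP => [->|_]; last by rewrite scale0r mpolyC0.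
rewrite scale1r (_ : (U_(i) - U_(i))%MM = 0%MM) ?mpolyX0 //.
by apply/mnmP => k; rewrite mnmBE subnn mnm0E.
Qed.

Lemma mderiv_linform (v : 'rV[K]_n) i p : peval (linform v)^`M(i) p = v 0 i.
Proof.
rewrite mderiv_sum peval_sum (bigD1 i) //= mderivZ mderivXU eqxx pevalZ.
rewrite [peval _ _]mevalC mulr1 big1 ?addr0 // => j ji.
by rewrite mderivZ mderivXU (negbTE ji) pevalZ [peval _ _]mevalC mulr0.
Qed.

Lemma mderiv_qform (A : 'M[K]_n) i p : symmetric_mx A ->
  peval (qform A)^`M(i) p = 2%:R * (p *m A) 0 i.
Proof.
move=> sA.
have -> : peval (qform A)^`M(i) p =
   \sum_a \sum_b A a b * ((a == i)%:R * p 0 b + p 0 a * (b == i)%:R).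
  rewrite mderiv_sum peval_sum; apply: eq_bigr => a _.
  rewrite mderiv_sum peval_sum; apply: eq_bigr => b _.
  rewrite mderivZ pevalZ mderivM !mderivXU pevalD !pevalM !pevalX.
  by rewrite ![peval _%:MP _]mevalC.
rewrite (eq_bigr (fun a => (a == i)%:R * (\sum_b A a b * p 0 b) + p 0 a * A a i)).
  rewrite big_split /= (bigD1 i) //= eqxx mul1r [X in _ + X + _]big1 ?addr0; last first.
    by move=> j /negbTE ji; rewrite ji mul0r.
  rewrite mulr_natl mulr2n mxE; congr (_ + _); apply: eq_bigr => b _.
  by rewrite -{1}sA mxE mulrC.
move=> a _; rewrite (eq_bigr (fun b => (a == i)%:R * (A a b * p 0 b) +
  p 0 a * A a b * (b == i)%:R)); last by move=> b _; ring.
rewrite big_split -mulr_sumr /=; congr (_ + _).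
rewrite (bigD1 i) //= eqxx mulr1 big1 ?addr0 // => j /negbTE ji.
by rewrite ji mulr0.
Qed.

End Jacobian.

Section Ideals.
Variables (K : fieldType) (n : nat).
Implicit Types (I J : {mpoly K[n]} -> Prop).

Lemma ideal_gen_sub I (r : seq {mpoly K[n]}) :
  is_ideal I -> (forall f, f \in r -> I f) -> forall f, ideal_gen r f -> I f.
Proof.
move=> [i0 iD iM] hr f [d ->].
have h (i : nat) : (i < size r)%N -> I (d i * r`_i).
  by move=> hi; apply: iM; apply: hr; apply: mem_nth.
elim: (size r) h => [|k IH] h; first by rewrite big_ord0.
rewrite big_ord_recr /=; apply: iD; last exact: h.
by apply: IH => i hi; apply: h; apply: ltnW.
Qed.

Lemma subscheme_of_sub I J : (forall f, J f -> I f) -> subscheme I J.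
Proof. by move=> h f [k hk]; exists k => g hg; apply/h/hk. Qed.

End Ideals.

Section EllipticSmooth.
Variables (K : numClosedFieldType) (c : 'I_4 -> K).
Hypothesis c_inj : injective c.
Variables (W V : 'M[K]_(4, 7)).
Hypothesis VW : V *m W^T = 1%:M.
Variables (B1 B2 : 'M[K]_7).
Hypotheses (sB1 : symmetric_mx B1) (sB2 : symmetric_mx B2).
Hypothesis eB1 : W *m B1 *m W^T = 1%:M.
Hypothesis eB2 : W *m B2 *m W^T = diag_mx (\row_i c i).
Local Notation I := (ell_ideal c W).

Lemma ell_ideal_linform (v : 'rV_7) : v *m W^T = 0 -> I (linform v).
Proof.
move=> v0; rewrite /ell_ideal theta_linform v0 big1 // => i _.
by rewrite mxE rmorph0 mul0r.
Qed.

Lemma ell_ideal_qform (A : 'M_7) a b :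
  W *m A *m W^T = a%:M + b *: diag_mx (\row_i c i) -> I (qform A).
Proof.
move=> eA; rewrite /ell_ideal theta_qform eA.
rewrite (eq_bigr (fun i => qconst _ a%:MP * (ell_Y c i * ell_Y c i) +
   qconst _ b%:MP * (qconst _ (c i)%:MP * (ell_Y c i * ell_Y c i)))).
  by rewrite big_split /= -!mulr_sumr ell_rel1 ell_rel2 // !mulr0 addr0.
move=> i _; rewrite (bigD1 i) //= !mxE eqxx !mulr1n big1 ?addr0.
  rewrite mpolyCD mpolyCM rmorphD rmorphM /= mulrDl; congr (_ + _).
  by rewrite -[LHS]mulrA.
move=> j /negbTE ji; rewrite !mxE eq_sym ji !mulr0n mulr0 addr0.
by rewrite rmorph0 mul0r.
Qed.

(** Equations of the row space of [W]. *)
Lemma annihilator_ex : exists R : 'M[K]_(3, 7), row_free R /\ R *m W^T = 0.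
Proof.
pose L : 'M[K]_7 := kermx W^T.
have LW : L *m W^T = 0 by apply: mulmx_ker.
have rW : \rank W = 4%N.
  apply/eqP; rewrite eqn_leq rank_leq_row -{1}(mxrank1 K 4) -VW.
  by rewrite -(mxrank_tr W) mxrankM_maxr.
have rL : \rank L = 3%N by rewrite mxrank_ker mxrank_tr rW.
suff : exists R : 'M[K]_(\rank L, 7), row_free R /\ R *m W^T = 0 by rewrite rL.
exists (row_base L); split; first exact: row_base_free.
have /submxP[D ->] : (row_base L <= L)%MS by rewrite eq_row_base.
by rewrite -mulmxA LW mulmx0.
Qed.

Lemma span_of_annihilator (R : 'M[K]_(3, 7)) (p : 'rV_7) :
  row_free R -> R *m W^T = 0 -> p *m R^T = 0 -> exists y, p = y *m W.
Proof.
move=> rR RW pR; apply/submxP.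
have rW : \rank W = 4%N.
  apply/eqP; rewrite eqn_leq rank_leq_row -{1}(mxrank1 K 4) -VW.
  by rewrite -(mxrank_tr W) mxrankM_maxr.
have WR : (W <= kermx R^T)%MS.
  by apply/sub_kermxP; rewrite -[W]trmxK -trmx_mul RW trmx0.
have [_ e] := mxrank_leqif_sup WR.
apply: submx_trans (_ : (kermx R^T <= W)%MS); first exact/sub_kermxP.
by rewrite -e mxrank_ker mxrank_tr rW (eqP rR).
Qed.

(** At a point [y *m W] of the curve, a linear relation between the gradients of
    the two quadrics and the equations of the 3-space gives [(a + b * c_i) * y_i =
    0] for all [i]; two coordinates [y_i] are nonzero, because the sum of their
    squares is zero. *)
Lemma ell_smooth : smooth_of_codim 5 I.
Proof.
move=> p p0 pI; have [R [rR RW]] := annihilator_ex.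
have iL k : I (linform (row k R)).
  by apply: ell_ideal_linform; rewrite -row_mul RW row0.
have [y ey] : exists y, p = y *m W.
  apply: span_of_annihilator rR RW _; apply/rowP => k; rewrite [RHS]mxE.
  have := pI _ (iL k); rewrite peval_linform => e.
  by rewrite -[RHS]e !mxE; apply: eq_bigr => j _; rewrite !mxE.
have i1 : I (qform B1).
  by apply: (@ell_ideal_qform _ 1 0); rewrite eB1 scale0r addr0.
have i2 : I (qform B2).
  by apply: (@ell_ideal_qform _ 0 1); rewrite eB2 scale1r raddf0 add0r.
pose f (i : 'I_(1 + 1 + 3)) : {mpoly K[7]} := match split i with
  | inl k => if split k is inl _ then qform B1 else qform B2
  | inr k => linform (row k R) end.
pose J : 'M_(1 + 1 + 3, 7) := col_mx (col_mx (2%:R *: (p *m B1)) (2%:R *: (p *m B2))) R.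
have fJ : jacobian f p = J.
  apply/matrixP => i j; rewrite !mxE /f; case: (split i) => [k|k].
    by rewrite mxE; case: (split k) => k'; rewrite mderiv_qform // !mxE ord1.
  by rewrite mderiv_linform mxE.
exists f; split.
  move=> i; rewrite /f; case: (@split (1 + 1) 3 i) => k; last exact: iL.
  by case: (split k) => _; [exact: i1 | exact: i2].
suff rJ : row_free J by rewrite fJ; apply/eqP.
rewrite -kermx_eq0; apply/rowV0P => u /sub_kermxP.
rewrite -[u]hsubmxK -[lsubmx u]hsubmxK.
move: (rsubmx u) (lsubmx (lsubmx u)) (rsubmx (lsubmx u)) => w a' b'.
rewrite [a']mx11_scalar [b']mx11_scalar; move: (a' 0 0) (b' 0 0) => a1 b1.
rewrite /J !mul_row_col !mul_scalar_mx !scalerA.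
set a := a1 * _; set b := b1 * _ => eJ.
have eY : forall i, (a + b * c i) * y 0 i = 0.
  move=> i; have := congr1 (fun M => (M *m W^T) 0 i) eJ.
  rewrite /= !mulmxDl -mulmxA RW mulmx0 addr0 -!scalemxAl ey.
  rewrite -!mulmxA [W *m (_ *m _)]mulmxA eB1 [W *m (_ *m _)]mulmxA eB2.
  by rewrite mulmx1 mul0mx mul_mx_diag !mxE => <-; ring.
have [i [j [ij yi yj]]] : exists i j, [/\ i != j, y 0 i != 0 & y 0 j != 0].
  have y0 : y != 0 by apply: contraNneq p0 => z; rewrite ey z mul0mx.
  have [k [i yi]] := matrix_neq0P y0; rewrite ord1 in yi => {k}.
  have sq : \sum_i y 0 i ^+ 2 = 0.
    have := pI _ i1; rewrite peval_qform ey trmx_mul !mulmxA.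
    rewrite -[y *m W *m B1]mulmxA -[y *m _ *m W^T]mulmxA eB1 mulmx1 mxE => s0.
    rewrite -[RHS]s0.
    by apply: eq_bigr => k _; rewrite mxE expr2.
  have [/existsP[j /andP[ji yj]]|] := boolP [exists j, (j != i) && (y 0 j != 0)].
    by exists i, j; rewrite eq_sym.
  rewrite negb_exists => /forallP h; move: sq; rewrite (bigD1 i) //= big1.
    by rewrite addr0 => /eqP; rewrite expf_eq0 (negbTE yi).
  move=> j ji; have := h j; rewrite ji negbK => /eqP ->.
  by rewrite expr0n.
have ei : a + b * c i = 0.
  by have /eqP := eY i; rewrite mulf_eq0 (negbTE yi) orbF => /eqP.
have ej : a + b * c j = 0.
  by have /eqP := eY j; rewrite mulf_eq0 (negbTE yj) orbF => /eqP.
have b0 : b = 0.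
  have : b * (c i - c j) = 0 by rewrite -[RHS](subr0 0) -{1}ei -ej; ring.
  move/eqP; rewrite mulf_eq0 subr_eq0 (inj_eq c_inj) (negbTE ij) orbF.
  by move/eqP.
have a0 : a = 0 by move: ei; rewrite b0 mul0r addr0.
have w0 : w = 0.
  move: eJ; rewrite a0 b0 !scale0r !add0r => /eqP.
  by rewrite mulmx_free_eq0 // => /eqP.
have n2 : 2%:R != 0 :> K by rewrite pnatr_eq0.
have -> : a1 = 0 by move/eqP: a0; rewrite mulf_eq0 (negbTE n2) orbF => /eqP.
have -> : b1 = 0 by move/eqP: b0; rewrite mulf_eq0 (negbTE n2) orbF => /eqP.
by rewrite w0 raddf0 !row_mx0.
Qed.

End EllipticSmooth.

(** If the quadrics of the net restrict to the 3-space of the rows of [W] as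
    combinations of [sum y_i ^+ 2] and [sum c_i * y_i ^+ 2], with distinct [c_i],
    then the threefold contains the elliptic quartic with these equations. *)
Lemma elliptic_quartic_exists (K : numClosedFieldType) (A : 'I_3 -> 'M[K]_7)
    (W V : 'M[K]_(4, 7)) (B1 B2 : 'M[K]_7) (c : 'I_4 -> K) :
  injective c -> V *m W^T = 1%:M -> symmetric_mx B1 -> symmetric_mx B2 ->
  W *m B1 *m W^T = 1%:M -> W *m B2 *m W^T = diag_mx (\row_i c i) ->
  (forall k, exists a b, W *m A k *m W^T = a%:M + b *: diag_mx (\row_i c i)) ->
  exists C : {mpoly K[7]} -> Prop,
    [/\ elliptic_curve C 4, projectively_normal C & subscheme C (V8_ideal A)].
Proof.
move=> ci VW s1 s2 e1 e2 hA; exists (ell_ideal c W); split.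
- split; [exact: ell_ideal_homog|exact: ell_ideal_prime|exact: ell_curve VW|].
  exact: ell_smooth VW _ _ s1 s2 e1 e2.
- exact: ell_normal VW.
apply: subscheme_of_sub; apply: ideal_gen_sub (ell_ideal_ideal c W) _ => q.
by case/mapP => k _ ->; have [a [b e]] := hA k; apply: ell_ideal_qform e.
Qed.

(** * Generic properties of nets of quadrics *)

Section NetAlgebra.
Variable K : fieldType.
Local Notation net := ('I_3 -> 'M[K]_7).

(** Polynomials in the entries of the three matrices. *)
Definition net_reg (F : net -> K) :=
  exists f, forall A, F A = peval f (net_coords A).

Lemma net_reg_ext F G : net_reg F -> F =1 G -> net_reg G.
Proof. by move=> [f e] FG; exists f => A; rewrite -FG. Qed.
Lemma net_reg_cst c : net_reg (fun=> c).
Proof. by exists c%:MP => A; rewrite /peval mevalC. Qed.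
Lemma net_reg_add F G : net_reg F -> net_reg G -> net_reg (fun A => F A + G A).
Proof. by move=> [f e] [g e']; exists (f + g) => A; rewrite pevalD e e'. Qed.
Lemma net_reg_mul F G : net_reg F -> net_reg G -> net_reg (fun A => F A * G A).
Proof. by move=> [f e] [g e']; exists (f * g) => A; rewrite pevalM e e'. Qed.

Definition net_alg : falg K net :=
  FAlg net_reg_ext net_reg_cst net_reg_add net_reg_mul.

Lemma mreg_net k : mreg net_alg (fun A => A k).
Proof.
move=> i j; exists ('X_(mxvec_index k (mxvec_index i j))) => A.
by rewrite pevalX /net_coords mxvecE mxE mxvecE.
Qed.

Definition symmetric_net (A : net) : Prop := forall k, symmetric_mx (A k).

(** [P] holds on a nonempty principal open subset of the space of symmetric
    triples. *)
Definition generic (P : net -> Prop) : Prop := exists E,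
  [/\ net_alg E, exists2 A, symmetric_net A & E A != 0
    & forall A, symmetric_net A -> E A != 0 -> P A].

End NetAlgebra.

Section Density.
Variable K : numFieldType.
Local Notation net := ('I_3 -> 'M[K]_7).

(** The space of symmetric triples is irreducible: restrict to the line through
    two points. *)
Lemma net_irreducible (E F : net -> K) A B : net_alg K E -> net_alg K F ->
  symmetric_net A -> symmetric_net B -> E A != 0 -> F B != 0 ->
  exists C, [/\ symmetric_net C, E C != 0 & F C != 0].
Proof.
move=> [e he] [f hf] sA sB EA FB.
pose x := net_coords A; pose y := net_coords B.
pose l (g : {mpoly K[3 * (7 * 7)]}) : {poly K} :=
  mmap (@polyC K) (fun i => (x 0 i)%:P + (y 0 i - x 0 i) *: 'X) g.
have hl g t : (l g).[t] = peval g (x + t *: (y - x)).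
  rewrite /l /peval /meval /mmap horner_sum; apply: eq_bigr => m _.
  rewrite hornerM hornerC; congr (_ * _); rewrite /mmap1 horner_prod.
  apply: eq_bigr => i _; rewrite horner_exp hornerD hornerC hornerZ hornerX !mxE.
  by rewrite mulrC.
have l0 : l e != 0.
  apply: contraNneq EA => z; rewrite he -/x.
  by rewrite -[x]addr0 -(scale0r (y - x)) -hl z horner0.
have l1 : l f != 0.
  apply: contraNneq FB => z; rewrite hf -/y.
  by rewrite -[y](subrKC x) -[y - x]scale1r -hl z horner0.
have /poly_nonroot[t] := mulf_neq0 l0 l1.
rewrite hornerM mulf_eq0 negb_or !hl => /andP[h1 h2].
pose C k := A k + t *: (B k - A k).
have eC : net_coords C = x + t *: (y - x).
  apply/rowP => a; case/mxvec_indexP: a => k a; case/mxvec_indexP: a => i j.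
  by rewrite !mxE /x /y /net_coords !mxvecE !mxE !mxvecE !mxE.
exists C; split; last 2 first.
- by rewrite he eC.
- by rewrite hf eC.
move=> k; apply/matrixP => i j.
by rewrite /C -[in RHS](sA k) -[in RHS](sB k) !mxE.
Qed.

Lemma generic_and (P Q : net -> Prop) :
  generic P -> generic Q -> generic (fun A => P A /\ Q A).
Proof.
move=> [E [hE [A sA EA] hP]] [F [hF [B sB FB] hQ]].
have [C [sC EC FC]] := net_irreducible hE hF sA sB EA FB.
exists (fun A => E A * F A); split; first exact: freg_mul.
  by exists C => //; rewrite mulf_neq0.
move=> D sD; rewrite mulf_eq0 negb_or => /andP[ED FD].
by split; [apply: hP | apply: hQ].
Qed.

End Density.

Section NetIdeal.
Variables (K : fieldType).

Lemma ideal_gen_mem n (r : seq {mpoly K[n]}) f : f \in r -> ideal_gen r f.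
Proof.
move=> fr; exists (fun i => (i == index f r)%:R).
have hi : (index f r < size r)%N by rewrite index_mem.
rewrite (bigD1 (Ordinal hi)) //= eqxx mul1r nth_index // big1 ?addr0 // => i.
by rewrite -val_eqE /= => /negbTE ir; rewrite ir mul0r.
Qed.

Lemma net_form_mem (A : 'I_3 -> 'M[K]_7) k : V8_ideal A (qform (A k)).
Proof. by apply: ideal_gen_mem; apply: map_f; rewrite mem_enum. Qed.

Lemma V8_idealP (A : 'I_3 -> 'M[K]_7) f : V8_ideal A f ->
  exists d : 'I_3 -> {mpoly K[7]}, f = \sum_k d k * qform (A k).
Proof.
apply: (@ideal_gen_sub _ _ (fun f => exists d : 'I_3 -> {mpoly K[7]},
  f = \sum_k d k * qform (A k))) => [|g /mapP[k _ ->]].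
  split=> [|g1 g2 [d1 ->] [d2 ->]|g1 g2 [d ->]].
  - by exists (fun=> 0); rewrite big1 // => k _; rewrite mul0r.
  - exists (fun k => d1 k + d2 k); rewrite -big_split; apply: eq_bigr => k _ /=.
    by rewrite mulrDl.
  - exists (fun k => g1 * d k); rewrite mulr_sumr; apply: eq_bigr => k _.
    by rewrite mulrA.
exists (fun j => (j == k)%:R); rewrite (bigD1 k) //= eqxx mul1r big1 ?addr0 //.
by move=> j /negbTE jk; rewrite jk mul0r.
Qed.
End NetIdeal.

(** ** Smoothness *)

Section GenericSmooth.
Variable K : numFieldType.
Local Notation net := ('I_3 -> 'M[K]_7).
Local Notation O := (net_alg K).

(** Half the gradients of the three quadrics at [p]. *)
Definition gradients (A : net) (p : 'rV[K]_7) : 'M[K]_(3, 7) :=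
  \matrix_(k, j) (p *m A k) 0 j.

(** The common zeros of the quadrics where the gradients are dependent, that is,
    where all 3 by 3 minors vanish. *)
Definition singular_at (A : net) (p : 'rV[K]_7) : Prop :=
  (forall k, peval (qform (A k)) p = 0) /\
  (forall f : {ffun 'I_3 -> 'I_7}, \det (colsub f (gradients A p)) = 0).

Lemma rform_gradients k j : rform O 1 (fun A p => gradients A p k j).
Proof.
apply: (@rform_ext _ net O _ _ (fun A p => \sum_i A k i j * p 0 i)).
  apply: rform_sum => i; apply: rform_scale; last exact: rform_X.
  exact: mreg_net.
by move=> A p; rewrite !mxE; apply: eq_bigr => i _; rewrite mulrC.
Qed.

(** The diagonal net with eigenvalues [l ^ k] for [k < 3] and [l < 7]. *)
Definition diag_net : net := fun k => diag_mx (\row_(l < 7) l%:R ^+ k).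

Let lift := lifted O singular_at diag_net.

Lemma diag_net_sym : symmetric_net diag_net.
Proof. by move=> k; rewrite /symmetric_mx tr_diag_mx. Qed.

Lemma lift_quadric (k : 'I_3) :
  lift 2 (fun p => \sum_(l < 7) l%:R ^+ k * p 0 l ^+ 2).
Proof.
exists (fun A p => peval (qform (A k)) p); split; last 2 first.
- by move=> A p [].
- move=> p; rewrite peval_qform mul_mx_diag mxE; apply: eq_bigr => l _.
  by rewrite !mxE expr2; ring.
apply: (@rform_ext _ net O _ _ (fun A p => \sum_i \sum_j A k i j * (p 0 i * p 0 j))).
  apply: rform_sum => i; apply: rform_sum => j; apply: rform_scale.
    exact: mreg_net.
  by apply: (@rform_mul _ _ _ _ 1 1); apply: rform_X.
move=> A p; rewrite peval_sum; apply: eq_bigr => i _.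
by rewrite peval_sum; apply: eq_bigr => j _; rewrite pevalZ pevalM !pevalX.
Qed.

Lemma lift_interp (u v : K) :
  lift 2 (fun p => \sum_(l < 7) (u + v * l%:R) * p 0 l ^+ 2).
Proof.
have h0 := lift_quadric 0; have h1 := lift_quadric 1.
apply: lifted_ext (lifted_add (lifted_scale u h0) (lifted_scale v h1)) _ => p.
rewrite !mulr_sumr -big_split; apply: eq_bigr => l _ /=.
by rewrite expr0 expr1; ring.
Qed.

(** The minors of the gradients are Vandermonde determinants times monomials. *)
Lemma lift_minor (i j l : 'I_7) : i != j -> i != l -> j != l ->
  lift 3 (fun p => p 0 i * p 0 j * p 0 l).
Proof.
move=> ij il jl.
pose f : {ffun 'I_3 -> 'I_7} := [ffun k => tnth [tuple i; j; l] k].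
pose V : 'M[K]_3 := Vandermonde 3 (\row_k (f k)%:R).
have V0 : \det V != 0.
  rewrite det_Vandermonde; apply/prodf_neq0 => a _; apply/prodf_neq0 => b ab.
  rewrite !mxE subr_eq0 eqr_nat (inj_eq val_inj).
  have finj : injective f.
    move=> a1 a2; rewrite !ffunE !(tnth_nth i) => /eqP.
    rewrite nth_uniq ?ltn_ord //=; first by move/eqP/val_inj.
    by rewrite !inE negb_or ij il jl.
  by rewrite (inj_eq finj) eq_sym -val_eqE /= neq_ltn ab.
have h : lift 3 (fun p => \det V * (p 0 i * p 0 j * p 0 l)).
  exists (fun A p => \det (colsub f (gradients A p))); split.
  - apply: (@rform_det _ _ _ _ 1 3) => a b.
    by apply: rform_ext (rform_gradients a (f b)) _ => A p; rewrite !mxE.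
  - by move=> A p [].
  move=> p; have -> : colsub f (gradients diag_net p) =
      V *m diag_mx (\row_k p 0 (f k)).
    apply/matrixP => a b; rewrite mul_mx_diag !mxE (bigD1 (f b)) //= big1.
      by rewrite !mxE eqxx addr0 mulrC.
    by move=> k kb; rewrite !mxE (negbTE kb) mulr0.
  rewrite det_mulmx det_diag !big_ord_recl big_ord0 !mxE !ffunE; congr (_ * _).
  by rewrite mulr1 mulrA.
apply: lifted_ext (lifted_scale (\det V)^-1 h) _ => p.
by rewrite mulrA mulVf // mul1r.
Qed.

Lemma cform_X (n : nat) (i : 'I_n) : cform O 1 (fun p => p 0 i).
Proof. exact: rform_X. Qed.

Lemma cform_mul (n d e k : nat) (f g : 'rV[K]_n -> K) : cform O d f ->
  cform O e g -> (d + e)%N = k -> cform O k (fun p => f p * g p).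
Proof. by move=> hf hg <-; apply: rform_mul. Qed.

Let XX (i : 'I_7) : cform O 2 (fun p : 'rV[K]_7 => p 0 i * p 0 i).
Proof. exact: cform_mul (cform_X i) (cform_X i) _. Qed.

(** The quadric [\sum_l pi_l * x_l ^+ 2] with [pi_i = 1], [pi_j = 0], multiplied by
    [x_i ^+ 2 * x_j ^+ 2]: all other terms contain three distinct coordinates. *)
Lemma lift_42 (i j : 'I_7) : i != j ->
  lift 6 (fun p => p 0 i ^+ 4 * p 0 j ^+ 2).
Proof.
move=> ij; have d0 : i%:R - j%:R != 0 :> K by rewrite subr_eq0 eqr_nat.
pose pi (l : 'I_7) : K := (l%:R - j%:R) / (i%:R - j%:R).
have h1 : lift 6 (fun p => (p 0 i * p 0 i * (p 0 j * p 0 j)) *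
    \sum_l pi l * p 0 l ^+ 2).
  apply: (@lifted_mul _ _ _ _ _ _ 4 2).
    exact: cform_mul (XX i) (XX j) _.
  apply: lifted_ext (lift_interp (- j%:R / (i%:R - j%:R)) (i%:R - j%:R)^-1) _ => p.
  by apply: eq_bigr => l _; rewrite /pi; set d := (_ - _)^-1; ring.
have h2 : lift 6 (fun p => \sum_(l | (l != i) && (l != j))
    (pi l * (p 0 i * p 0 j * p 0 l)) * (p 0 i * p 0 j * p 0 l)).
  apply: lifted_sum => l /andP[li lj].
  apply: (@lifted_mul _ _ _ _ _ _ 3 3); last by apply: lift_minor; rewrite // eq_sym.
  apply: rform_scale; first exact: freg_cst.
  exact: cform_mul (cform_mul (cform_X _) (cform_X _) (erefl _)) (cform_X _) _.
apply: lifted_ext (lifted_sub h1 h2) _ => p.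
rewrite (bigD1 i) //= (bigD1 j) ?[j == i]eq_sym //= {2}/pi subrr mul0r mul0r add0r.
rewrite {1}/pi divff // mul1r mulrDr mulr_sumr.
rewrite (eq_bigr (fun l => pi l * (p 0 i * p 0 j * p 0 l) * (p 0 i * p 0 j * p 0 l))).
  by rewrite addrK; ring.
by move=> l _; ring.
Qed.

Lemma lift_6 (i : 'I_7) : lift 6 (fun p => p 0 i ^+ 6).
Proof.
have h1 : lift 6 (fun p => (p 0 i * p 0 i * (p 0 i * p 0 i)) *
    \sum_(l < 7) (1 + 0 * l%:R) * p 0 l ^+ 2).
  apply: (@lifted_mul _ _ _ _ _ _ 4 2) (lift_interp 1 0).
  exact: cform_mul (XX i) (XX i) _.
have h2 : lift 6 (fun p => \sum_(l | l != i) p 0 i ^+ 4 * p 0 l ^+ 2).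
  by apply: lifted_sum => l li; apply: lift_42; rewrite eq_sym.
apply: lifted_ext (lifted_sub h1 h2) _ => p.
rewrite (bigD1 i) //= mulrDr mulr_sumr.
rewrite (eq_bigr (fun l => p 0 i ^+ 4 * p 0 l ^+ 2)).
  by rewrite addrK; ring.
by move=> l _; ring.
Qed.

Lemma generic_smooth :
  generic (fun A : net => smooth_of_codim 3 (V8_ideal A)).
Proof.
have [E [hE E0 hs]] := elimination lift_6.
exists E; split => //; first by exists diag_net; [apply: diag_net_sym|].
move=> A sA EA p p0 pI.
have hI k : V8_ideal A (qform (A k)).
  exact: net_form_mem.
exists (fun k => qform (A k)); split => //.
have eJ : jacobian (fun k => qform (A k)) p = 2%:R *: gradients A p.
  by apply/matrixP => k j; rewrite !mxE mderiv_qform ?mxE.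
rewrite eJ mxrank_scale_nz ?pnatr_eq0 //.
have [/existsP[f hf]|] := boolP [exists f : {ffun 'I_3 -> 'I_7},
   \det (colsub f (gradients A p)) != 0].
  apply/eqP; rewrite -[_ == _]/(row_free _) -kermx_eq0; apply/rowV0P => u.
  move/sub_kermxP => uG.
  have : u *m colsub f (gradients A p) = 0.
    apply/rowP => j; rewrite mxE [RHS]mxE.
    by have /rowP/(_ (f j)) := uG; rewrite !mxE => e;
      rewrite -[RHS]e; apply: eq_bigr => k _; rewrite !mxE.
  move/eqP; rewrite mulmx_free_eq0; first by move/eqP.
  by rewrite row_free_unit unitmxE unitfE.
rewrite negb_exists => /forallP h; case/eqP: p0; apply: hs EA _.
by split=> [k|f]; [apply: pI|have := h f; rewrite negbK => /eqP].
Qed.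

End GenericSmooth.

(** ** The ranks of the quadrics of the net *)

Section GenericRank.
Variable K : numFieldType.
Local Notation net := ('I_3 -> 'M[K]_7).
Local Notation O := (net_alg K).

(** The member of the net with coordinates [x]. *)
Definition member (A : net) (x : 'rV[K]_3) : 'M[K]_7 := \sum_k x 0 k *: A k.

(** The member with coordinates [x] has rank at most 5. *)
Definition corank2 (A : net) (x : 'rV[K]_3) : Prop := \adj (member A x) = 0.

(** The net of Hankel matrices [x * [i + j = 6] + y * [i + j = 7] + z * [i + j =
    5]]. *)
Definition hankel_net : net := fun k => \matrix_(i, j)
  ((i + j)%N == nth 0%N [:: 6; 7; 5]%N k)%:R.

Lemma hankel_net_sym : symmetric_net hankel_net.
Proof. by move=> k; apply/matrixP => i j; rewrite !mxE addnC. Qed.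

Lemma hankelE (x : 'rV[K]_3) (i j : 'I_7) : member hankel_net x i j =
  x 0 0 * ((i + j)%N == 6)%:R + x 0 1 * ((i + j)%N == 7)%:R +
  x 0 2 * ((i + j)%N == 5)%:R.
Proof.
rewrite summxE !big_ord_recl big_ord0 !mxE /= addr0 addrA.
by congr (_ + x 0 _ * _ + x 0 _ * _); apply: val_inj.
Qed.

Let lift := lifted O corank2 hankel_net.

Definition minor (A : net) (i j : 'I_7) (x : 'rV[K]_3) : K :=
  \det (row' i (col' j (member A x))).

Lemma rform_minor i j : rform O 6 (fun A x => minor A i j x).
Proof.
apply: (@rform_det _ _ _ _ 1 6) => a b.
apply: (@rform_ext _ net O _ _
    (fun A x => \sum_k A k (fintype.lift i a) (fintype.lift j b) * x 0 k)).
  apply: rform_sum => k; apply: rform_scale; last exact: rform_X.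
  exact: mreg_net.
move=> A x; rewrite !mxE summxE; apply: eq_bigr => k _.
by rewrite !mxE mulrC.
Qed.

Lemma lift_minor6 i j : lift 6 (minor hankel_net i j).
Proof.
exists (fun A x => minor A i j x); split => //; first exact: rform_minor.
move=> A x /matrixP/(_ j i); rewrite !mxE /cofactor => /eqP.
by rewrite mulf_eq0 signr_eq0 /= => /eqP.
Qed.

(** Reversing the order of the columns changes a determinant by a sign. *)
Lemma det_rev_col n : exists e : K, e != 0 /\ forall M : 'M[K]_n,
  \det M = e * \det (\matrix_(i, j) M i (rev_ord j)).
Proof.
pose s := perm (@rev_ord_inj n).
exists ((-1) ^+ odd_perm s); split; first by rewrite signr_eq0.
move=> M; rewrite -det_perm mulrC -det_mulmx; congr (\det _).
apply/matrixP => i j; rewrite mxE (bigD1 (rev_ord j)) //= !mxE permE.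
rewrite !rev_ordK eqxx mulr1 big1 ?addr0 // => k kj; rewrite !mxE permE.
case: eqP => [e|_]; last by rewrite mulr0.
by case/eqP: kj; rewrite -e rev_ordK.
Qed.

Lemma det_rev_row n : exists e : K, e != 0 /\ forall M : 'M[K]_n,
  \det M = e * \det (\matrix_(i, j) M (rev_ord i) j).
Proof.
have [e [e0 he]] := det_rev_col n; exists e; split => // M.
transitivity (e * \det (\matrix_(i, j) M (rev_ord i) j)^T); last by rewrite det_tr.
rewrite -det_tr [LHS]he; congr (e * \det _).
by apply/matrixP => i j; rewrite !mxE.
Qed.

Lemma det_ltrig n (M : 'M[K]_n) (d : K) : (forall i j : 'I_n, (i < j)%N -> M i j = 0) ->
  (forall i, M i i = d) -> \det M = d ^+ n.
Proof.
move=> h hd; rewrite det_trig; last by apply/is_trig_mxP.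
by rewrite (eq_bigr (fun=> d)) // prodr_const card_ord.
Qed.

(** The rows reversed, the minor without the first row and column is triangular. *)
Lemma lift_y : lift 6 (fun x => x 0 1 ^+ 6).
Proof.
have [e [e0 he]] := det_rev_row 6.
apply: lifted_ext (lifted_scale e^-1 (lift_minor6 0 0)) _ => x.
rewrite /minor he mulrA mulVf // mul1r; apply: det_ltrig => [i j ij|i].
  rewrite !mxE hankelE /= /bump /=.
  have := ltn_ord i; have := ltn_ord j => hj hi.
  do 3!(rewrite (_ : (_ == _) = false); last by lia).
  by rewrite !mulr0 !addr0.
rewrite !mxE hankelE /= /bump /=; have hi := ltn_ord i.
rewrite (_ : (_ == 6)%N = false); last by lia.
rewrite (_ : (_ == 7)%N = true); last by lia.
rewrite (_ : (_ == 5)%N = false); last by lia.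
by rewrite !mulr0 addr0 add0r mulr1.
Qed.

(** The columns reversed, the minor without the last row and column is
    triangular. *)
Lemma lift_z : lift 6 (fun x => x 0 2 ^+ 6).
Proof.
have [e [e0 he]] := det_rev_col 6.
apply: lifted_ext (lifted_scale e^-1 (lift_minor6 ord_max ord_max)) _ => x.
have bumpE k : (k < 6)%N -> bump 6 k = k by rewrite /bump; lia.
rewrite /minor he mulrA mulVf // mul1r; apply: det_ltrig => [i j ij|i].
  rewrite !mxE hankelE /=; have hj := ltn_ord j; have hi := ltn_ord i.
  rewrite !bumpE; try lia.
  do 3!(rewrite (_ : (_ == _) = false); last by lia).
  by rewrite !mulr0 !addr0.
rewrite !mxE hankelE /=; have hi := ltn_ord i.
rewrite !bumpE; try lia.
rewrite (_ : (_ == 6)%N = false); last by lia.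
rewrite (_ : (_ == 7)%N = false); last by lia.
rewrite (_ : (_ == 5)%N = true); last by lia.
by rewrite !mulr0 add0r add0r mulr1.
Qed.

(** The [l]-th coordinate is replaced by [0]. *)
Definition kill (n : nat) (l : 'I_n) (x : 'rV[K]_n) : 'rV[K]_n :=
  \row_j (if j == l then 0 else x 0 j).

Lemma cform_split n (l : 'I_n) d f : cform O d.+1 f ->
  exists2 r, cform O d r & forall x, f x = f (kill l x) + x 0 l * r x.
Proof.
have word (w : seq 'I_n) : (0 < size w)%N -> exists2 r, cform O (size w).-1 r &
    forall x : 'rV[K]_n,
    \prod_(i <- w) x 0 i = \prod_(i <- w) kill l x 0 i + x 0 l * r x.
  elim: w => // i w IH _.
  have [->|w0] := eqVneq w [::].
    have [->|il] := eqVneq i l.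
      exists (fun=> 1); first exact: rform_cst (freg_cst O 1).
      by move=> x; rewrite !big_seq1 mxE eqxx; ring.
    exists (fun=> 0); first exact: rform_0.
    by move=> x; rewrite !big_seq1 mxE (negbTE il); ring.
  have sw : (0 < size w)%N by rewrite lt0n size_eq0.
  have [r hr er] := IH sw.
  have [->|il] := eqVneq i l.
    exists (fun x : 'rV[K]_n => \prod_(i <- w) x 0 i); last first.
      by move=> x; rewrite !big_cons mxE eqxx mul0r add0r.
    apply: rform_deg (rform_prod w (rform_X O (n := n))) _; exact: muln1.
  exists (fun x : 'rV[K]_n => x 0 i * r x).
    by apply: cform_mul (cform_X _ i) hr _; rewrite /= add1n prednK.
  by move=> x; rewrite !big_cons er mxE (negbTE il); ring.
move=> [T [w [c [hc e]]]].
have sz k : (0 < size (w k))%N by rewrite size_tuple.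
have [r hr] := fin_all_exists2 (fun k => word (w k) (sz k)).
move=> er.
exists (fun x => \sum_k c k hankel_net * r k x).
  apply: rform_sum => k; apply: rform_scale; first exact: freg_cst.
  by have := hr k; rewrite size_tuple.
move=> x; rewrite (e hankel_net x) (e hankel_net (kill l x)) mulr_sumr -big_split.
by apply: eq_bigr => k _ /=; rewrite er; ring.
Qed.

Lemma rform_at n d (g : net -> 'rV[K]_n -> K) A : rform O d g -> cform O d (g A).
Proof.
move=> [T [w [c [hc e]]]]; exists T, w, (fun k _ => c k A); split=> [k|_ p].
  exact: freg_cst.
exact: e.
Qed.

Lemma cform_exp n d k (f : 'rV[K]_n -> K) : cform O d f ->
  cform O (k * d) (fun x => f x ^+ k).
Proof. exact: rform_exp. Qed.

(** The minor [m] without the last row and the first column is [x ^+ 6 + y * r] for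
    a form [r], so [x ^+ 36 - (y * r) ^+ 6] is a multiple of [m]. *)
Lemma lift_x : lift 36 (fun x => x 0 0 ^+ 36).
Proof.
have [e [e0 he]] := det_rev_row 6.
pose m x := e^-1 * minor hankel_net ord_max 0 x.
have hm : lift 6 m := lifted_scale e^-1 (lift_minor6 ord_max 0).
have cm : cform O 6 m.
  by apply: rform_scale (freg_cst _ _) _; apply: rform_at (rform_minor _ _).
have [r hr er] := cform_split 1 cm.
have em x : m (kill 1 x) = x 0 0 ^+ 6.
  have bumpE k : (k < 6)%N -> bump 6 k = k by rewrite /bump; lia.
  rewrite /m /minor he mulrA mulVf // mul1r; apply: det_ltrig => [i j ij|i].
    rewrite !mxE hankelE !mxE /=; have hj := ltn_ord j; have hi := ltn_ord i.
    rewrite !bumpE; try lia; rewrite [bump 0 _]/bump /=.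
    rewrite (_ : (_ == 6)%N = false); last by lia.
    rewrite (_ : (_ == 5)%N = false); last by lia.
    by rewrite !mulr0 mul0r !addr0.
  rewrite !mxE hankelE !mxE /=; have hi := ltn_ord i.
  rewrite !bumpE; try lia; rewrite [bump 0 _]/bump /=.
  rewrite (_ : (_ == 6)%N = true); last by lia.
  rewrite (_ : (_ == 5)%N = false); last by lia.
  by rewrite mulr0 mul0r !addr0 mulr1.
pose u (x : 'rV[K]_3) := x 0 0 ^+ 6; pose v (x : 'rV[K]_3) := - 1 * (x 0 1 * r x).
have cu : cform O 6 u by apply: rform_deg (cform_exp 6 (cform_X K 0)) _.
have cv : cform O 6 v.
  by apply: rform_scale (freg_cst _ _) _; apply: cform_mul (cform_X K 1) hr _.
have cS : cform O 30 (fun x => \sum_(i < 6) u x ^+ (6.-1 - i) * v x ^+ i).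
  apply: rform_sum => i; apply: cform_mul (cform_exp _ cu) (cform_exp _ cv) _.
  by have := ltn_ord i; lia.
have h1 := lifted_mul cS hm.
have h2 := lifted_mul (cform_exp 6 hr : cform O 30 _) lift_y.
apply: lifted_ext (lifted_add h1 h2) _ => x.
have mE : m x = u x - v x by rewrite er em /u /v; ring.
rewrite mE mulrC -subrXX /u /v -exprM; ring.
Qed.

Lemma generic_rank :
  generic (fun A : net => forall x, x != 0 -> \adj (member A x) != 0).
Proof.
have hl i : lift 36 (fun x => x 0 i ^+ 36).
  have pow k : lift 6 (fun x => x 0 k ^+ 6) -> lift 36 (fun x => x 0 k ^+ 36).
    move=> hk; have c30 := cform_exp 30 (cform_X K k).
    apply: lifted_ext (lifted_mul (c30 : cform O 30 _) hk) _ => x.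
    by rewrite -exprD.
  case: i => [[|[|[|i]]] hi] //.
  - rewrite (_ : Ordinal hi = 0); [exact: lift_x | exact: val_inj].
  - rewrite (_ : Ordinal hi = 1); [exact: pow lift_y | exact: val_inj].
  rewrite (_ : Ordinal hi = 2); [exact: pow lift_z | exact: val_inj].
have [E [hE E0 hs]] := elimination hl.
exists E; split => //; first by exists hankel_net; [apply: hankel_net_sym|].
move=> A _ EA x; apply: contraNneq => z; apply/eqP.
exact: hs EA z.
Qed.

End GenericRank.

(** ** Regular sequences *)

(** *** Division of forms that are monic in one variable *)

Section ElimDivision.
Variable K : numClosedFieldType.
Local Notation S := {mpoly K[7]}.
Local Notation TT := {poly {poly S}}.

(** The variables [x_1] and [x_2] become the outer and the inner variable of
    polynomials over [S]. *)
Definition expand : S -> TT := mmap (@polyC _ \o @polyC _ \o @mpolyC 7 K)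
  (fun j : 'I_7 => if j == 1 then 'X else if j == 2 then 'X%:P else ('X_j)%:P%:P).
HB.instance Definition _ := GRing.RMorphism.on expand.

(** The inverse substitution. *)
Definition contract : TT -> S :=
  horner_eval ('X_2 : S) \o horner_eval (('X_1)%:P : {poly S}).
HB.instance Definition _ := GRing.RMorphism.on contract.

Lemma expandK : cancel expand contract.
Proof.
apply: (@rmorph_mpoly_eq K 7 S (contract \o expand) idfun) => [k|i] /=.
  by rewrite /expand mmapC /contract /= /horner_eval !hornerC.
rewrite /expand mmapXU /contract /= /horner_eval.
case: eqP => [->|_]; first by rewrite hornerX hornerC.
by case: eqP => [->|_]; rewrite hornerC ?hornerX ?hornerC.
Qed.

(** The points whose only nonzero coordinates are [x_1], or [x_1] and [x_2]. *)
Definition pt1 : 'rV[K]_7 := delta_mx 0 1.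
Definition pt12 (x y : K) : 'rV[K]_7 := x *: delta_mx 0 1 + y *: delta_mx 0 2.

Lemma expand_monomial m : exists2 c : {poly S},
  expand 'X_[m] = c%:P * 'X^(m 1) & (mdeg m = m 1 -> c = 1).
Proof.
rewrite /expand mmapX /mmap1 (bigD1 1) //= mulrC.
pose F (j : 'I_7) : {poly S} := if j == 2 then 'X else ('X_j)%:P.
exists (\prod_(j | j != 1) F j ^+ m j).
  congr (_ * _); rewrite rmorph_prod; apply: eq_bigr => j /negbTE ->.
  by rewrite rmorphXn /F /=; case: ifP.
rewrite mdegE (bigD1 1) //= => /eqP; rewrite -[X in _ == X]addn0 eqn_add2l.
rewrite sum_nat_eq0 => /forallP h; apply: big1 => j j1.
by have := h j; rewrite j1 /= => /eqP ->; rewrite expr0.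
Qed.

Lemma expand_homog d f : f \is d.-homog ->
  (size (expand f) <= d.+1)%N /\ (expand f)`_d = (peval f pt1)%:MP%:P.
Proof.
move=> hf.
have term m : mdeg m = d -> (size (expand 'X_[m]) <= d.+1)%N /\
    (expand 'X_[m])`_d = (peval 'X_[m] pt1)%:MP%:P.
  move=> dm; have [c -> hc] := expand_monomial m.
  have m1d : (m 1%R <= d)%N by rewrite -dm mdegE (bigD1 1) //= leq_addr.
  split.
    rewrite (leq_trans (size_polyMleq _ _)) // size_polyXn size_polyC.
    by case: (c != 0) => /=; lia.
  rewrite coefCM coefXn /peval mevalX.
  have [e|ne] := eqVneq d (m 1).
    rewrite hc ?dm // mul1r (bigD1 1) //= mxE !eqxx expr1n mul1r big1 //.
    move=> j j1; rewrite (_ : m j = 0%N) ?expr0 //.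
    move: dm; rewrite mdegE (bigD1 1) //= e => /eqP.
    rewrite -[X in _ == X]addn0 eqn_add2l sum_nat_eq0 => /forallP/(_ j).
    by rewrite j1 => /eqP.
  rewrite mulr0.
  have /existsP[j /andP[j1 mj]] : [exists j, (j != 1) && (m j != 0%N)].
    apply: contraR ne; rewrite negb_exists => /forallP h.
    rewrite -dm mdegE (bigD1 1) //= big1 ?addn0 // => j j1.
    by have := h j; rewrite j1 negbK => /eqP.
  rewrite (bigD1 j) //= mxE eqxx (negbTE j1) expr0n (negbTE mj) mul0r.
  by rewrite mpolyC0.
have hz k g : expand (k *: g) = (k%:MP%:P%:P) * expand g.
  by rewrite -mul_mpolyC rmorphM /= {1}/expand mmapC.
have main (r : seq 'X_{1..7}) : (forall m, m \in r -> mdeg m = d) ->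
    let g := \sum_(m <- r) f@_m *: 'X_[m] in
    (size (expand g) <= d.+1)%N /\ (expand g)`_d = (peval g pt1)%:MP%:P.
  elim: r => [|m r IH] hr /=.
    by rewrite big_nil rmorph0 size_poly0 coef0 peval0 mpolyC0.
  have [|h1 h2] := IH; first by move=> k kr; apply: hr; rewrite inE kr orbT.
  have [h3 h4] := term m (hr m (mem_head _ _)).
  rewrite big_cons rmorphD /= hz; split.
    rewrite (leq_trans (size_polyD _ _)) // geq_max h1 andbT mul_polyC.
    by rewrite (leq_trans (size_scale_leq _ _)).
  rewrite coefD h2 coefCM h4 pevalD pevalZ.
  by rewrite -rmorphM -rmorphD /= -mpolyCM -mpolyCD.
rewrite (mpolyE f); by apply: main => m mf; rewrite (dhomog_mf hf mf).
Qed.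

(** The inner variable is replaced by [1] and the variables of [S] by [0]. *)
Definition spec : {poly S} -> K :=
  meval (fun=> 0) \o horner_eval (1 : S).
HB.instance Definition _ := GRing.RMorphism.on spec.

Lemma specC (f : S) : spec f%:P = f.@[fun=> 0].
Proof. by rewrite /spec /= /horner_eval hornerC. Qed.

Lemma specX : spec 'X = 1.
Proof. by rewrite /spec /= /horner_eval hornerX meval1. Qed.

Lemma spec_expand f t :
  (map_poly spec (expand f)).[t] = peval f (pt12 t 1).
Proof.
pose g : {rmorphism S -> K} := horner_eval t \o map_poly spec \o expand.
pose g' : {rmorphism S -> K} := meval (fun i => pt12 t 1 0 i).
apply: (@rmorph_mpoly_eq K 7 K g g') => [k|i].
  rewrite /g /g' /= mevalC /expand mmapC /= map_polyC /horner_eval hornerC.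
  by rewrite /= specC mevalC.
rewrite /g /g' /= mevalXU /expand mmapXU /pt12 !mxE /=.
have [->|i1] := eqVneq i 1.
  by rewrite map_polyX /horner_eval hornerX /= mulr1 mulr0 addr0.
have [_|i2] := eqVneq i 2.
  by rewrite map_polyC /horner_eval hornerC /= specX mulr0 mulr1 add0r.
rewrite map_polyC /horner_eval hornerC /= specC mevalXU.
by rewrite !mulr0 addr0.
Qed.

Lemma bezout_remainder (R : comNzRingType) (c n1 n2 e k M u v rho D r : R) :
  c * n2 = n1 * e -> n1 = k * M -> rho = u * n1 + v * n2 -> c = D * M + r ->
  exists w, rho * r = w * M.
Proof.
move=> ec ek erho er; exists (k * (u * c + v * e) - rho * D).
have -> : r = c - D * M by rewrite er; ring.
transitivity (u * n1 * c + v * (c * n2) - rho * (D * M)).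
  by rewrite erho; ring.
by rewrite ec ek; ring.
Qed.

Lemma small_remainder (R : idomainType) (rho : R) (r w M : {poly R}) :
  rho != 0 -> M \is monic -> (size r < size M)%N -> rho%:P * r = w * M -> r = 0.
Proof.
move=> rho0 mM sr ew; apply/eqP; apply: contraTT sr => r0.
have w0 : w != 0.
  apply: contraNneq r0 => w0; move/eqP: ew.
  by rewrite w0 mul0r mulf_eq0 polyC_eq0 (negbTE rho0).
have := congr1 (fun p : {poly R} => size p) ew.
rewrite mul_polyC size_scale // size_Mmonic // => ->.
by move: w0; rewrite -size_poly_gt0 -leqNgt; lia.
Qed.

(** If two forms of degree [d] contain the power [x_1 ^+ d] and have no common zero
    on the line where only [x_1] and [x_2] survive, then the second one is not a
    zero divisor modulo the first one: their resultant with respect to [x_1] is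
    nonzero already on this line. *)
Lemma coprime_forms d (N1 N2 c : S) : (0 < d)%N ->
  N1 \is d.-homog -> N2 \is d.-homog ->
  peval N1 pt1 != 0 -> peval N2 pt1 != 0 ->
  (forall t, peval N1 (pt12 t 1) = 0 -> peval N2 (pt12 t 1) = 0 -> False) ->
  (exists e, c * N2 = N1 * e) -> exists e, c = N1 * e.
Proof.
move=> d0 h1 h2 n1 n2 hcop [e0 ee].
have lc N : N \is d.-homog -> peval N pt1 != 0 -> size (expand N) = d.+1 /\
    lead_coef (expand N) = (peval N pt1)%:MP%:P.
  move=> hN nN; have [sN cN] := expand_homog hN.
  have e : size (expand N) = d.+1.
    apply/eqP; rewrite eqn_leq sN ltnNge; apply: contra nN => le.
    by move/eqP: cN; rewrite nth_default // eq_sym polyC_eq0 mpolyC_eq0.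
  by rewrite lead_coefE e.
have [s1 l1] := lc N1 h1 n1; have [s2 l2] := lc N2 h2 n2.
have spC k : spec k%:MP%:P = k by rewrite specC mevalC.
have k0 : (peval N1 pt1)%:MP%:P != 0 :> {poly S}.
  by rewrite polyC_eq0 mpolyC_eq0.
have kK : (peval N1 pt1)%:MP%:P * ((peval N1 pt1)^-1)%:MP%:P = 1 :> {poly S}.
  by rewrite -polyCM -mpolyCM divff // mpolyC1.
have [M mM NM] : exists2 M, M \is monic &
    expand N1 = (peval N1 pt1)%:MP%:P *: M.
  exists (((peval N1 pt1)^-1)%:MP%:P *: expand N1); last first.
    by rewrite scalerA kK scale1r.
  by rewrite monicE lead_coefZ l1 mulrC kK.
have sM : size M = d.+1 by rewrite -s1 NM size_scale.
pose rho := resultant (expand N1) (expand N2).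
have rho0 : rho != 0.
  suff : spec rho != 0 by apply: contraNneq => ->; rewrite rmorph0.
  have -> : spec rho =
      resultant (map_poly spec (expand N1)) (map_poly spec (expand N2)).
    by apply: (@map_resultant _ _ spec); [rewrite l1 /= spC | rewrite l2 /= spC].
  rewrite resultant_eq0 -leqNgt.
  set g := gcdp _ _.
  have [//|gs] := leqP (size g) 1.
  have /closed_rootP[t gt] : size g != 1%N by rewrite neq_ltn gs orbT.
  exfalso; move: gt; rewrite root_gcd => /andP[/rootP r1 /rootP r2].
  have e1 : peval N1 (pt12 t 1) = 0 := etrans (esym (spec_expand N1 t)) r1.
  have e2 : peval N2 (pt12 t 1) = 0 := etrans (esym (spec_expand N2 t)) r2.
  exact: (hcop t e1 e2).
have [[u v] /= _ euv] := resultant_in_ideal (p := expand N1) (q := expand N2)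
  (ltac:(by rewrite s1 ltnS)) (ltac:(by rewrite s2 ltnS)).
pose r := Pdiv.Ring.rmodp (expand c) M; pose D := Pdiv.Ring.rdivp (expand c) M.
have er : expand c = D * M + r by apply: Pdiv.RingMonic.rdivp_eq.
suff r0 : r = 0.
  exists (contract (((peval N1 pt1)^-1)%:MP%:P *: D)).
  rewrite -[LHS]expandK -{1}(expandK N1) -rmorphM er r0 addr0; congr contract.
  by rewrite NM -scalerAl -scalerAr scalerA kK scale1r mulrC.
(* [rho * r] is a multiple of the monic polynomial [M] of larger degree. *)
have sr : (size r < size M)%N by rewrite Pdiv.Ring.ltn_rmodpN0 ?monic_neq0.
have ec : expand c * expand N2 = expand N1 * expand e0.
  exact: etrans (esym (rmorphM expand c N2))
    (etrans (congr1 expand ee) (rmorphM expand N1 e0)).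
have NM' : expand N1 = (peval N1 pt1)%:MP%:P%:P * M by rewrite mul_polyC.
have [w ew] : exists w, rho%:P * r = w * M.
  exact: bezout_remainder ec NM' euv er.
exact: small_remainder rho0 mM sr ew.
Qed.

End ElimDivision.

Section Bilinear.
Variables (K : fieldType) (R : comNzRingType) (phi : {rmorphism K -> R}) (n : nat).
Implicit Types (B : 'M[K]_n) (x y : 'I_n -> R).

(** The bilinear form of [B] over a [K]-algebra. *)
Definition bil B x y : R := \sum_i \sum_j phi (B i j) * (x i * y j).

Lemma bil_sym B x y : symmetric_mx B -> bil B x y = bil B y x.
Proof.
move=> sB; rewrite /bil exchange_big; apply: eq_bigr => i _; apply: eq_bigr => j _.
by rewrite -[in LHS]sB mxE [y i * _]mulrC.
Qed.

Lemma bilDl B x x' y : bil B (fun i => x i + x' i) y = bil B x y + bil B x' y.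
Proof.
rewrite /bil -big_split; apply: eq_bigr => i _; rewrite -big_split.
by apply: eq_bigr => j _ /=; rewrite mulrDl mulrDr.
Qed.

Lemma bilDr B x y y' : bil B x (fun i => y i + y' i) = bil B x y + bil B x y'.
Proof.
rewrite /bil -big_split; apply: eq_bigr => i _; rewrite -big_split.
by apply: eq_bigr => j _ /=; rewrite !mulrDr.
Qed.

Lemma bilZl c B x y : bil B (fun i => c * x i) y = c * bil B x y.
Proof.
rewrite /bil mulr_sumr; apply: eq_bigr => i _; rewrite mulr_sumr.
by apply: eq_bigr => j _; ring.
Qed.

Lemma bilZr c B x y : bil B x (fun i => c * y i) = c * bil B x y.
Proof.
rewrite /bil mulr_sumr; apply: eq_bigr => i _; rewrite mulr_sumr.
by apply: eq_bigr => j _; ring.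
Qed.

Lemma bil_ext B x x' y y' : x =1 x' -> y =1 y' -> bil B x y = bil B x' y'.
Proof.
by move=> ex ey; apply: eq_bigr => i _; apply: eq_bigr => j _; rewrite ex ey.
Qed.

(** The [k]-th unit vector. *)
Definition unitv (k i : 'I_n) : R := (i == k)%:R.

Lemma bil_unit B k l : bil B (unitv k) (unitv l) = phi (B k l).
Proof.
rewrite /bil (bigD1 k) //= (bigD1 l) //= /unitv !eqxx !mulr1.
rewrite [X in _ + X + _]big1 => [|j /negbTE jl]; last by rewrite jl !mulr0.
rewrite addr0 big1 ?addr0 // => i /negbTE ik.
by apply: big1 => j _; rewrite ik mul0r mulr0.
Qed.

(** The square of [c * e_k + x], for a symmetric form. *)
Lemma bil_split B k c x : symmetric_mx B ->
  bil B (fun i => c * unitv k i + x i) (fun i => c * unitv k i + x i) =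
  phi (B k k) * c ^+ 2 + 2%:R * c * bil B (unitv k) x + bil B x x.
Proof.
move=> sB; rewrite bilDl !bilDr !bilZl !bilZr bil_unit.
by rewrite [bil B x (unitv k)]bil_sym //; ring.
Qed.

End Bilinear.

Lemma bil_rmorph (K : fieldType) (R R' : comNzRingType)
    (phi : {rmorphism K -> R}) (f : {rmorphism R -> R'}) n (B : 'M[K]_n) x y :
  f (bil phi B x y) = bil (f \o phi) B (f \o x) (f \o y).
Proof.
rewrite /bil rmorph_sum; apply: eq_bigr => i _; rewrite rmorph_sum.
by apply: eq_bigr => j _; rewrite !rmorphM.
Qed.

Lemma qform_bil (K : fieldType) n (B : 'M[K]_n) :
  qform B = bil (@mpolyC n K) B (fun i => 'X_i) (fun i => 'X_i).
Proof. by apply: eq_bigr => i _; apply: eq_bigr => j _; rewrite mul_mpolyC. Qed.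

(** *** Reduction modulo a quadric *)

Section Regularity.
Variable K : numClosedFieldType.
Local Notation S := {mpoly K[7]}.
Local Notation bilS := (bil (@mpolyC 7 K)).
Implicit Types (A B : 'M[K]_7).

(** The form of [A] is [a * x_0 ^+ 2 + 2 * lin0 A * x_0 + quad0 A] with [a = A 0 0],
    where [lin0 A] and [quad0 A] do not involve [x_0]; modulo this form, [a * x_0 +
    lin0 A] is a square root of [disc0 A]. Modulo it, the form of [B] multiplied by
    [a ^+ 2] becomes [norm_P A B + norm_Q A B * sqrt (disc0 A)]. *)
Definition tailv (i : 'I_7) : S := if i == 0 then 0 else 'X_i.
Definition lin0 B : S := bilS B (unitv S 0) tailv.
Definition quad0 B : S := bilS B tailv tailv.
Definition disc0 A : S := lin0 A ^+ 2 - (A 0 0)%:MP * quad0 A.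
Definition norm_P A B : S := (B 0 0)%:MP * (lin0 A ^+ 2 + disc0 A) -
  2%:R * (A 0 0)%:MP * lin0 A * lin0 B + (A 0 0)%:MP ^+ 2 * quad0 B.
Definition norm_Q A B : S :=
  2%:R * ((A 0 0)%:MP * lin0 B - (B 0 0)%:MP * lin0 A).

(** The norm of this element: a form in the variables other than [x_0]. *)
Definition norm0 A B : S := norm_P A B ^+ 2 - disc0 A * norm_Q A B ^+ 2.

Section Reduction.
Variable A : 'M[K]_7.
Hypothesis sA : symmetric_mx A.
Hypothesis a0 : A 0 0 != 0.
Local Notation D := (disc0 A).
Local Notation a := (A 0 0).

(** The value of [x_0]. *)
Definition root0 : quad D :=
  qconst D (a^-1)%:MP * (qroot D - qconst D (lin0 A)).

(** Reduction modulo the form of [A], with values in [S[sqrt D]]. *)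
Definition red0 : S -> quad D := mmap (@qconst S D \o @mpolyC 7 K)
  (fun i => if i == 0 then root0 else qconst D 'X_i).
HB.instance Definition _ := GRing.RMorphism.on red0.

(** The converse substitution, multiplicative modulo the form of [A]. *)
Definition lift0 (x : quad D) : S := x.1 + x.2 * (a%:MP * 'X_0 + lin0 A).

Lemma red0_qform B : symmetric_mx B ->
  qconst D (a%:MP ^+ 2) * red0 (qform B) = qpair D (norm_P A B) (norm_Q A B).
Proof.
move=> sB.
have e1 : red0 (qform B) = qconst D (B 0 0)%:MP * root0 ^+ 2 +
    2%:R * root0 * qconst D (lin0 B) + qconst D (quad0 B).
  rewrite qform_bil (bil_rmorph (@mpolyC 7 K) red0) /lin0 /quad0.
  rewrite !(bil_rmorph (@mpolyC 7 K) (@qconst S D)).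
  transitivity (bil (@qconst S D \o @mpolyC 7 K) B
    (fun i => root0 * unitv (quad D) 0 i + (@qconst S D \o tailv) i)
    (fun i => root0 * unitv (quad D) 0 i + (@qconst S D \o tailv) i)).
    have hx i : red0 'X_i = root0 * unitv (quad D) 0 i + (@qconst S D \o tailv) i.
      rewrite /red0 mmapXU /unitv /tailv /=; case: eqP => _.
        by rewrite mulr1 rmorph0 addr0.
      by rewrite mulr0 add0r.
    apply: eq_bigr => i _; apply: eq_bigr => j _; rewrite [LHS]/= !hx.
    by congr (_ * _); rewrite /red0 mmapC.
  have eu : bil (@qconst S D \o @mpolyC 7 K) B (unitv (quad D) 0) (@qconst S D \o tailv)
      = bil (@qconst S D \o @mpolyC 7 K) B (@qconst S D \o unitv S 0)
          (@qconst S D \o tailv).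
    apply: bil_ext => // i; rewrite /unitv /=.
    by case: eqP => _; rewrite ?rmorph1 ?rmorph0.
  have := @bil_split _ _ (@qconst S D \o @mpolyC 7 K) _ B 0 root0
    (@qconst S D \o tailv) sB.
  by rewrite eu.
have e2 : qconst D a%:MP * root0 = qroot D - qconst D (lin0 A).
  by rewrite /root0 mulrA -rmorphM -mpolyCM divff // mpolyC1 rmorph1 mul1r.
have e3 : qroot D ^+ 2 = qconst D D by rewrite expr2 qroot_sqr.
rewrite e1; transitivity (qconst D (B 0 0)%:MP * (qconst D a%:MP * root0) ^+ 2 +
   2%:R * qconst D a%:MP * (qconst D a%:MP * root0) * qconst D (lin0 B) +
   qconst D a%:MP ^+ 2 * qconst D (quad0 B)).
  by rewrite rmorphXn /=; move: (qconst D a%:MP) root0 => u v; ring.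
rewrite e2; apply: qpairP; rewrite !(expr2, quadE) /= /norm_P /norm_Q.
  by ring.
by ring.
Qed.


Lemma red0_self : red0 (qform A) = 0.
Proof.
have a20 : a%:MP ^+ 2 != 0 :> S by rewrite expf_neq0 // mpolyC_eq0.
apply: (qconst_reg a20); rewrite red0_qform //; apply: qpairP => /=.
  by rewrite /norm_P /disc0; ring.
by rewrite /norm_Q subrr mulr0.
Qed.

Lemma qform_lift0 : (a%:MP * 'X_0 + lin0 A) ^+ 2 = D + a%:MP * qform A.
Proof.
have -> : qform A = a%:MP * 'X_0 ^+ 2 + 2%:R * 'X_0 * lin0 A + quad0 A.
  have := @bil_split _ _ (@mpolyC 7 K) _ A 0 'X_0 tailv sA.
  rewrite -/(lin0 A) -/(quad0 A) => <-; rewrite qform_bil.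
  have hx i : 'X_i = 'X_0 * unitv S 0 i + tailv i.
    by rewrite /unitv /tailv; case: eqP => [->|_]; rewrite ?mulr1 ?addr0 ?mulr0 ?add0r.
  exact: bil_ext.
by rewrite /disc0; move: (lin0 A) (quad0 A) => u v; ring.
Qed.

Lemma lift0M x y : exists c, lift0 (x * y) = lift0 x * lift0 y + c * qform A.
Proof.
exists (- (x.2 * y.2 * a%:MP)); rewrite /lift0 !quadE.
have e := qform_lift0; move: (a%:MP * 'X_0 + lin0 A) e => u e.
have -> : D = u ^+ 2 - a%:MP * qform A by rewrite e addrK.
by move: (qform A) => q; ring.
Qed.

Lemma lift0_red0 f : exists c, lift0 (red0 f) = f + c * qform A.
Proof.
move: f; apply: mpoly_alg_ind => [k|i|f g [c e] [c' e']|f g [c e] [c' e']].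
- by exists 0; rewrite /red0 mmapC /lift0 /=; ring.
- rewrite /red0 mmapXU; case: eqP => [->|_]; last first.
    by exists 0; rewrite /lift0 /=; ring.
  exists 0; rewrite /lift0 /root0 !quadE /=.
  have e : (a^-1)%:MP * a%:MP = 1 :> S by rewrite -mpolyCM mulVf.
  transitivity ((a^-1)%:MP * a%:MP * 'X_0 : S); last by rewrite e mul1r mul0r addr0.
  by move: (lin0 A) (disc0 A) => u v; ring.
- exists (c + c'); rewrite [red0 _]rmorphD /=.
  move: (red0 f) (red0 g) e e' => x y e e'.
  have -> : lift0 (x + y) = lift0 x + lift0 y by rewrite /lift0 !quadE; ring.
  by rewrite e e' mulrDl addrACA.
rewrite [red0 _]rmorphM /=; move: (red0 f) (red0 g) e e' => x y e e'.
have [d ed] := lift0M x y.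
exists (f * c' + c * g + c * c' * qform A + d).
by rewrite ed e e'; ring.
Qed.

Lemma red0_ker f : red0 f = 0 -> exists c, f = c * qform A.
Proof.
move=> e; have [c] := lift0_red0 f; rewrite e /lift0 !quadE mul0r addr0 => h.
by exists (- c); apply/eqP; rewrite mulNr -addr_eq0 -h.
Qed.

Lemma red0_dvd f g y : red0 f = red0 g * y -> exists c d, f = c * qform A + d * g.
Proof.
move=> e; have [c1 e1] := lift0_red0 f; have [c2 e2] := lift0_red0 g.
have [c3 e3] := lift0M (red0 g) y.
exists (c2 * lift0 y + c3 - c1), (lift0 y).
have -> : f = lift0 (red0 f) - c1 * qform A by rewrite e1 addrK.
by rewrite e e3 e2; move: (qform A) (lift0 y) => q z; ring.
Qed.

End Reduction.

Lemma tailv_homog i : tailv i \is 1.-homog.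
Proof. by rewrite /tailv; case: eqP => _; rewrite ?dhomog0 ?dhomogX //= mdeg1. Qed.

Lemma lin0_homog B : lin0 B \is 1.-homog.
Proof.
apply: rpred_sum => i _; apply: rpred_sum => j _; rewrite /unitv.
case: eqP => _; last by rewrite mul0r mulr0 dhomog0.
by rewrite mul1r; apply: homogMe (homogC _ _) (tailv_homog _) _.
Qed.

Lemma quad0_homog B : quad0 B \is 2.-homog.
Proof.
apply: rpred_sum => i _; apply: rpred_sum => j _.
exact: homogMe (homogC _ _) (homogMe (tailv_homog _) (tailv_homog _) (erefl _)) _.
Qed.

Lemma norm0_homog A B : norm0 A B \is 4.-homog.
Proof.
have hC k d e (f : S) : f \is d.-homog -> d = e -> k%:MP * f \is e.-homog.
  by move=> hf <-; apply: homogMe (homogC _ _) hf _.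
have l2 C E : lin0 C * lin0 E \is 2.-homog.
  exact: homogMe (lin0_homog _) (lin0_homog _) _.
have hD : disc0 A \is 2.-homog.
  by rewrite /disc0 expr2; apply: rpredB (l2 _ _) (hC _ _ _ _ (quad0_homog _) _).
have hP : norm_P A B \is 2.-homog.
  rewrite /norm_P -mpolyC_nat -mpolyCM expr2 -(rmorphXn (@mpolyC 7 K)).
  apply: rpredD (hC _ _ _ _ (quad0_homog _) _) => //; apply: rpredB.
    by apply: (hC) (erefl _); apply: rpredD.
  by rewrite -mulrA; apply: (hC) (l2 _ _) _.
have hQ : norm_Q A B \is 1.-homog.
  rewrite /norm_Q -mpolyC_nat; apply: (hC) (erefl _).
  by apply: rpredB; apply: (hC) (lin0_homog _) _.
rewrite /norm0; apply: rpredB; first by apply: homogXn hP _.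
by apply: homogMe hD (homogXn hQ (erefl _)) _.
Qed.

(** The reduction modulo the form of [A] is possible, and the norm of the form of
    [B] contains a power of [x_1]. *)
Definition good_pair A B : Prop :=
  A 0 0 != 0 /\ peval (norm0 A B) (pt1 K) != 0.
(** The norms have no common zero on the line of [x_1], [x_2]. *)
Definition no_common A B C : Prop := forall t,
  peval (norm0 A B) (pt12 t 1) = 0 -> peval (norm0 A C) (pt12 t 1) = 0 -> False.

Lemma mulrCA_congr (T : comPzRingType) (a b c d q : T) :
  a * c = b * d -> a * (q * c) = b * (q * d).
Proof. by move=> e; rewrite mulrCA e mulrCA. Qed.

Lemma mulrAC_swap (T : comPzRingType) (a b c : T) : a * b * c = b * (a * c).
Proof. by ring. Qed.

(** If the norm of [c] is a nonzerodivisor modulo the norm of [b], then [c] is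
    a nonzerodivisor modulo [b]. *)
Lemma quad_divide (R : idomainType) (h : R) (b c x y : quad h) :
  x * c = y * b -> qnorm b != 0 ->
  (forall u, (exists v, u * qnorm c = qnorm b * v) -> exists v, u = qnorm b * v) ->
  exists v, x = b * v.
Proof.
move=> e1 nb dvd; pose b' := qconj b; pose c' := qconj c.
have e2 : (x * b') * qconst _ (qnorm c) = (y * c') * qconst _ (qnorm b).
  rewrite -!mul_qconj -/b' -/c'.
  transitivity (x * c * (b' * c')); first by ring.
  by rewrite e1; ring.
have [v1 ev1] : exists v, (x * b').1 = qnorm b * v.
  apply: dvd; exists (y * c').1.
  have := congr1 fst e2; rewrite ![_ * qconst _ _]mulrC !qconstM /= => <-.
  by rewrite mulrC.
have [v2 ev2] : exists v, (x * b').2 = qnorm b * v.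
  apply: dvd; exists (y * c').2.
  have := congr1 snd e2; rewrite ![_ * qconst _ _]mulrC !qconstM /= => <-.
  by rewrite mulrC.
pose v := qpair h v1 v2.
have ev : x * b' = b * b' * v by rewrite mul_qconj qconstM; apply: qpairP.
have nb' : qnorm b' != 0 by rewrite /qnorm /b' /= sqrrN.
exists v; apply/eqP; rewrite -subr_eq0; apply/eqP; apply: (qnorm_reg nb').
by rewrite mulrBr [b' * x]mulrC ev; ring.
Qed.

(** Modulo the form of [A], the form of [B] is not a zero divisor because its norm
    is nonzero, and the form of [C] is not one modulo [B] because their norms are
    coprime ([coprime_forms], [quad_divide]). *)
Lemma regular_of_norms A B C : symmetric_mx A -> symmetric_mx B -> symmetric_mx C ->
  good_pair A B -> good_pair A C -> no_common A B C ->
  regular_seq [:: qform A; qform B; qform C].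
Proof.
move=> sA sB sC [a0 nB] [_ nC] hc.
have nz f (p : 'rV[K]_7) : peval f p != 0 -> f != 0.
  by apply: contraNneq => ->; rewrite peval0.
have nB0 := nz _ _ nB; have nC0 := nz _ _ nC.
have q0 : qform A != 0.
  apply: (nz _ (delta_mx 0 0)); rewrite peval_qform -rowE mxE.
  rewrite (bigD1 0) //= !mxE !eqxx mulr1 big1 ?addr0 // => j /negbTE j0.
  by rewrite !mxE j0 mulr0.
have a20 : (A 0 0)%:MP ^+ 2 != 0 :> S by rewrite expf_neq0 // mpolyC_eq0.
pose k B := qpair (disc0 A) (norm_P A B) (norm_Q A B).
split.
  case=> d; have e0 i : peval ([:: qform A; qform B; qform C]`_i) 0 = 0.
    by case: i => [|[|[|i]]] /=; rewrite ?peval_qform ?mul0mx ?mxE // nth_nil peval0.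
  move/(congr1 (fun f => peval f 0)); rewrite peval_sum big1 => [|i _].
    by rewrite /peval meval1 => /eqP; rewrite oner_eq0.
  by rewrite pevalM e0 mulr0.
move=> [|[|[|i]]] // _ f /=.
- case=> d; rewrite big_ord0 => /eqP; rewrite mulf_eq0 (negbTE q0) orbF => /eqP ->.
  by exists d; rewrite big_ord0.
- case=> d; rewrite big_ord1 /= => e.
  have e1 : k B * red0 A f = 0.
    rewrite /k -(red0_qform a0 sB) -mulrA -[red0 A (qform B) * _]rmorphM /=.
    rewrite [qform B * f]mulrC e.
    by rewrite [red0 A (d 0%N * _)]rmorphM /= (red0_self sA a0) !mulr0.
  have nk : qnorm (k B) != 0 by exact: nB0.
  have [c ec] := red0_ker sA a0 (qnorm_reg nk e1).
  by exists (fun=> c); rewrite big_ord1 /=.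
case=> d; rewrite !big_ord_recl big_ord0 addr0 /= => e.
set d0 := d _ in e; set d1 := d _ in e.
have e1 : red0 A f * k C = red0 A d1 * k B.
  have e3 : red0 A f * red0 A (qform C) = red0 A d1 * red0 A (qform B).
    have m u v : red0 A (u * v) = red0 A u * red0 A v by exact: rmorphM.
    have p u v : red0 A (u + v) = red0 A u + red0 A v by exact: rmorphD.
    have z : red0 A (d0 * qform A) = 0 by rewrite (m d0 (qform A)) (red0_self sA a0) mulr0.
    apply: (etrans (esym (m f (qform C)))); apply: (etrans (congr1 (red0 A) e)).
    apply: (etrans (p _ _)); apply: (etrans (congr1 (fun u => u + _) z)).
    by apply: (etrans (add0r _)); apply: m.
  have hB := red0_qform a0 sB; have hC := red0_qform a0 sC.
  apply: (etrans (congr1 (fun u => red0 A f * u) (esym hC))).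
  apply: (etrans _ (congr1 (fun u => red0 A d1 * u) hB)).
  exact: mulrCA_congr e3.
have [v ef] : exists v, red0 A f = k B * v.
  apply: (quad_divide e1); first exact: nB0.
  move=> u; exact: coprime_forms (norm0_homog _ _) (norm0_homog _ _) nB nC hc.
have [|c1 [c2 ec]] := @red0_dvd A sA a0 f (qform B) (qconst _ ((A 0 0)%:MP ^+ 2) * v).
  have hB := red0_qform a0 sB.
  apply: (etrans ef); apply: (etrans (congr1 (fun u => u * v) (esym hB))).
  exact: mulrAC_swap.
exists (fun i => if i == 0%N then c1 else c2).
by rewrite !big_ord_recl big_ord0 addr0 /=.
Qed.

End Regularity.

(** The expression of [norm0] in terms of the coefficients of two forms. *)
Definition norm_expr (T : comPzRingType) (a b l m q r : T) : T :=
  (b * (l ^+ 2 + (l ^+ 2 - a * q)) - 2%:R * a * l * m + a ^+ 2 * r) ^+ 2 -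
  (l ^+ 2 - a * q) * (2%:R * (a * m - b * l)) ^+ 2.

Lemma rmorph_norm_expr (T T' : comPzRingType) (f : {rmorphism T -> T'})
    (a b l m q r : T) :
  f (norm_expr a b l m q r) = norm_expr (f a) (f b) (f l) (f m) (f q) (f r).
Proof.
by rewrite /norm_expr !(rmorph_nat, rmorphB, rmorphD, rmorphM, rmorphXn).
Qed.

(** *** Regularity of the general net *)

Section GenericRegular.
Variable K : numClosedFieldType.
Local Notation net := ('I_3 -> 'M[K]_7).
Local Notation O := (net_alg K).
Implicit Types (x : 'rV[K]_7).

(** The values of [lin0], [quad0], [disc0] and [norm0] at points with [x_0 = 0]. *)
Definition lin_at (A : 'M[K]_7) x : K := \sum_j A 0 j * x 0 j.
Definition quad_at (A : 'M[K]_7) x : K := \sum_i \sum_j A i j * (x 0 i * x 0 j).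
Definition disc_at (A : 'M[K]_7) x : K := lin_at A x ^+ 2 - A 0 0 * quad_at A x.
Definition norm_at (A B : 'M[K]_7) x : K :=
  (B 0 0 * (lin_at A x ^+ 2 + disc_at A x) -
    2%:R * A 0 0 * lin_at A x * lin_at B x + A 0 0 ^+ 2 * quad_at B x) ^+ 2 -
  disc_at A x * (2%:R * (A 0 0 * lin_at B x - B 0 0 * lin_at A x)) ^+ 2.

(** The line of the coordinates [x_1], [x_2]. *)
Definition line12 (p : 'rV[K]_2) : 'rV[K]_7 := pt12 (p 0 0) (p 0 1).

Lemma peval_norm0 (A B : 'M[K]_7) x : x 0 0 = 0 -> peval (norm0 A B) x = norm_at A B x.
Proof.
move=> x0; pose ev : {rmorphism {mpoly K[7]} -> K} := meval (fun i => x 0 i).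
have hC k : ev k%:MP = k by exact: mevalC.
have ht j : ev (tailv K j) = x 0 j.
  rewrite /ev /tailv; case: eqP => [->|_]; last exact: mevalXU.
  by rewrite x0; exact: meval0.
have hl B' : ev (lin0 B') = lin_at B' x.
  rewrite /lin0 (bil_rmorph (@mpolyC 7 K) ev) /bil (bigD1 0) //=.
  rewrite [X in _ + X]big1 ?addr0 => [|i /negbTE i0].
    apply: eq_bigr => j _; rewrite /= ht hC /unitv eqxx.
    by rewrite (rmorph1 ev) mul1r.
  apply: big1 => j _; rewrite /= /unitv i0 (rmorph0 ev).
  by rewrite mul0r mulr0.
have hq B' : ev (quad0 B') = quad_at B' x.
  rewrite /quad0 (bil_rmorph (@mpolyC 7 K) ev).
  by apply: eq_bigr => i _; apply: eq_bigr => j _; rewrite /= !ht hC.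
rewrite -[LHS]/(ev (norm0 A B)).
have -> : norm0 A B = norm_expr (A 0 0)%:MP (B 0 0)%:MP (lin0 A) (lin0 B)
    (quad0 A) (quad0 B) by [].
by rewrite rmorph_norm_expr !hC !hl !hq.
Qed.

Lemma rform_line12 j : rform O 1 (fun _ p => line12 p 0 j).
Proof.
apply: (@rform_ext _ net O _ _ (fun _ p =>
    (delta_mx 0 1 : 'rV[K]_7) 0 j * p 0 0 + (delta_mx 0 2 : 'rV[K]_7) 0 j * p 0 1)).
  by apply: rform_add; apply: rform_scale (freg_cst _ _) (rform_X _ _).
by move=> _ p; rewrite !mxE; ring.
Qed.

Lemma rform_norm k l : rform O 4 (fun A p => norm_at (A k) (A l) (line12 p)).
Proof.
have hl m : rform O 1 (fun A p => lin_at (A m) (line12 p)).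
  by apply: rform_sum => j; apply: rform_scale (@mreg_net _ _ _ _) (rform_line12 j).
have hq m : rform O 2 (fun A p => quad_at (A m) (line12 p)).
  apply: rform_sum => i; apply: rform_sum => j; apply: rform_scale (@mreg_net _ _ _ _) _.
  exact: rform_mul (rform_line12 i) (rform_line12 j).
have sub d f g : rform O d f -> rform O d g ->
    rform O d (fun (A : net) (p : 'rV[K]_2) => f A p - g A p).
  move=> hf hg; apply: rform_ext (rform_add hf (rform_scale (freg_cst _ (-1)) hg)) _.
  by move=> A p; rewrite mulN1r.
have h00 m : O (fun A => A m 0 0) := @mreg_net K m 0 0.
have hD m : rform O 2 (fun A p => disc_at (A m) (line12 p)).
  apply: (sub); first exact: rform_deg (rform_exp 2 (hl m)) _.
  exact: rform_scale (h00 m) (hq m).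
apply: (sub).
  apply: (rform_deg (d := (2 * 2)%N)) => //; apply: rform_exp; apply: rform_add.
    apply: (sub); first exact: rform_scale (h00 l)
      (rform_add (rform_deg (rform_exp 2 (hl k)) (erefl 2%N)) (hD k)).
    apply: (rform_deg (d := (1 + 1)%N)) => //; apply: rform_mul _ (hl l).
    apply: rform_scale _ (hl k); exact: freg_mul (freg_cst _ _) (h00 k).
  exact: rform_scale (freg_exp 2 (h00 k)) (hq l).
apply: (rform_deg (d := (2 + 2 * 1)%N)) => //; apply: rform_mul (hD k) _.
apply: rform_exp.
apply: rform_scale (freg_cst _ _) _.
by apply: (sub); [exact: rform_scale (h00 k) (hl l)|exact: rform_scale (h00 l) (hl k)].
Qed.

Lemma norm_at_delta (k : 'I_7) p : k != 0 ->
  norm_at (delta_mx 0 0) (delta_mx k k) (line12 p) = line12 p 0 k ^+ 4.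
Proof.
move=> k0; pose x := line12 p; have x0 : x 0 0 = 0 by rewrite !mxE /=; ring.
have hl j : lin_at (delta_mx j j) x = (j == 0)%:R * x 0 0.
  rewrite /lin_at (bigD1 0) //= big1 ?addr0 => [|i /negbTE i0].
    by rewrite mxE eq_sym andbb.
  by rewrite mxE; case: (eqVneq 0 j) => [<-|_]; rewrite ?i0 mul0r.
have hq j : quad_at (delta_mx j j) x = x 0 j ^+ 2.
  rewrite /quad_at (bigD1 j) //= (bigD1 j) //= [X in _ + X + _]big1 => [|i /negbTE i0].
    rewrite mxE eqxx mul1r addr0 big1 ?addr0 // => i /negbTE i0.
    by apply: big1 => l _; rewrite mxE i0 mul0r.
  by rewrite mxE i0 andbF mul0r.
rewrite /norm_at /disc_at !hl !hq -/x x0 !mxE eqxx eq_sym (negbTE k0) /=.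
by move: (x 0 k) => t; ring.
Qed.

Lemma delta_sym (k : 'I_7) : symmetric_mx (delta_mx k k : 'M[K]_7).
Proof. by rewrite /symmetric_mx trmx_delta. Qed.

(** The net of the squares of the coordinates in [s]. *)
Definition delta_net (s : seq 'I_7) : net := fun k => delta_mx (nth 0 s k) (nth 0 s k).

Lemma rform_eval (n : nat) d (g : net -> 'rV[K]_n -> K) p :
  rform O d g -> O (fun A => g A p).
Proof.
move=> [T [w [c [hc e]]]].
apply: (@freg_ext _ _ _ (fun A => \sum_k c k A * \prod_(i <- w k) p 0 i)).
  by apply: freg_sum => k; apply: freg_mul (hc k) (freg_cst _ _).
by move=> A; rewrite e.
Qed.

Lemma pt1E : pt1 K = line12 (delta_mx 0 0).
Proof. by apply/rowP => j; rewrite !mxE /=; ring. Qed.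

Lemma generic_regular : generic (fun A : net => regular_seq (net_forms A)).
Proof.
pose w := delta_net [:: 0; 1; 2].
have sw s : symmetric_net (delta_net s) by move=> k; apply: delta_sym.
have pair s (k : 'I_3) : k != 0 -> nth 0 s 0 = 0 :> 'I_7 -> nth 0 s k = 1 :> 'I_7 ->
    generic (fun A : net => good_pair (A 0) (A k)).
  move=> k0 s0 sk.
  exists (fun A : net => A 0 0 0 * norm_at (A 0) (A k) (pt1 K)); split.
  - apply: freg_mul (@mreg_net _ _ _ _) _; rewrite pt1E.
    exact: rform_eval (rform_norm 0 k).
  - exists (delta_net s); first exact: sw.
    rewrite /delta_net s0 sk pt1E norm_at_delta // -pt1E !mxE /=.
    by rewrite expr1n mul1r oner_eq0.
  move=> A _; rewrite mulf_eq0 negb_or => /andP[a0 n0]; split => //.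
  by rewrite peval_norm0 // mxE.
have g1 := @pair [:: 0; 1] 1 isT erefl erefl.
have g2 := @pair [:: 0; 0; 1] 2 isT erefl erefl.
have g3 : generic (fun A : net => no_common (A 0) (A 1) (A 2)).
  pose bad (A : net) (p : 'rV[K]_2) :=
    norm_at (A 0) (A 1) (line12 p) = 0 /\ norm_at (A 0) (A 2) (line12 p) = 0.
  have hl i : lifted O bad w 4 (fun p => p 0 i ^+ 4).
    case: i => [[|[|//]] hi].
      exists (fun A p => norm_at (A 0) (A 1) (line12 p)); split.
      - exact: rform_norm.
      - by move=> A p [].
      move=> p; rewrite norm_at_delta // !mxE /=; congr (_ ^+ 4).
      by rewrite mulr1 mulr0 addr0; congr (p 0 _); apply: val_inj.
    exists (fun A p => norm_at (A 0) (A 2) (line12 p)); split.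
    - exact: rform_norm.
    - by move=> A p [].
    move=> p; rewrite norm_at_delta // !mxE /=; congr (_ ^+ 4).
    by rewrite mulr1 mulr0 add0r; congr (p 0 _); apply: val_inj.
  have [E [hE E0 hs]] := elimination hl.
  exists E; split => //; first by exists w; [apply: sw|].
  move=> A _ EA t.
  pose p : 'rV[K]_2 := \row_i (if i == 0 then t else 1).
  have ep : pt12 t 1 = line12 p by rewrite /line12 !mxE.
  have z : pt12 t 1 0 0 = 0 by rewrite !mxE /=; ring.
  rewrite !peval_norm0 // ep => e1 e2.
  have /rowP/(_ 1) := hs A p EA (conj e1 e2).
  by rewrite !mxE /= => /eqP; rewrite oner_eq0.
have [E [hE hw hs]] := generic_and g1 (generic_and g2 g3).
exists E; split => // A sA EA; have [h1 [h2 h3]] := hs A sA EA.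
rewrite /net_forms !enum_ordSl /= (_ : enum 'I_0 = [::]) /=; last first.
  by apply: size0nil; rewrite size_enum_ord.
rewrite (_ : lift _ (lift _ _) = 2); last exact: val_inj.
rewrite (_ : lift _ _ = 1); last exact: val_inj.
exact: regular_of_norms (sA 0) (sA 1) (sA 2) h1 h2 h3.
Qed.

End GenericRegular.

(** * Elliptic quartics on the general threefold *)

(** ** Simultaneous diagonalisation *)

Section Diagonalisation.
Variables (K : numClosedFieldType) (n : nat).
Implicit Types M N P : 'M[K]_n.+1.

(** The eigenvalues of [N] are simple if [chi'(N)] is invertible, where [chi] is
    the characteristic polynomial. *)
Definition simple_det N : K := \det (horner_mx N (char_poly N)^`()).

(** A matrix with simple eigenvalues is diagonalisable. *)
Lemma simple_spectrum N : simple_det N != 0 ->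
  exists P d, [/\ P \in unitmx, P *m N = diag_mx (\row_i d i) *m P & injective d].
Proof.
move=> sN; pose chi := char_poly N.
have root' a : root chi a -> (chi^`()).[a] != 0.
  rewrite -eigenvalue_root_char => /eigenvalueP[v vN v0].
  apply: contraNneq v0 => z.
  have hv p : v *m horner_mx N p = p.[a] *: v.
    elim/poly_ind: p => [|p c IH].
      by rewrite rmorph0 mulmx0 horner0 scale0r.
    rewrite rmorphD rmorphM /= horner_mx_X horner_mx_C mulmxDr mulmxA IH.
    by rewrite -scalemxAl vN mul_mx_scalar hornerMXaddC scalerDl scalerA.
  have := hv chi^`(); rewrite z scale0r => /eqP.
  rewrite mulmx_free_eq0 //; by rewrite row_free_unit unitmxE unitfE.
have [r er] := closed_field_poly_normal chi.
rewrite (monicP (char_poly_monic N)) scale1r in er.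
have ur : uniq r.
  rewrite -separable_prod_XsubC -er unlock; apply: Pdiv.ClosedField.root_coprimep => a.
  exact: root'.
have [_ dP] := diagonalizableP N.
have [|P uP] := dP; first by exists r => //; rewrite -er mxminpoly_dvd_char.
move/similar_diagPex => [D] /(similarP uP) eP.
exists P, (fun i => D 0 i); split => //.
  by rewrite eP; congr (diag_mx _ *m _); apply/rowP => j; rewrite mxE.
have eD : chi = \prod_i ('X - (D 0 i)%:P).
  have -> : chi = char_poly (diag_mx D).
    have -> : diag_mx D = P *m N *m invmx P by rewrite eP mulmxK.
    have e2 : map_mx polyC P *m map_mx polyC (invmx P) = 1%:M.
      by rewrite -map_mxM mulmxV // map_mx1.
    have e1 : \det (map_mx polyC P) * \det (map_mx polyC (invmx P)) = 1.
      by rewrite -det_mulmx e2 det1.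
    rewrite /chi /char_poly -[LHS]mul1r -e1 mulrAC -!det_mulmx; congr (\det _).
    rewrite /char_poly_mx mulmxBr mulmxBl !map_mxM mul_mx_scalar -scalemxAl.
    by rewrite e2 scalemx1.
  rewrite char_poly_trig ?diag_mx_is_trig //.
  by apply: eq_bigr => i _; rewrite mxE eqxx.
have : uniq [seq D 0 i | i <- enum 'I_n.+1].
  rewrite -separable_prod_XsubC big_map big_enum -eD er.
  by rewrite separable_prod_XsubC.
by move/injectiveP.
Qed.

(** Two symmetric forms, the first one nondegenerate, whose ratio has simple
    eigenvalues, have a common orthogonal basis of eigenvectors. *)
Lemma simultaneous_diag M N : symmetric_mx M -> symmetric_mx N -> \det M != 0 ->
  simple_det (N *m \adj M) != 0 ->
  exists (G : 'M[K]_n.+1) (c : 'I_n.+1 -> K), [/\ G *m M *m G^T = 1%:M,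
    G *m N *m G^T = diag_mx (\row_i c i)
    & injective c].
Proof.
move=> sM sN dM /simple_spectrum[P [d [uP eP di]]].
have e1 : \det M *: (P *m N) = diag_mx (\row_i d i) *m P *m M.
  by rewrite -eP !mulmxA -(mulmxA (P *m N)) mul_adj_mx mul_mx_scalar.
pose S := P *m M *m P^T.
have sS : S^T = S by rewrite !trmx_mul trmxK sM mulmxA.
have eS : \det M *: (P *m N *m P^T) = diag_mx (\row_i d i) *m S.
  by rewrite scalemxAl e1 !mulmxA.
have comm : diag_mx (\row_i d i) *m S = S *m diag_mx (\row_i d i).
  have eT : (P *m N *m P^T)^T = P *m N *m P^T by rewrite !trmx_mul trmxK sN mulmxA.
  have := congr1 trmx eS; rewrite linearZ /= eT eS => ->.
  by rewrite trmx_mul sS tr_diag_mx.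
have S_diag i j : i != j -> S i j = 0.
  move=> ij; have /matrixP/(_ i j) := comm.
  rewrite mul_diag_mx mul_mx_diag !mxE mulrC => /eqP.
  rewrite -subr_eq0 -mulrBr mulf_eq0 subr_eq0 (inj_eq di) (negbTE ij) orbF.
  by move/eqP.
have Sii i : S i i != 0.
  have : \det S != 0.
    by rewrite !det_mulmx det_tr !mulf_neq0 // -unitfE -unitmxE.
  rewrite det_trig; first by move/prodf_neq0; apply.
  by apply/is_trig_mxP => k l kl; apply: S_diag; rewrite neq_ltn kl.
have ePM : P *m M *m P^T = S by [].
have ePN : P *m N *m P^T = (\det M)^-1 *: (diag_mx (\row_i d i) *m S).
  by rewrite -eS scalerA mulVf // scale1r.
clearbody S.
pose D := diag_mx (\row_i (sqrtC (S i i))^-1).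
exists (D *m P), (fun i => d i / \det M); split;
  last by move=> i j /(mulIf (invr_neq0 dM)); apply: di.
- rewrite trmx_mul tr_diag_mx !mulmxA -[D *m P *m M]mulmxA -[D *m _ *m P^T]mulmxA.
  rewrite ePM; apply/matrixP => i j; rewrite mul_mx_diag mul_diag_mx !mxE.
  case: (eqVneq i j) => [<-|/S_diag ->]; last by rewrite mulr0 mul0r.
  by rewrite mulrAC -expr2 exprVn sqrtCK mulVf.
rewrite trmx_mul tr_diag_mx !mulmxA -[D *m P *m N]mulmxA -[D *m _ *m P^T]mulmxA.
rewrite ePN; apply/matrixP => i j; rewrite mul_mx_diag !mul_diag_mx !mxE.
case: (eqVneq i j) => [<-|/S_diag ->]; last by rewrite !(mulr0, mul0r).
rewrite mulr1n; transitivity (((sqrtC (S i i))^-1 ^+ 2 * S i i) * (d i / \det M)).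
  by ring.
by rewrite exprVn sqrtCK mulVf // mul1r.
Qed.

End Diagonalisation.

(** ** Isotropic frames of a degenerate quadric *)

Section IsotropicFrames.
Variables (K : fieldType).
Local Notation rV := 'rV[K]_7.
Implicit Types (q : 'M[K]_7) (u v w x y : rV) (s : K).

(** The bilinear form of [q]. *)
Definition qb q x y : K := (x *m q *m y^T) 0 0.

Lemma qbDl q x x' y : qb q (x + x') y = qb q x y + qb q x' y.
Proof. by rewrite /qb !mulmxDl mxE. Qed.
Lemma qbZl q c x y : qb q (c *: x) y = c * qb q x y.
Proof. by rewrite /qb -!scalemxAl mxE. Qed.
Lemma qbC q x y : symmetric_mx q -> qb q x y = qb q y x.
Proof.
move=> sq; rewrite /qb -[LHS]/((x *m q *m y^T) 0 0) -[x *m q *m y^T]trmxK mxE.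
by rewrite !trmx_mul trmxK sq mulmxA.
Qed.
Lemma qbDr q x y y' : qb q x (y + y') = qb q x y + qb q x y'.
Proof. by rewrite /qb linearD mulmxDr mxE. Qed.
Lemma qbZr q c x y : qb q x (c *: y) = c * qb q x y.
Proof. by rewrite /qb linearZ -scalemxAr mxE. Qed.

(** A combination of [u] and [u'], isotropic when [iso_eq] vanishes. *)
Definition iso_vec q u u' s : rV := qb q u' u' *: u + s *: u'.
Definition iso_eq q u u' s : K :=
  s ^+ 2 + 2%:R * qb q u u' * s + qb q u u * qb q u' u'.

Lemma iso_vecP q u u' s : symmetric_mx q -> iso_eq q u u' s = 0 ->
  qb q (iso_vec q u u' s) (iso_vec q u u' s) = 0.
Proof.
move=> sq e; rewrite /iso_vec !(qbDl, qbDr, qbZl, qbZr) [qb q u' u]qbC //.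
transitivity (qb q u' u' * iso_eq q u u' s); last by rewrite e mulr0.
by rewrite /iso_eq; ring.
Qed.

(** A matrix whose characteristic polynomial is [iso_eq] as a function of [s]. *)
Definition iso_mx q u u' : 'M[K]_2 := \matrix_(i, j)
  if i == 0 then (if j == 0 then - (2%:R * qb q u u') else - (qb q u u * qb q u' u'))
  else (j == 0)%:R.

Lemma iso_mxP q u u' s : eigenvalue (iso_mx q u u') s <-> iso_eq q u u' s = 0.
Proof.
pose vv (a b : K) : 'rV[K]_2 := \row_j (if j == 0 then a else b).
have ve (v : 'rV[K]_2) : v = vv (v 0 0) (v 0 1).
  apply/rowP => j; rewrite mxE; case: j => [[|[|//]] hj] /=; congr (v 0 _); exact: val_inj.
have mulE a b : vv a b *m iso_mx q u u' =
    vv (b - a * (2%:R * qb q u u')) (- (a * (qb q u u * qb q u' u'))).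
  apply/rowP => j; rewrite mxE big_ord_recl big_ord1 !mxE /=.
  by case: eqP => _ /=; ring.
split=> [/eigenvalueP[v]|e].
  rewrite (ve v) mulE; move: (v 0 0) (v 0 1) => a b /rowP h v0.
  have := h 0; have := h 1; rewrite !mxE /= => h1 h0.
  have a0 : a != 0.
    apply: contraNneq v0 => a0; apply/eqP/rowP => j; rewrite !mxE.
    by move: h0; rewrite a0 mulr0 mul0r subr0 => ->; case: ifP.
  apply: (mulfI a0); rewrite mulr0 /iso_eq.
  have -> : a * (s ^+ 2 + 2%:R * qb q u u' * s + qb q u u * qb q u' u') =
    s * (s * a + a * (2%:R * qb q u u')) + a * (qb q u u * qb q u' u') by ring.
  by rewrite -h0 subrK -h1 addNr.
apply/eigenvalueP; exists (vv 1 (s + 2%:R * qb q u u')); last first.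
  by apply/eqP => /rowP/(_ 0); rewrite !mxE /= => /eqP; rewrite oner_eq0.
rewrite mulE; apply/rowP => j; rewrite !mxE; case: eqP => _; first by ring.
by apply/eqP; rewrite -subr_eq0 -oppr_eq0 -e /iso_eq; apply/eqP; ring.
Qed.

(** A combination of [y] and [e] orthogonal to [w]. *)
Definition perp q w e y : rV := qb q w e *: y - qb q w y *: e.

Lemma perpP q w e y : qb q w (perp q w e y) = 0.
Proof. by rewrite /perp qbDr -scaleNr !qbZr; ring. Qed.

Lemma qb_perp0 q z w e y :
  qb q w e = 0 -> qb q w y = 0 -> qb q w (perp q z e y) = 0.
Proof. by move=> he hy; rewrite /perp qbDr -scaleNr !qbZr he hy !mulr0 addr0. Qed.

Lemma qb_iso0 q w u u' s :
  qb q w u = 0 -> qb q w u' = 0 -> qb q w (iso_vec q u u' s) = 0.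
Proof. by move=> hu hu'; rewrite /iso_vec qbDr !qbZr hu hu' !mulr0 addr0. Qed.

Definition ebase (i : 'I_7) : rV := delta_mx 0 i.

(** Three orthogonal isotropic vectors: each is taken in the span of two vectors
    orthogonal to the preceding ones. *)
Definition fv1 q s1 := iso_vec q (ebase 1) (ebase 2) s1.
Definition pv1 q s1 y := perp q (fv1 q s1) (ebase 1) y.
Definition fv2 q s1 s2 := iso_vec q (pv1 q s1 (ebase 3)) (pv1 q s1 (ebase 4)) s2.
Definition pv2 q s1 s2 y :=
  perp q (fv2 q s1 s2) (pv1 q s1 (ebase 3)) (pv1 q s1 y).
Definition fv3 q s1 s2 s3 :=
  iso_vec q (pv2 q s1 s2 (ebase 5)) (pv2 q s1 s2 (ebase 6)) s3.

(** A vector of the kernel of [q], if [q] is singular. *)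
Definition fv0 q : rV := row 0 (\adj q).
(** The rows of [frame] span an isotropic subspace of a singular quadric. *)
Definition frame q s1 s2 s3 : 'M[K]_(4, 7) := \matrix_(i < 4)
  nth 0 [:: fv0 q; fv1 q s1; fv2 q s1 s2; fv3 q s1 s2 s3] i.

Lemma qb_frame q (W : 'M[K]_(4, 7)) i j :
  (W *m q *m W^T) i j = qb q (row i W) (row j W).
Proof. by rewrite /qb -row_mul !mxE; apply: eq_bigr => k _; rewrite !mxE. Qed.

Lemma frame_isotropic q s1 s2 s3 : symmetric_mx q -> \det q = 0 ->
  iso_eq q (ebase 1) (ebase 2) s1 = 0 ->
  iso_eq q (pv1 q s1 (ebase 3)) (pv1 q s1 (ebase 4)) s2 = 0 ->
  iso_eq q (pv2 q s1 s2 (ebase 5)) (pv2 q s1 s2 (ebase 6)) s3 = 0 ->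
  frame q s1 s2 s3 *m q *m (frame q s1 s2 s3)^T = 0.
Proof.
move=> sq dq e1 e2 e3.
have h0 y : qb q (fv0 q) y = 0.
  rewrite /qb /fv0 -row_mul mul_adj_mx dq.
  by rewrite (_ : row 0 _ = 0) ?mul0mx ?mxE //; apply/rowP => j; rewrite !mxE mul0rn.
have h11 : qb q (fv1 q s1) (fv1 q s1) = 0 := iso_vecP sq e1.
have h22 : qb q (fv2 q s1 s2) (fv2 q s1 s2) = 0 := iso_vecP sq e2.
have h33 : qb q (fv3 q s1 s2 s3) (fv3 q s1 s2 s3) = 0 := iso_vecP sq e3.
have p1 y : qb q (fv1 q s1) (pv1 q s1 y) = 0 by exact: perpP.
have p2 y : qb q (fv2 q s1 s2) (pv2 q s1 s2 y) = 0 by exact: perpP.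
have h12 : qb q (fv1 q s1) (fv2 q s1 s2) = 0 := qb_iso0 _ (p1 _) (p1 _).
have h13 : qb q (fv1 q s1) (fv3 q s1 s2 s3) = 0.
  exact: qb_iso0 _ (qb_perp0 _ (p1 _) (p1 _)) (qb_perp0 _ (p1 _) (p1 _)).
have h23 : qb q (fv2 q s1 s2) (fv3 q s1 s2 s3) = 0 := qb_iso0 _ (p2 _) (p2 _).
have hc x y : qb q x y = 0 -> qb q y x = 0 by move=> <-; exact: qbC.
have := (hc _ _ h12, hc _ _ h13, hc _ _ h23, h11, h22, h33, (h12, h13, h23)).
have := fun y => hc _ _ (h0 y); move: h0.
rewrite /frame; move: (fv0 q) (fv1 _ _) (fv2 _ _ _) (fv3 _ _ _ _).
move=> f0 f1 f2 f3 h0 h0' h.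
apply/matrixP => i j; rewrite qb_frame !rowK [RHS]mxE.
case: i j => [[|[|[|[|//]]]] ?] [[|[|[|[|//]]]] ?] /=; by rewrite ?h0 ?h0' ?h.
Qed.

End IsotropicFrames.

(** Solutions of [iso_eq] spread to a neighbourhood. *)
Section RegularFrames.
Variables (K : closedFieldType) (X : Type) (O : falg K X).
Implicit Types (q : X -> 'M[K]_7) (u v : X -> 'rV[K]_7).

Lemma mreg_qb q u v : mreg O q -> mreg O u -> mreg O v ->
  O (fun x => qb (q x) (u x) (v x)).
Proof. by move=> hq hu hv; apply: mreg_mul (mreg_mul hu hq) (mreg_tr hv) _ _. Qed.

Lemma mreg_iso_vec q u v (s : X -> K) : mreg O q -> mreg O u -> mreg O v -> O s ->
  mreg O (fun x => iso_vec (q x) (u x) (v x) (s x)).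
Proof.
move=> hq hu hv hs; apply: mreg_add (mreg_scale _ hu) (mreg_scale hs hv).
exact: mreg_qb.
Qed.

Lemma mreg_perp q u v w : mreg O q -> mreg O u -> mreg O v -> mreg O w ->
  mreg O (fun x => perp (q x) (u x) (v x) (w x)).
Proof.
move=> hq hu hv hw; apply: mreg_sub (mreg_scale _ hw) (mreg_scale _ hv);
  exact: mreg_qb.
Qed.

Lemma lift_iso q u v (F : X * K -> K) x0 s0 :
  mreg O q -> mreg O u -> mreg O v -> falg_prod O F ->
  iso_eq (q x0) (u x0) (v x0) s0 = 0 -> F (x0, s0) != 0 ->
  exists E, [/\ O E, E x0 != 0 & forall x, E x != 0 ->
    exists2 s, iso_eq (q x) (u x) (v x) s = 0 & F (x, s) != 0].
Proof.
move=> hq hu hv hF e F0.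
have hM : mreg O (fun x => iso_mx (q x) (u x) (v x)).
  have h f g : mreg O f -> mreg O g -> O (fun x => qb (q x) (f x) (g x)).
    by move=> hf hg; apply: mreg_qb.
  move=> i j; case: (eqVneq i 0) => [->|i0].
    case: (eqVneq j 0) => [->|j0].
      apply: (@freg_ext _ _ O (fun x => - 2%:R * qb (q x) (u x) (v x))).
        exact: freg_scale (h _ _ hu hv).
      by move=> x; rewrite mxE /= mulNr.
    apply: (freg_ext (freg_scale (-1) (freg_mul (h _ _ hu hu) (h _ _ hv hv)))).
    by move=> x; rewrite mxE /= (negbTE j0) mulN1r.
  apply: freg_ext (freg_cst O (j == 0)%:R) _ => x.
  by rewrite mxE (negbTE i0).
have [E [hE E0 hs]] := lift_eigenvalue hM hF (proj2 (iso_mxP _ _ _ _) e) F0.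
by exists E; split => // x /hs[s /iso_mxP]; exists s.
Qed.

End RegularFrames.

(** ** Existence of the elliptic curve *)

Section GenericCurve.
Variable K : numClosedFieldType.
Local Notation net := ('I_3 -> 'M[K]_7).
Local Notation O := (net_alg K).

(** A degenerate member of the pencil of the first two quadrics, for [mu] an
    eigenvalue of [A 0 *m \adj (A 1)]. *)
Definition cone (A : net) (mu : K) : 'M[K]_7 := \det (A 1) *: A 0 - mu *: A 1.

Lemma cone_sym A mu : symmetric_net A -> symmetric_mx (cone A mu).
Proof. by move=> sA; rewrite /symmetric_mx /cone linearB !linearZ /= !sA. Qed.

Lemma cone_det A mu : eigenvalue (A 0 *m \adj (A 1)) mu ->
  \det (cone A mu) = 0.
Proof.
move=> /eigenvalueP[v vM v0]; apply/eqP/det0P; exists v => //.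
have := congr1 (mulmx^~ (A 1)) vM.
rewrite mulmxA -(mulmxA _ (\adj _)) mul_adj_mx mul_mx_scalar -scalemxAl => e.
by rewrite /cone mulmxBr -!scalemxAr e subrr.
Qed.

(** On the row space of [W], the second quadric is nondegenerate and its pencil
    with the third one has simple eigenvalues, if [frame_disc] is nonzero. *)
Definition frame_disc (A : net) (W : 'M[K]_(4, 7)) : K :=
  \det (A 1) * \det (W *m A 1 *m W^T) *
  simple_det (W *m A 2 *m W^T *m \adj (W *m A 1 *m W^T)).

Lemma curve_of_frame A mu W : symmetric_net A ->
  W *m cone A mu *m W^T = 0 -> frame_disc A W != 0 ->
  exists C, [/\ elliptic_curve C 4, projectively_normal C & subscheme C (V8_ideal A)].
Proof.
move=> sA Wq; rewrite /frame_disc !mulf_eq0 !negb_or => /andP[/andP[d1 dr] sd].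
have sW k : symmetric_mx (W *m A k *m W^T).
  by rewrite /symmetric_mx !trmx_mul trmxK sA mulmxA.
have [G [c [e1 e2 ci]]] := simultaneous_diag (sW 1) (sW 2) dr sd.
pose W' := G *m W.
have eW B : W' *m B *m W'^T = G *m (W *m B *m W^T) *m G^T.
  by rewrite /W' trmx_mul !mulmxA.
have f1 : W' *m A 1 *m W'^T = 1%:M by rewrite eW.
have f2 : W' *m A 2 *m W'^T = diag_mx (\row_i c i) by rewrite eW.
apply: (@elliptic_quartic_exists K A W' (W' *m A 1) (A 1) (A 2) c) => //.
case=> [[|[|[|//]]] hk].
- rewrite (_ : Ordinal hk = 0); last exact: val_inj.
  exists (mu / \det (A 1)), 0; rewrite scale0r addr0.
  have := congr1 (fun B => G *m B *m G^T) Wq; rewrite -eW mulmx0 mul0mx.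
  rewrite /cone mulmxBr mulmxBl -!scalemxAr -!scalemxAl f1 => /eqP.
  rewrite subr_eq0 scalemx1 => /eqP /(congr1 ( *:%R (\det (A 1))^-1)).
  by rewrite scalerA mulVf // scale1r scale_scalar_mx mulrC.
- rewrite (_ : Ordinal hk = 1); last exact: val_inj.
  by exists 1, 0; rewrite scale0r addr0.
rewrite (_ : Ordinal hk = 2); last exact: val_inj.
by exists 0, 1; rewrite scale1r raddf0 add0r.
Qed.

Section Regularity.
Variables (X : Type) (OX : falg K X).

Lemma mreg_frame (q : X -> 'M[K]_7) (s1 s2 s3 : X -> K) : mreg OX q ->
  OX s1 -> OX s2 -> OX s3 ->
  [/\ mreg OX (fun x => frame (q x) (s1 x) (s2 x) (s3 x)),
      forall y, mreg OX (fun x => pv1 (q x) (s1 x) y)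
    & forall y, mreg OX (fun x => pv2 (q x) (s1 x) (s2 x) y)].
Proof.
move=> hq h1 h2 h3; have hc y : mreg OX (fun=> y : 'rV[K]_7) := mreg_cst OX y.
have hf1 : mreg OX (fun x => fv1 (q x) (s1 x)) by exact: mreg_iso_vec.
have hp1 y : mreg OX (fun x => pv1 (q x) (s1 x) y) by exact: mreg_perp.
have hf2 : mreg OX (fun x => fv2 (q x) (s1 x) (s2 x)) by exact: mreg_iso_vec.
have hp2 y : mreg OX (fun x => pv2 (q x) (s1 x) (s2 x) y) by exact: mreg_perp.
have hf3 : mreg OX (fun x => fv3 (q x) (s1 x) (s2 x) (s3 x)) by exact: mreg_iso_vec.
have hf0 : mreg OX (fun x => fv0 (q x)) by exact/mreg_row/mreg_adj.
split=> // i j.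
apply: (@freg_ext _ _ OX (fun x =>
  nth (fun=> 0) [:: fun x => fv0 (q x) 0 j; fun x => fv1 (q x) (s1 x) 0 j;
    fun x => fv2 (q x) (s1 x) (s2 x) 0 j;
    fun x => fv3 (q x) (s1 x) (s2 x) (s3 x) 0 j] i x)).
  by case: i => [[|[|[|[|//]]]] hi] /=; [exact: hf0|exact: hf1|exact: hf2|exact: hf3].
by move=> x; rewrite mxE; case: i => [[|[|[|[|//]]]] hi].
Qed.

Lemma mreg_frame_disc (A : X -> net) (W : X -> 'M[K]_(4, 7)) :
  (forall k, mreg OX (fun x => A x k)) -> mreg OX W ->
  OX (fun x => frame_disc (A x) (W x)).
Proof.
move=> hA hW; have hr k : mreg OX (fun x => W x *m A x k *m (W x)^T).
  exact: mreg_mul (mreg_mul hW (hA k)) (mreg_tr hW).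
apply: freg_mul (freg_mul (mreg_det (hA 1)) (mreg_det (hr 1))) _.
have hN := mreg_mul (hr 2) (mreg_adj (hr 1)).
exact: mreg_det (mreg_horner hN (preg_deriv (preg_char hN))).
Qed.

End Regularity.

(** *** A net for which the construction succeeds *)

(** The matrices are diagonal, with diagonals [(0, 1, -1, 1, -1, 1, -1)], [(1, 1, 1,
    1, 1, 1, 1)] and [(0, 1, 0, 2, 0, 3, 0)]; the cone is the first quadric. *)
Definition tower_row (k : nat) (j : 'I_7) : K :=
  if k == 0%N then (if j == 0 then 0 else (-1) ^+ j.+1)
  else if k == 1%N then 1 else if odd j then (uphalf j)%:R else 0.
Definition tower_net : net := fun k => diag_mx (\row_j tower_row k j).
Local Notation q0 := (cone tower_net 0).

Lemma tower_net_sym : symmetric_net tower_net.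
Proof. by move=> k; rewrite /symmetric_mx tr_diag_mx. Qed.

Lemma tower_det1 : \det (tower_net 1) = 1.
Proof. by rewrite det_diag; apply: big1 => i _; rewrite mxE. Qed.

Lemma tower_cone : q0 = tower_net 0.
Proof. by rewrite /cone tower_det1 scale0r scale1r subr0. Qed.

Lemma qb_base (q : 'M[K]_7) i j : qb q (ebase K i) (ebase K j) = q i j.
Proof. by rewrite /qb -rowE trmx_delta -colE !mxE. Qed.

Lemma qb_tower (k : 'I_3) i j :
  qb (tower_net k) (ebase K i) (ebase K j) = tower_row k j *+ (i == j).
Proof. by rewrite qb_base !mxE; case: eqP => [->|]. Qed.

Local Notation e := (ebase K).
Lemma qbNl q (x y : 'rV[K]_7) : qb q (- x) y = - qb q x y.
Proof. by rewrite -scaleN1r qbZl mulN1r. Qed.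
Lemma qbNr q (x y : 'rV[K]_7) : qb q x (- y) = - qb q x y.
Proof. by rewrite -scaleN1r qbZr mulN1r. Qed.
Let qbE := (qbNl, qbNr, qbDl, qbDr, qbZl, qbZr).

Ltac tower_eval :=
  rewrite /perp /iso_vec ?qbE ?qb_tower /tower_row /= ?mulr0n ?mulr1n;
  apply/rowP => j; rewrite !mxE; ring.

Lemma tower_fv1 : fv1 q0 (-1) = - (e 1 + e 2).
Proof. rewrite tower_cone /fv1; tower_eval. Qed.

Lemma tower_pv1 (j : 'I_7) : (2 < j)%N -> pv1 q0 (-1) (e j) = - e j.
Proof.
move=> j2; rewrite /pv1 tower_fv1 tower_cone /perp !qbE !qb_tower.
have h (k : 'I_7) : (k <= 2)%N -> (k == j) = false.
  by move=> k2; apply/eqP => kj; rewrite kj in k2; lia.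
rewrite !h // !mulr0n /tower_row /=; apply/rowP => l; rewrite !mxE; ring.
Qed.

Lemma tower_fv2 : fv2 q0 (-1) (-1) = e 3 + e 4.
Proof. rewrite /fv2 !tower_pv1 // tower_cone; tower_eval. Qed.

Lemma tower_pv2 (j : 'I_7) : (4 < j)%N -> pv2 q0 (-1) (-1) (e j) = e j.
Proof.
move=> j4; rewrite /pv2 tower_fv2 !tower_pv1 ?(ltn_trans _ j4) // tower_cone.
rewrite /perp !qbE !qb_tower.
have h (k : 'I_7) : (k <= 4)%N -> (k == j) = false.
  by move=> k2; apply/eqP => kj; rewrite kj in k2; lia.
rewrite !h // !mulr0n /tower_row /=; apply/rowP => l; rewrite !mxE; ring.
Qed.

Lemma tower_fv3 : fv3 q0 (-1) (-1) (-1) = - (e 5 + e 6).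
Proof. rewrite /fv3 !tower_pv2 // tower_cone; tower_eval. Qed.

Lemma tower_fv0 : exists2 c, c != 0 & fv0 q0 = c *: e 0.
Proof.
have d0 j : j != 0 -> tower_row 0 j != 0.
  by move=> j0; rewrite /tower_row /= (negbTE j0) signr_eq0.
rewrite tower_cone; exists (\adj (tower_net 0) 0 0).
  rewrite mxE /cofactor /= mul1r.
  have -> : row' 0 (col' 0 (tower_net 0)) =
      diag_mx (\row_j tower_row 0 (lift 0 j)) :> 'M[K]_6.
    by apply/matrixP => i j; rewrite !mxE (inj_eq lift_inj).
  by rewrite det_diag; apply/prodf_neq0 => i _; rewrite mxE d0.
apply/rowP => j; rewrite !mxE; have [->|j0] := eqVneq j 0; first by rewrite mulr1.
rewrite mulr0; have := mul_adj_mx (tower_net 0).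
rewrite [X in X%:M]det_diag (bigD1 0) //= mxE /tower_row /= mul0r.
move/matrixP/(_ 0 j); rewrite mul_mx_diag !mxE mul0rn => /eqP.
by rewrite mulf_eq0 -[X in _ || X]negbK -/(tower_row 0 j) d0 // orbF => /eqP.
Qed.

Local Notation W0 := (frame q0 (-1) (-1) (-1)).

Lemma tower_frame : exists2 c, c != 0 & forall k : 'I_3,
  W0 *m tower_net k *m W0^T = diag_mx (\row_i nth 0 [:: c ^+ 2 * tower_row k 0;
    tower_row k 1 + tower_row k 2; tower_row k 3 + tower_row k 4;
    tower_row k 5 + tower_row k 6] i).
Proof.
have [c c0 ec] := tower_fv0; exists c => // k.
apply/matrixP => i j; rewrite qb_frame /frame !rowK.
rewrite ec tower_fv1 tower_fv2 tower_fv3 !mxE.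
by case: i j => [[|[|[|[|//]]]] ?] [[|[|[|[|//]]]] ?];
  rewrite [LHS]/= !qbE !qb_tower /= ?mulr0n ?mulr1n; ring.
Qed.

Lemma simple_det_diag n (d : 'rV[K]_n.+1) : injective (d 0) ->
  simple_det (diag_mx d) != 0.
Proof.
move=> di; rewrite /simple_det horner_mx_diag det_diag.
apply/prodf_neq0 => i _; rewrite mxE.
have e1 : char_poly (diag_mx d) = \prod_(x <- codom (d 0)) ('X - x%:P).
  rewrite char_poly_trig ?diag_mx_is_trig // big_map big_enum.
  by apply: eq_bigr => j _; rewrite mxE eqxx.
apply: (@coprimep_root _ (char_poly (diag_mx d))).
  have : separable_poly (char_poly (diag_mx d)).
    by rewrite e1 separable_prod_XsubC; apply/injectiveP.
  by rewrite unlock.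
rewrite e1 root_prod_XsubC; exact: codom_f.
Qed.

Lemma tower_disc : frame_disc tower_net W0 != 0.
Proof.
have [c c0 h] := tower_frame.
pose a i := nth 0 [:: c ^+ 2; 2; 2; 2] i.
pose b i : K := nth 0 [:: 0; 1; 2; 3] i.
have a0 (i : 'I_4) : a i != 0.
  by case: i => [[|[|[|[|//]]]] ?]; rewrite /a /= ?expf_neq0 // pnatr_eq0.
have h1 : W0 *m tower_net 1 *m W0^T = diag_mx (\row_(i < 4) a i).
  rewrite h; congr diag_mx; apply/rowP => i; rewrite !mxE.
  by case: i => [[|[|[|[|//]]]] ?]; rewrite /a /tower_row /= ?mulr1.
have h2 : W0 *m tower_net 2 *m W0^T = diag_mx (\row_(i < 4) b i).
  rewrite h; congr diag_mx; apply/rowP => i; rewrite !mxE.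
  by case: i => [[|[|[|[|//]]]] ?]; rewrite /b /tower_row /= ?mulr0 ?addr0.
rewrite /frame_disc h1 h2 tower_det1 mul1r.
set R1 := diag_mx (\row_i a i).
have dR : \det R1 != 0 by rewrite det_diag; apply/prodf_neq0 => i _; rewrite mxE.
rewrite mulf_neq0 //.
have -> : diag_mx (\row_i b i) *m \adj R1 = diag_mx (\row_i (\det R1 * (b i / a i))).
  apply: (can_inj (mulmxK (_ : R1 \in unitmx))); first by rewrite unitmxE unitfE.
  rewrite -mulmxA mul_adj_mx mul_mx_scalar; apply/matrixP => i j.
  rewrite mul_mx_diag !mxE; case: eqP => [<-|_]; last by rewrite !mulr0n mulr0 mul0r.
  by rewrite !mulr1n -mulrA divfK.
apply: simple_det_diag => i j; rewrite !mxE => /(mulfI dR).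
have bE (k : 'I_4) : b k / a k = k%:R / 2.
  by case: k => [[|[|[|[|//]]]] ?]; rewrite /b /a /= ?mul0r.
rewrite !bE => /(divIf _) -/(_ _)/eqP; rewrite pnatr_eq0 eqr_nat => /(_ isT)/eqP.
exact: val_inj.
Qed.

(** The eigenvalue [mu] and the three roots of [iso_eq] are chosen in succession
    over the general net, so that [frame_disc] does not vanish. *)
Lemma generic_curve : generic (fun A : net => exists C,
  [/\ elliptic_curve C 4, projectively_normal C & subscheme C (V8_ideal A)]).
Proof.
pose O1 := falg_prod O; pose O2 := falg_prod O1; pose O3 := falg_prod O2.
pose O4 := falg_prod O3.
have hq : mreg O1 (fun z => cone z.1 z.2).
  have hA k := mreg_fst (@mreg_net K k).
  apply: mreg_sub (mreg_scale _ (hA 0)) (mreg_scale (falg_prod_snd O) (hA 1)).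
  exact: mreg_det (hA 1).
pose q2 (z : net * K * K) := cone z.1.1 z.1.2.
have hq2 : mreg O2 q2 := mreg_fst hq.
pose q3 (z : net * K * K * K) := q2 z.1.
have hq3 : mreg O3 q3 := mreg_fst hq2.
pose q4 (z : net * K * K * K * K) := q3 z.1.
have hq4 : mreg O4 q4 := mreg_fst hq3.
have r1 : O2 (fun z => z.2) := falg_prod_snd O1.
have r2 : O3 (fun z => z.1.2) := falg_prod_fst r1.
have r3 : O4 (fun z => z.1.1.2) := falg_prod_fst r2.
have t1 : O3 (fun z => z.2) := falg_prod_snd O2.
have t2 : O4 (fun z => z.1.2) := falg_prod_fst t1.
have u1 : O4 (fun z => z.2) := falg_prod_snd O3.
have hc (X : Type) (OX : falg K X) y : mreg OX (fun=> y : 'rV[K]_7) := mreg_cst OX y.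
pose F4 (z : net * K * K * K * K) :=
  frame_disc z.1.1.1.1 (frame (q4 z) z.1.1.2 z.1.2 z.2).
have hF4 : O4 F4.
  apply: mreg_frame_disc; last by have [] := mreg_frame hq4 r3 t2 u1.
  by move=> k; exact: mreg_fst (mreg_fst (mreg_fst (mreg_fst (@mreg_net K k)))).
pose w1 : net * K := (tower_net, 0).
have [_ _ p3] := mreg_frame hq3 r2 t1 t1.
have [_ p2 _] := mreg_frame hq2 r1 r1 r1.
have z3 : iso_eq (q3 (w1, -1, -1)) (pv2 (q3 (w1, -1, -1)) (-1) (-1) (ebase K 5))
    (pv2 (q3 (w1, -1, -1)) (-1) (-1) (ebase K 6)) (-1) = 0.
  rewrite /q3 /q2 /w1 /= !tower_pv2 // /iso_eq tower_cone !qb_tower /tower_row /=.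
  by rewrite mulr0n !mulr1n; ring.
have [E3 [hE3 n3 s3]] := lift_iso hq3 (p3 (ebase K 5)) (p3 (ebase K 6)) hF4 z3 tower_disc.
have z2 : iso_eq (q2 (w1, -1)) (pv1 (q2 (w1, -1)) (-1) (ebase K 3))
    (pv1 (q2 (w1, -1)) (-1) (ebase K 4)) (-1) = 0.
  rewrite /q2 /w1 /= !tower_pv1 // /iso_eq tower_cone !qbE !qb_tower /tower_row /=.
  by rewrite mulr0n !mulr1n; ring.
have [E2 [hE2 n2 s2]] := lift_iso hq2 (p2 (ebase K 3)) (p2 (ebase K 4)) hE3 z2 n3.
have z1 : iso_eq (cone w1.1 w1.2) (ebase K 1) (ebase K 2) (-1) = 0.
  rewrite /w1 /= /iso_eq tower_cone !qb_tower /tower_row /=.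
  by rewrite mulr0n !mulr1n; ring.
have [E1 [hE1 n1 s1]] := lift_iso hq (hc _ _ (ebase K 1)) (hc _ _ (ebase K 2)) hE2 z1 n2.
have hM : mreg O (fun A : net => A 0 *m \adj (A 1)).
  exact: mreg_mul (@mreg_net K 0) (mreg_adj (@mreg_net K 1)).
have z0 : eigenvalue (tower_net 0 *m \adj (tower_net 1)) 0.
  apply/eigenvalueP; exists (ebase K 0); last first.
    by apply/eqP => /rowP/(_ 0); rewrite !mxE => /eqP; rewrite oner_eq0.
  rewrite mulmxA scale0r (_ : ebase K 0 *m tower_net 0 = 0) ?mul0mx //.
  apply/rowP => j; rewrite mul_mx_diag !mxE /tower_row /=.
  by case: eqP => _; rewrite ?mulr0 ?mul0r.
have [E [hE n0 s0]] := lift_eigenvalue hM hE1 z0 n1.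
exists (fun A => E A * \det (A 1)); split.
- exact: freg_mul hE (mreg_det (@mreg_net K 1)).
- by exists tower_net; [exact: tower_net_sym|rewrite tower_det1 mulr1].
move=> A sA; rewrite mulf_eq0 negb_or => /andP[/s0[mu emu /s1[a ea /s2[b eb /s3[d ed' ed]]]] _].
apply: (@curve_of_frame A mu (frame (cone A mu) a b d) sA _ ed).
exact: frame_isotropic (cone_sym _ sA) (cone_det emu) ea eb ed'.
Qed.

End GenericCurve.

(** * The 3-space of an elliptic quartic *)

(** ** Saturation of a complete intersection of two forms *)

Section Saturation.
Variables (K : fieldType) (n : nat).
Local Notation S := {mpoly K[n]}.
Implicit Types (p f g : S).

(** The variables in [s] are replaced by [0]. *)
Definition kill_vars (s : pred 'I_n) : S -> S :=
  mmap (@mpolyC n K) (fun i => if s i then 0 else 'X_i).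
HB.instance Definition _ s := GRing.RMorphism.on (kill_vars s).

Lemma kill_varsX s i : kill_vars s 'X_i = if s i then 0 else 'X_i.
Proof. exact: mmapXU. Qed.

Lemma kill_varsP (I : S -> Prop) (s : pred 'I_n) : is_ideal I ->
  (forall i, s i -> I 'X_i) -> forall p, I (p - kill_vars s p).
Proof.
move=> [I0 ID IM] hs; apply: mpoly_alg_ind => [c|i|f g hf hg|f g hf hg].
- by rewrite /kill_vars mmapC subrr.
- by rewrite kill_varsX; case: ifP => [/hs|_]; rewrite ?subr0 ?subrr.
- by rewrite rmorphD opprD addrACA; apply: ID.
rewrite rmorphM /=; move: (kill_vars s f) (kill_vars s g) hf hg => f' g' hf hg.
have -> : f * g - f' * g' = g * (f - f') + f' * (g - g') by ring.
by apply: ID; apply: IM.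
Qed.

Lemma ideal_pair f g : is_ideal (fun p => exists a b, p = a * f + b * g).
Proof.
split=> [|p q [a [b ->]] [c [d ->]]|p q [a [b ->]]].
- by exists 0, 0; rewrite !mul0r addr0.
- by exists (a + c), (b + d); ring.
by exists (p * a), (p * b); ring.
Qed.

Lemma mpolyX_neq0 i : ('X_i : S) != 0.
Proof.
apply/eqP => /(congr1 (mcoeff U_(i))); rewrite mcoeffX eqxx mcoeff0 => /eqP.
by rewrite oner_eq0.
Qed.

Lemma var_dvd i j (u v : S) : i != j -> 'X_j * u = 'X_i * v -> exists e, u = e * 'X_i.
Proof.
move=> ij e; have [a [b ->]] : exists a b, u = a * 'X_i + b * 'X_i.
  have := @kill_varsP _ (pred1 i) (ideal_pair 'X_i 'X_i) _ u.
  have -> : kill_vars (pred1 i) u = 0.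
    have := congr1 (kill_vars (pred1 i)) e; rewrite !rmorphM /= !kill_varsX /= eqxx.
    rewrite eq_sym (negbTE ij) mul0r => /eqP; rewrite mulf_eq0.
    by rewrite (negbTE (mpolyX_neq0 j)) => /eqP.
  rewrite subr0; apply=> k /eqP ->; by exists 1, 0; rewrite mul1r mul0r addr0.
by exists (a + b); rewrite mulrDl.
Qed.

Lemma var_regular i j k (c a b : S) : i != k -> j != k ->
  'X_k * c = a * 'X_i + b * 'X_j -> exists a' b', c = a' * 'X_i + b' * 'X_j.
Proof.
move=> ik jk e; have := @kill_varsP _ (pred2 i j) (ideal_pair 'X_i 'X_j) _ c.
have -> : kill_vars (pred2 i j) c = 0.
  have := congr1 (kill_vars (pred2 i j)) e.
  rewrite rmorphD !rmorphM /= !kill_varsX /= !eqxx orbT !mulr0 addr0.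
  rewrite ![k == _]eq_sym (negbTE ik) (negbTE jk) /= => /eqP.
  by rewrite mulf_eq0 (negbTE (mpolyX_neq0 k)) => /eqP.
rewrite subr0; apply=> l /orP[/eqP ->|/eqP ->].
  by exists 1, 0; rewrite mul1r mul0r addr0.
by exists 0, 1; rewrite mul1r mul0r add0r.
Qed.

(** [f], [g] is a regular sequence. *)
Section CompleteIntersection.
Variables (f g : S).
Hypothesis f0 : f != 0.
Hypothesis fg : forall c d, c * g = d * f -> exists e, c = e * f.
Variables i j k : 'I_n.
Hypotheses (ij : i != j) (ik : i != k) (jk : j != k).

(** The maximal ideal is not associated to [(f, g)]: the Koszul relations between
    the coefficients of three multiples by variables are solved. *)
Lemma ci_saturated_step p : (forall l, exists a b, 'X_l * p = a * f + b * g) ->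
  exists a b, p = a * f + b * g.
Proof.
move=> h; have [a0 [b0 e0]] := h i; have [a1 [b1 e1]] := h j.
have [a2 [b2 e2]] := h k.
have rel (x y : S) a b a' b' : x * p = a * f + b * g -> y * p = a' * f + b' * g ->
    exists c, y * b - x * b' = c * f /\ y * a - x * a' = - (c * g).
  move=> ex ey; have e : (y * b - x * b') * g = - (y * a - x * a') * f.
    have : y * (x * p) = x * (y * p) by ring.
    rewrite ex ey => /eqP; rewrite -subr_eq0 => /eqP z; apply/eqP.
    by rewrite -subr_eq0; apply/eqP; rewrite -[RHS]z; ring.
  have [c ec] := fg e; exists c; split=> //.
  apply: (mulIf f0); have -> : (y * a - x * a') * f = - ((y * b - x * b') * g).
    by rewrite e; ring.
  by rewrite ec; ring.
have [c01 [eb01 ea01]] := rel _ _ _ _ _ _ e0 e1.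
have [c12 [eb12 ea12]] := rel _ _ _ _ _ _ e1 e2.
have [c20 [eb20 ea20]] := rel _ _ _ _ _ _ e2 e0.
have kos : 'X_k * c01 = (- c12) * 'X_i + (- c20) * 'X_j.
  apply: (mulIf f0); apply/eqP; rewrite -subr_eq0; apply/eqP.
  transitivity ('X_k * (c01 * f) + 'X_i * (c12 * f) + 'X_j * (c20 * f)); first by ring.
  by rewrite -eb01 -eb12 -eb20; ring.
have [d1 [d0 ed]] := var_regular ik jk kos.
have [b' eb'] : exists e, b0 - d0 * f = e * 'X_i.
  apply: (@var_dvd i j _ (b1 + d1 * f) ij); apply/eqP; rewrite -subr_eq0; apply/eqP.
  transitivity (('X_j * b0 - 'X_i * b1) - (d1 * 'X_i + d0 * 'X_j) * f); first by ring.
  by rewrite eb01 ed subrr.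
have [a' ea'] : exists e, a0 + d0 * g = e * 'X_i.
  apply: (@var_dvd i j _ (a1 - d1 * g) ij); apply/eqP; rewrite -subr_eq0; apply/eqP.
  transitivity (('X_j * a0 - 'X_i * a1) + (d1 * 'X_i + d0 * 'X_j) * g); first by ring.
  by rewrite ea01 ed addNr.
exists a', b'; apply: (mulfI (mpolyX_neq0 i)); rewrite e0.
transitivity ((a0 + d0 * g) * f + (b0 - d0 * f) * g); first by ring.
by rewrite ea' eb'; ring.
Qed.

(** The ideal of a complete intersection of two forms is saturated. *)
Lemma ci_saturated d p : (forall m, m \is d.-homog -> exists a b,
  m * p = a * f + b * g) -> exists a b, p = a * f + b * g.
Proof.
elim: d => [|d IH] h; first by have := h 1 (dhomog1 _ _); rewrite mul1r.
apply: IH => m hm; apply: ci_saturated_step => l; rewrite mulrA; apply: h.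
exact: homogMe (homogXU _ _) hm (add1n d).
Qed.

End CompleteIntersection.

Lemma pihomogMl d p f : f \is d.-homog -> pihomog mdeg d (p * f) = p@_0 *: f.
Proof.
move=> hf; elim/mpolyind: p => [|c m p _ _ IH].
  by rewrite mul0r pihomog0 mcoeff0 scale0r.
rewrite mulrDl pihomogD IH mcoeffD scalerDl; congr (_ + _).
rewrite mcoeffZ mcoeffX -scalerAl linearZ /= -scalerA; congr (_ *: _).
have hm : 'X_[m] * f \is (mdeg m + d).-homog by apply: dhomogM hf; rewrite dhomogX.
have [m0|m0] := eqVneq m 0%MM.
  by rewrite m0 mpolyX0 mul1r pihomog_dE // scale1r.
rewrite scale0r (pihomog_ne0 _ hm) //.
by rewrite -{2}[d]add0n eqn_add2r mdeg_eq0.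
Qed.

(** A form of degree [d] in the ideal of two forms of degree [d]. *)
Lemma homog_pair d p f g : p \is d.-homog -> f \is d.-homog -> g \is d.-homog ->
  (exists a b, p = a * f + b * g) -> exists a b, p = a *: f + b *: g.
Proof.
move=> hp hf hg [a [b e]]; exists a@_0, b@_0.
by rewrite -(pihomogMl _ hf) -(pihomogMl _ hg) -pihomogD -e pihomog_dE.
Qed.

End Saturation.

(** ** Restriction to a linear subspace *)

Section IdealGen.
Variables (K : fieldType) (n : nat).
Local Notation S := {mpoly K[n]}.
Implicit Types (r s : seq S) (f : S).

Lemma ideal_gen_ideal r : is_ideal (ideal_gen r).
Proof.
split=> [|f g [c ->] [d ->]|f g [c ->]].
- by exists (fun=> 0); rewrite big1 // => i _; rewrite mul0r.
- exists (fun i => c i + d i); rewrite -big_split; apply: eq_bigr => i _ /=.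
  by rewrite mulrDl.
by exists (fun i => f * c i); rewrite mulr_sumr; apply: eq_bigr => i _; rewrite mulrA.
Qed.

Lemma ideal_gen_mono r s : {subset r <= s} ->
  forall f, ideal_gen r f -> ideal_gen s f.
Proof.
move=> rs; apply: ideal_gen_sub (ideal_gen_ideal s) _ => f /rs.
exact: ideal_gen_mem.
Qed.

Lemma ideal_sum (I : S -> Prop) (T : Type) (r : seq T) (F : T -> S) :
  is_ideal I -> (forall i, I (F i)) -> I (\sum_(i <- r) F i).
Proof. by move=> [I0 ID _] h; elim/big_ind: _. Qed.

End IdealGen.

Section LinearSubstitution.
Variables (K : fieldType) (n m : nat) (P : 'M[K]_(n, m)).
Local Notation S := {mpoly K[n]}.
Local Notation T := {mpoly K[m]}.

Lemma linform_sum (k : nat) (l : 'rV[K]_k) :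
  linform l = \sum_j (l 0 j)%:MP * 'X_j.
Proof. by apply: eq_bigr => j _; rewrite mul_mpolyC. Qed.

(** The variables are replaced by the linear forms of the rows of [P]. *)
Definition lin_subst : S -> T :=
  mmap (@mpolyC m K) (fun j => linform (row j P)).
HB.instance Definition _ := GRing.RMorphism.on lin_subst.

Lemma lin_substC k : lin_subst k%:MP = k%:MP.
Proof. by rewrite /lin_subst mmapC. Qed.

Lemma lin_substX j : lin_subst 'X_j = linform (row j P).
Proof. exact: mmapXU. Qed.

Lemma lin_subst_linform l : lin_subst (linform l) = linform (l *m P).
Proof.
rewrite linform_sum rmorph_sum linform_sum /=.
transitivity (\sum_j \sum_i (l 0 j * P j i)%:MP * 'X_i : T).
  apply: eq_bigr => j _; rewrite rmorphM /= lin_substC lin_substX linform_sum.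
  by rewrite mulr_sumr; apply: eq_bigr => i _; rewrite !mxE mulrA mpolyCM.
rewrite exchange_big; apply: eq_bigr => i _ /=.
by rewrite -mulr_suml mxE -rmorph_sum.
Qed.

Lemma lin_subst_qform (A : 'M[K]_n) : lin_subst (qform A) = qform (P^T *m A *m P).
Proof.
have qE k (B : 'M[K]_k) : qform B = \sum_i 'X_i * linform (row i B).
  apply: eq_bigr => i _; rewrite mulr_sumr; apply: eq_bigr => j _.
  by rewrite mxE scalerAr.
rewrite !qE rmorph_sum /=.
transitivity (\sum_i \sum_a 'X_a * ((P i a)%:MP * linform (row i A *m P)) : T).
  apply: eq_bigr => i _; rewrite rmorphM /= lin_substX lin_subst_linform.
  rewrite linform_sum mulr_suml; apply: eq_bigr => a _; rewrite mxE.
  by rewrite mulrA ['X_a * _]mulrC.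
rewrite exchange_big; apply: eq_bigr => a _ /=; rewrite -mulr_sumr; congr (_ * _).
rewrite linform_sum.
transitivity (\sum_i \sum_j (P i a * (row i A *m P) 0 j)%:MP * 'X_j : T).
  apply: eq_bigr => i _; rewrite linform_sum mulr_sumr; apply: eq_bigr => j _.
  by rewrite mpolyCM mulrA.
rewrite exchange_big; apply: eq_bigr => j _ /=; rewrite -mulr_suml -rmorph_sum.
congr (_%:MP * _); rewrite mxE -mulmxA mxE; apply: eq_bigr => i _.
by rewrite -row_mul !mxE.
Qed.

Lemma lin_subst_homog d f : f \is d.-homog -> lin_subst f \is d.-homog.
Proof.
move=> hf; rewrite (mpolyE f) big_seq rmorph_sum /=; apply: rpred_sum => u hu.
rewrite -mul_mpolyC rmorphM /= lin_substC mul_mpolyC; apply: rpredZ.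
have <- : mdeg u = d by apply: (dhomogP _ _ _ hf).
rewrite mpolyXE_id rmorph_prod mdegE.
elim/big_ind2: _ => [|d1 p d2 q hp hq|i _]; [exact: dhomog1|exact: dhomogM|].
by rewrite rmorphXn /= lin_substX; apply: homogXn (linform_homog _) (mul1n _).
Qed.

End LinearSubstitution.

Section LinearSection.
Variables (K : fieldType) (c m n : nat).
Variables (W V : 'M[K]_(m, n)) (L : 'M[K]_(c, n)).
Hypothesis VW : V *m W^T = 1%:M.
Hypothesis LW : L *m W^T = 0.
Hypothesis WL : forall l : 'rV_n, l *m W^T = 0 -> (l <= L)%MS.
Local Notation S := {mpoly K[n]}.
Local Notation T := {mpoly K[m]}.

(** Restriction of a polynomial to the row space of [W]. *)
Notation restr := (lin_subst W^T).

(** Composition with a linear projection to that space. *)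
Notation extend := (lin_subst V).

Lemma linform_delta k i : linform (delta_mx 0 i : 'rV[K]_k) = 'X_i.
Proof.
rewrite linform_sum (bigD1 i) //= !mxE !eqxx mpolyC1 mul1r big1 ?addr0 //.
by move=> j /negbTE ji; rewrite !mxE ji mpolyC0 mul0r.
Qed.

Lemma restr_extend f : restr (extend f) = f.
Proof.
move: f; apply: (@rmorph_mpoly_eq K m _ (restr \o extend) idfun) => [k|i] /=.
  by rewrite !lin_substC.
by rewrite lin_substX lin_subst_linform -row_mul VW row1 linform_delta.
Qed.

Lemma linform_mem (l : 'rV_n) : (l <= L)%MS -> ideal_gen (linforms L) (linform l).
Proof.
case/submxP => u ->.
have -> : linform (u *m L) = \sum_i (u 0 i)%:MP * linform (row i L).
  rewrite linform_sum.
  transitivity (\sum_j \sum_i (u 0 i * L i j)%:MP * 'X_j : S).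
    by apply: eq_bigr => j _; rewrite mxE rmorph_sum mulr_suml.
  rewrite exchange_big; apply: eq_bigr => i _ /=; rewrite linform_sum mulr_sumr.
  by apply: eq_bigr => j _; rewrite !mxE mpolyCM mulrA.
apply: ideal_sum (ideal_gen_ideal _) _ => i.
case: (ideal_gen_ideal (linforms L)) => _ _; apply; apply: ideal_gen_mem.
by apply: map_f; rewrite mem_enum.
Qed.

Lemma extend_restr f : ideal_gen (linforms L) (f - extend (restr f)).
Proof.
have [I0 ID IM] := ideal_gen_ideal (linforms L).
move: f; apply: mpoly_alg_ind => [k|i|f g hf hg|f g hf hg].
- by rewrite !lin_substC subrr.
- have -> : 'X_i - extend (restr 'X_i) =
      linform (delta_mx 0 i - delta_mx 0 i *m W^T *m V).
    rewrite linformD -[- (_ *m V)]scaleN1r linformZ scaleN1r linform_delta.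
    by rewrite -rowE lin_substX lin_subst_linform.
  by apply/linform_mem/WL; rewrite mulmxBl -[X in _ - X]mulmxA VW mulmx1 subrr.
- rewrite [restr _]rmorphD /= [extend _]rmorphD /=.
  move: (extend (restr f)) (extend (restr g)) hf hg => f' g' hf hg.
  by rewrite opprD addrACA; apply: (ID).
rewrite [restr _]rmorphM /= [extend _]rmorphM /=.
move: (extend (restr f)) (extend (restr g)) hf hg => f' g' hf hg.
have -> : f * g - f' * g' = g * (f - f') + f' * (g - g') by ring.
by apply: (ID); apply: (IM).
Qed.

Lemma restr0P f : restr f = 0 <-> ideal_gen (linforms L) f.
Proof.
split=> [e|]; first by have := extend_restr f; rewrite e rmorph0 subr0.
move: f; apply: (@ideal_gen_sub _ _ (fun f => restr f = 0)).
  split=> [|f g ef eg|f g eg]; first exact: rmorph0.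
    by rewrite rmorphD /= ef eg addr0.
  by rewrite rmorphM /= eg mulr0.
move=> f /mapP[i _ ->]; rewrite lin_subst_linform -row_mul LW linform_sum big1 // => j _.
by rewrite !mxE mpolyC0 mul0r.
Qed.

Lemma restr_pairP (p q f : S) : ideal_gen (linforms L ++ [:: p; q]) f <->
  exists a b, restr f = a * restr p + b * restr q.
Proof.
have [I0 ID IM] := ideal_gen_ideal (linforms L ++ [:: p; q]).
split; last first.
  move=> [a [b e]].
  have e0 : restr (f - (extend a * p + extend b * q)) = 0.
    by rewrite rmorphB rmorphD !rmorphM /= !restr_extend e subrr.
  rewrite -[f](subrK (extend a * p + extend b * q)); apply: (ID).
    move/restr0P: e0; apply: ideal_gen_mono => g; rewrite mem_cat => -> //.
  by apply: (ID); apply: (IM); apply: ideal_gen_mem; rewrite mem_cat !inE eqxx ?orbT.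
move: f; apply: ideal_gen_sub.
  have [J0 JD JM] := ideal_pair (restr p) (restr q).
  split=> [|f g hf hg|f g hg]; rewrite ?rmorph0 ?rmorphD ?rmorphM //=.
  - exact: JD.
  - exact: JM.
move=> f; rewrite mem_cat !inE => /orP[fL|/orP[/eqP ->|/eqP ->]].
- by exists 0, 0; rewrite !mul0r addr0; apply/restr0P/ideal_gen_mem.
- by exists 1, 0; rewrite mul1r mul0r addr0.
by exists 0, 1; rewrite mul1r mul0r add0r.
Qed.

Lemma restr_qform (A : 'M[K]_n) : restr (qform A) = qform (W *m A *m W^T).
Proof. by rewrite lin_subst_qform trmxK. Qed.

End LinearSection.

(** ** Degenerate pencils of quadrics *)

Section Pencils.
Variable K : numClosedFieldType.

Lemma rank_adj n (M : 'M[K]_n.+1) : \adj M != 0 -> (n <= \rank M)%N.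
Proof.
move=> /matrix_neq0P[i [j]]; rewrite mxE mulf_eq0 signr_eq0 /= => d0.
have rn : \rank (row' j (col' i M)) = n.
  by apply/mxrank_unit; rewrite unitmxE unitfE.
apply: leq_trans (_ : \rank (row' j (col' i M)) <= _)%N; first by rewrite rn.
have -> : row' j (col' i M) = row' j 1%:M *m M *m col' i 1%:M.
  apply/matrixP => a b; rewrite !mxE (bigD1 (lift i b)) //= !mxE eqxx mulr1.
  rewrite [X in _ + X]big1 ?addr0 => [|k /negbTE kb]; last by rewrite !mxE kb mulr0.
  rewrite (bigD1 (lift j a)) //= !mxE eqxx mul1r big1 ?addr0 // => k /negbTE kb.
  by rewrite !mxE eq_sym kb mul0r.
exact: leq_trans (mxrankM_maxl _ _) (mxrankM_maxr _ _).
Qed.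

(** A binary form of positive degree has a zero. *)
Lemma pencil_root n (Z M N : 'M[K]_n.+2) : exists a b : K,
  ((a != 0) || (b != 0)) /\ \tr (Z *m \adj (a *: M + b *: N)) = 0.
Proof.
have hp (M' N' : 'M[K]_n.+2) : exists p : {poly K}, forall t,
    p.[t] = \tr (Z *m \adj (M' + t *: N')).
  exists (\tr (map_mx polyC Z *m \adj (map_mx polyC M' + 'X *: map_mx polyC N'))).
  move=> t; rewrite -[LHS]/(horner_eval t _) /mxtrace rmorph_sum.
  have eC (B : 'M[K]_n.+2) : map_mx (horner_eval t) (map_mx polyC B) = B.
    by apply/matrixP => i j; rewrite !mxE /horner_eval hornerC.
  have <- : map_mx (horner_eval t) (map_mx polyC Z *m
      \adj (map_mx polyC M' + 'X *: map_mx polyC N')) = Z *m \adj (M' + t *: N').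
    rewrite map_mxM map_mx_adj map_mxD map_mxZ /= !eC.
    by rewrite /horner_eval hornerX.
  by apply: eq_bigr => i _; rewrite [RHS]mxE.
have [p1 e1] := hp M N; have [p2 e2] := hp N M.
case: (closed_rootP p1) => [[t /eqP t0]|nr].
  by exists 1, t; rewrite oner_eq0 scale1r -e1.
have [c ec] : exists c, p1 = c%:P.
  case: (eqVneq (size p1) 1%N) => [s1|/closed_rootP //].
  by exists p1`_0; apply: size1_polyC; rewrite s1.
have h a : a != 0 -> p2.[a] = c * a ^+ n.+1.
  move=> a0; have -> : p2.[a] = a ^+ n.+1 * p1.[a^-1].
    rewrite e1 e2 -mxtraceZ scalemxAr -adjZ scalerDr scalerA divff // scale1r.
    by rewrite addrC.
  by rewrite ec hornerC mulrC.
have e0 : 'X * (p2 - c *: 'X^(n.+1)) = 0.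
  apply/eqP; apply: contraT => /poly_nonroot[a].
  rewrite hornerM hornerX mulf_eq0; case: eqVneq => [//|a0] /=.
  by rewrite hornerD hornerN hornerZ hornerXn h // subrr eqxx.
exists 0, 1; rewrite oner_eq0 orbT; split=> //.
rewrite scale1r addrC -e2; move/eqP: e0; rewrite mulf_eq0 polyX_eq0 /= subr_eq0.
by move/eqP ->; rewrite hornerZ hornerXn expr0n mulr0.
Qed.

(** A quadric containing the 3-space of [W] is singular at one of its points. *)
Lemma isotropic_kernel (W : 'M[K]_(4, 7)) (Q : 'M[K]_7) : row_free W ->
  W *m Q *m W^T = 0 -> exists v : 'rV_7, [/\ v != 0, (v <= W)%MS & v *m Q = 0].
Proof.
move=> fW eQ; have : kermx (W *m Q) != 0.
  rewrite -mxrank_eq0 mxrank_ker; have := mulmx0_rank_max eQ.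
  by rewrite mxrank_tr (eqP fW); lia.
case/rowV0Pn => u /sub_kermxP uQ u0.
exists (u *m W); rewrite submxMl -mulmxA; split=> //.
by apply: contra u0; rewrite mulmx_free_eq0.
Qed.

Lemma rank_isotropic (W : 'M[K]_(4, 7)) (Q : 'M[K]_7) : row_free W ->
  W *m Q *m W^T = 0 -> \adj Q != 0 -> \rank Q = 6%N.
Proof.
move=> fW /(isotropic_kernel fW)[v [v0 _ vQ]] aQ.
have h1 := rank_adj aQ; have : ~~ row_free Q.
  by apply: contra v0 => fQ; rewrite -(mulmx_free_eq0 v fQ) vQ.
by have := rank_leq_row Q; rewrite /row_free; lia.
Qed.

(** The adjugate of a symmetric matrix of corank 1. *)
Lemma adj_rank_one (Q : 'M[K]_7) (v : 'rV_7) : symmetric_mx Q -> v != 0 ->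
  v *m Q = 0 -> \adj Q != 0 -> exists2 g, g != 0 & \adj Q = g *: (v^T *m v).
Proof.
move=> sQ v0 vQ aQ.
have r6 := rank_adj aQ; have dQ : \det Q = 0 by apply/eqP/det0P; exists v.
have kv : (v <= kermx Q)%MS by apply/sub_kermxP.
have vk : (kermx Q <= v)%MS.
  rewrite -(geq_leqif (mxrank_leqif_sup kv)) mxrank_ker rank_rV v0; lia.
have : (\adj Q <= v)%MS.
  apply: submx_trans vk; apply/sub_kermxP; rewrite mul_adj_mx dQ.
  by apply/matrixP => i j; rewrite !mxE mul0rn.
case/submxP => c ec; have /matrixP sc : (\adj Q)^T = \adj Q by rewrite trmx_adj sQ.
have [i vi] : exists i, v 0 i != 0.
  by have [k [i vi]] := matrix_neq0P v0; exists i; rewrite ord1 in vi.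
have h k l : c l 0 * v 0 k = c k 0 * v 0 l.
  by have := sc k l; rewrite ec !mxE !big_ord1.
have e : \adj Q = (c i 0 / v 0 i) *: (v^T *m v).
  apply/matrixP => k l; rewrite ec !mxE !big_ord1 !mxE mulrA; congr (_ * _).
  by apply: (mulIf vi); rewrite mulrAC divfK // h.
exists (c i 0 / v 0 i) => //.
by apply: contraNneq aQ => g0; rewrite e g0 scale0r.
Qed.

(** A singular point of a quadric of the net that lies on the threefold is a
    singular point of the threefold. *)
Lemma net_singular (A : 'I_3 -> 'M[K]_7) (x : 'rV_3) (v : 'rV_7) : symmetric_net A ->
  x != 0 -> v != 0 -> v *m member A x = 0 -> (forall k, (v *m A k *m v^T) 0 0 = 0) ->
  ~ smooth_of_codim 3 (V8_ideal A).
Proof.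
move=> sA x0 v0 vx vA hs.
have q0 k : peval (qform (A k)) v = 0 by rewrite peval_qform.
have [|f [hf rf]] := hs v v0.
  move=> f /V8_idealP[d ->]; rewrite peval_sum big1 // => k _.
  by rewrite pevalM q0 mulr0.
have [d ed] := fin_all_exists (fun i => V8_idealP (hf i)).
have eJ : jacobian f v = (\matrix_(i, k) (2%:R * peval (d i k) v)) *m gradients A v.
  apply/matrixP => i j; rewrite !mxE ed mderiv_sum peval_sum; apply: eq_bigr => k _.
  rewrite mderivM pevalD !pevalM q0 mulr0 add0r mderiv_qform // !mxE.
  by rewrite mulrCA mulrA.
have xG : x *m gradients A v = 0.
  apply/rowP => j; transitivity ((v *m member A x) 0 j); last by rewrite vx.
  rewrite /member mulmx_sumr summxE mxE; apply: eq_bigr => k _.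
  by rewrite -scalemxAr [RHS]mxE mxE.
have : ~~ row_free (gradients A v).
  by apply: contra x0 => fG; rewrite -(mulmx_free_eq0 x fG) xG.
rewrite /row_free; have := mxrankM_maxr (\matrix_(i, k) (2%:R * peval (d i k) v))
  (gradients A v).
by rewrite -eJ rf eqn_leq rank_leq_row => ->.
Qed.

(** If two independent members of the net contain the 3-space, some member of
    their pencil is singular at a base point of the net in this 3-space. *)
Lemma no_isotropic_pencil (A : 'I_3 -> 'M[K]_7) (W : 'M[K]_(4, 7)) (P : 'M[K]_(2, 3)) :
  symmetric_net A -> (forall x, x != 0 -> \adj (member A x) != 0) ->
  smooth_of_codim 3 (V8_ideal A) -> row_free W -> row_free P ->
  (forall u : 'rV_2, W *m member A (u *m P) *m W^T = 0) -> False.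
Proof.
move=> sA hA hs fW fP iso.
have memD x y : member A (x + y) = member A x + member A y.
  by rewrite /member -big_split; apply: eq_bigr => k _; rewrite mxE scalerDl.
have memZ a x : member A (a *: x) = a *: member A x.
  by rewrite /member scaler_sumr; apply: eq_bigr => k _; rewrite mxE scalerA.
have [z hz] : exists z : 'rV_3, ~~ (z <= P)%MS.
  have : ~~ ((1%:M : 'M[K]_3) <= P)%MS.
    apply/negP => /mxrankS; rewrite mxrank1; have := rank_leq_row P; lia.
  case/row_subPn => i hi; by exists (row i 1%:M).
(* By [adj_rank_one] this trace is, up to a scalar, the value of the third quadric
   at the singular point. *)
have [a [b [ab tr0]]] := pencil_root (member A z) (member A (row 0 P)) (member A (row 1 P)).
pose u : 'rV[K]_2 := \row_i (if i == 0 then a else b).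
have u0 : u != 0.
  apply/eqP => /rowP h; have := h 0; have := h 1; rewrite !mxE /= => hb ha.
  by rewrite ha hb eqxx in ab.
have eu : u *m P = a *: row 0 P + b *: row 1 P.
  rewrite mulmx_sum_row !big_ord_recl big_ord0 addr0 !mxE /=; congr (_ + _ *: row _ _).
  exact: val_inj.
pose x := u *m P; have x0 : x != 0 by rewrite mulmx_free_eq0.
pose Q := member A x.
have sQ : symmetric_mx Q.
  rewrite /symmetric_mx /Q /member linear_sum; apply: eq_bigr => k _.
  by rewrite linearZ /= sA.
have [v [v0 vW vQ]] := isotropic_kernel fW (iso u).
have [g g0 eg] := adj_rank_one sQ v0 vQ (hA x x0).
have vz : (v *m member A z *m v^T) 0 0 = 0.
  move: tr0; rewrite -!memZ -memD -eu -/Q eg -scalemxAr mxtraceZ => /eqP.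
  rewrite mulf_eq0 (negbTE g0) mulmxA mxtrace_mulC mulmxA /= => /eqP <-.
  by rewrite /mxtrace big_ord1.
have vP (w : 'rV_2) : (v *m member A (w *m P) *m v^T) 0 0 = 0.
  case/submxP: vW => s ->; rewrite trmx_mul !mulmxA -[s *m W *m _]mulmxA.
  by rewrite -[_ *m W^T]mulmxA iso mulmx0 mul0mx mxE.
have full (y : 'rV_3) : (y <= P + z)%MS.
  apply: submx_full; rewrite -col_leq_rank.
  have zP : (P < P + z)%MS.
    by rewrite ltmxE addsmxSl /=; apply: contra hz => /(submx_trans (addsmxSr _ _)).
  by have := rank_ltmx zP; rewrite (eqP fP).
apply: (@net_singular A x v) => // k.
have -> : A k = member A (delta_mx 0 k).
  rewrite /member (bigD1 k) //= mxE !eqxx scale1r big1 ?addr0 // => l /negbTE lk.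
  by rewrite mxE lk scale0r.
have /sub_addsmxP[[w t] /= ->] := full (delta_mx 0 k).
rewrite memD mulmxDr mulmxDl mxE vP add0r.
have -> : t *m z = t 0 0 *: z by rewrite [t]mx11_scalar mul_scalar_mx !mxE.
by rewrite memZ -scalemxAr -scalemxAl mxE vz mulr0.
Qed.

End Pencils.

(** ** The quadric of rank 6 *)

Section QuadraticForms.
Variables (K : numFieldType) (n : nat).

Lemma qform_homog (B : 'M[K]_n) : qform B \is 2.-homog.
Proof.
apply: rpred_sum => i _; apply: rpred_sum => j _; apply: rpredZ.
exact: homogMe (homogXU _ _) (homogXU _ _) (erefl _).
Qed.

Lemma qform_eq0 (B : 'M[K]_n) : symmetric_mx B -> qform B = 0 -> B = 0.
Proof.
move=> sB e; apply/matrixP => i j; have := mderiv_qform j (delta_mx 0 i) sB.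
rewrite e mderiv0 peval0 -rowE !mxE => /esym/eqP.
by rewrite mulf_eq0 pnatr_eq0 /= => /eqP.
Qed.

End QuadraticForms.

Lemma qform_member (K : numFieldType) (A : 'I_3 -> 'M[K]_7) x :
  qform (member A x) = \sum_k x 0 k *: qform (A k).
Proof.
transitivity (\sum_i \sum_j \sum_k (x 0 k * A k i j) *: ('X_i * 'X_j) : {mpoly K[7]}).
  apply: eq_bigr => i _; apply: eq_bigr => j _; rewrite summxE -scaler_suml.
  by congr (_ *: _); apply: eq_bigr => k _; rewrite mxE.
under eq_bigr do rewrite exchange_big; rewrite exchange_big; apply: eq_bigr => k _ /=.
rewrite scaler_sumr; apply: eq_bigr => i _; rewrite scaler_sumr.
by apply: eq_bigr => j _; rewrite scalerA.
Qed.

Lemma row_free_sub (K : fieldType) k m n (N : 'M[K]_(m, n)) : (k <= \rank N)%N ->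
  exists2 P : 'M_(k, n), row_free P & (P <= N)%MS.
Proof.
move=> kN; exists ((pid_mx k : 'M_(k, \rank N)) *m row_base N).
  by rewrite /row_free mxrankMfree ?row_base_free // rank_pid_mx.
by apply: submx_trans (submxMl _ _) _; rewrite eq_row_base.
Qed.

Lemma scheme_inter_ideal (K : fieldType) n (I J : {mpoly K[n]} -> Prop) :
  is_ideal I -> is_ideal J -> is_ideal (scheme_inter I J).
Proof.
move=> [I0 ID IM] [J0 JD JM]; split=> [|f g [a [b [Ia Jb ->]]] [c [d [Ic Jd ->]]]|].
- by exists 0, 0; rewrite addr0.
- by exists (a + c), (b + d); split; [exact: ID|exact: JD|rewrite addrACA].
move=> f g [a [b [Ia Jb ->]]].
by exists (f * a), (f * b); split; [exact: IM|exact: JM|rewrite mulrDr].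
Qed.

Section ThreeSpace.
Variable K : numClosedFieldType.
Local Notation S := {mpoly K[7]}.

(** Linear equations and a parametrisation of a 3-space. *)
Lemma linear_section (L : 'M[K]_(3, 7)) : \rank L = 3%N ->
  exists W V : 'M[K]_(4, 7), [/\ row_free W, V *m W^T = 1%:M, L *m W^T = 0
    & forall l : 'rV_7, l *m W^T = 0 -> (l <= L)%MS].
Proof.
move=> rL; have [|W fW WL] := @row_free_sub K 4%N _ _ (kermx L^T).
  by rewrite mxrank_ker mxrank_tr rL.
have LW : L *m W^T = 0.
  by apply: trmx_inj; rewrite trmx_mul trmxK trmx0; apply/sub_kermxP.
exists W, (pinvmx W)^T; split=> // [|l lW].
  by rewrite -trmx_mul mulmxVp // trmx1.
have kL : (L <= kermx W^T)%MS by apply/sub_kermxP.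
apply: (@submx_trans _ _ _ _ _ _ (kermx W^T)); first by apply/sub_kermxP.
by rewrite -(geq_leqif (mxrank_leqif_sup kL)) mxrank_ker mxrank_tr (eqP fW) rL.
Qed.

Lemma quartic_3space (A : 'I_3 -> 'M[K]_7) (C : S -> Prop) : symmetric_net A ->
  (forall x, x != 0 -> \adj (member A x) != 0) -> smooth_of_codim 3 (V8_ideal A) ->
  elliptic_quartic_on (V8_ideal A) C ->
  exists (L : 'M[K]_(3, 7)) (Q : 'M[K]_7),
    [/\ \rank L = 3%N,
        same_scheme C (scheme_inter (V8_ideal A) (ideal_gen (linforms L))),
        symmetric_mx Q /\ \rank Q = 6%N,
        subscheme (ideal_gen (linforms L)) (ideal_gen [:: qform Q])
      & subscheme (V8_ideal A) (ideal_gen [:: qform Q])].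
Proof.
move=> sA hA smA [_ _ sCV [L [A' [B' [rL _ _ [n1 reg] sJ]]]]].
set s := linforms L ++ _ in n1 reg sJ.
have [W [V [fW VW LW WL]]] := linear_section rL.
have kerP := restr0P VW LW WL.
have pairP := restr_pairP VW LW WL.
set R := lin_subst W^T in kerP pairP.
pose f := R (qform A'); pose g := R (qform B').
have szL : size (linforms L) = 3%N by rewrite size_map size_enum_ord.
have RE k : R (lin_subst V k) = k by exact: restr_extend.
have RB u v : R (u - v) = R u - R v by exact: rmorphB.
have RMul u v : R (u * v) = R u * R v by exact: rmorphM.
have f0 : f != 0.
  apply/eqP => z; apply: n1; have /kerP hL := z.
  have [t3 n3] : take 3%N s = linforms L /\ s`_(3%N) = qform A'.
    by rewrite /s (take_size_cat _ szL) nth_cat szL.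
  have := reg 3%N _ 1; rewrite t3 n3 mul1r size_cat szL => /(_ isT hL).
  by apply: ideal_gen_mono => h hh; rewrite mem_cat hh.
have fg (c d : {mpoly K[4]}) : c * g = d * f -> exists e, c = e * f.
  move=> e.
  have [t4 n4] : take 4%N s = linforms L ++ [:: qform A'] /\ s`_(4%N) = qform B'.
    by rewrite /s take_cat nth_cat szL.
  have := reg 4%N _ (lin_subst V c); rewrite t4 n4 size_cat szL => /(_ isT).
  have [_ ID IM] := ideal_gen_ideal (linforms L ++ [:: qform A']).
  case.
    rewrite -[_ * _](subrK (lin_subst V d * qform A')); apply: (ID).
      apply: (@ideal_gen_mono _ _ (linforms L)) => [h hh|]; first by rewrite mem_cat hh.
      by apply/kerP; rewrite RB !RMul !RE; rewrite -/f -/g e subrr.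
    by apply: (IM); apply: ideal_gen_mem; rewrite mem_cat inE eqxx orbT.
  move=> u eu.
  have : ideal_gen (linforms L ++ [:: qform A'; qform A']) (lin_subst V c).
    apply: (@ideal_gen_mono _ _ (linforms L ++ [:: qform A'])); last by exists u.
    by move=> h; rewrite !mem_cat !inE orbb.
  by move/pairP => [a [b]]; rewrite RE -mulrDl => ->; exists (a + b).
have h2 B : R (qform B) \is 2.-homog by rewrite /R restr_qform; apply: qform_homog.
have hk k : exists ab : K * K, R (qform (A k)) = ab.1 *: f + ab.2 *: g.
  have : exists a b, R (qform (A k)) = a * f + b * g.
    have : saturation (ideal_gen s) (qform (A k)).
      apply/sJ/sCV; exists 0%N => h _; case: (ideal_gen_ideal (net_forms A)) => _ _.
      by apply; apply: net_form_mem.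
    case=> d hd; apply: (@ci_saturated _ _ _ _ f0 fg 0 1 2 isT isT isT d) => m hm.
    have /pairP := hd (lin_subst V m) (lin_subst_homog V hm).
    by rewrite RMul RE.
  by move/(homog_pair (h2 _) (h2 _) (h2 _)) => [a [b e]]; exists (a, b).
have [ab eab] := fin_all_exists hk.
pose M : 'M[K]_(3, 2) := \matrix_(k, j) (if j == 0 then (ab k).1 else (ab k).2).
have RM x : R (qform (member A x)) = (x *m M) 0 0 *: f + (x *m M) 0 1 *: g.
  rewrite qform_member /R rmorph_sum /= -/R !mxE !scaler_suml -big_split.
  apply: eq_bigr => k _; rewrite !mxE /= -!scalerA -scalerDr -eab.
  by rewrite -!mul_mpolyC RMul /R lin_substC.
have symM x : symmetric_mx (member A x).
  rewrite /symmetric_mx /member linear_sum; apply: eq_bigr => k _.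
  by rewrite linearZ /= sA.
have iso x : x *m M = 0 -> W *m member A x *m W^T = 0.
  move=> xM; apply: qform_eq0.
    by rewrite /symmetric_mx !trmx_mul trmxK symM mulmxA.
  by rewrite -restr_qform -/R RM xM !mxE !scale0r addr0.
(* Otherwise a pencil of quadrics of the net contains the 3-space. *)
have rM : \rank M = 2%N.
  apply/eqP; rewrite eqn_leq rank_leq_col leqNgt; apply/negP => rM.
  have [|P fP PM] := @row_free_sub K 2%N _ _ (kermx M).
    by rewrite mxrank_ker; lia.
  apply: (no_isotropic_pencil sA hA smA fW fP) => u; apply: iso.
  by rewrite -mulmxA (sub_kermxP PM) mulmx0.
have : kermx M != 0 by rewrite -mxrank_eq0 mxrank_ker rM.
case/rowV0Pn => x /sub_kermxP xM x0.
pose Q := member A x.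
have V8Q y : V8_ideal A (qform (member A y)).
  rewrite qform_member; apply: ideal_sum (ideal_gen_ideal _) _ => k.
  case: (ideal_gen_ideal (net_forms A)) => _ _ IM; rewrite -mul_mpolyC.
  exact/IM/net_form_mem.
have RA k : ideal_gen s (qform (A k)).
  apply/pairP; rewrite eab; exists (ab k).1%:MP, (ab k).2%:MP.
  by rewrite !mul_mpolyC.
have inter h : ideal_gen s h <-> scheme_inter (V8_ideal A) (ideal_gen (linforms L)) h.
  have [_ ID _] := ideal_gen_ideal s.
  split; last first.
    move=> [h1 [h2' [V1 L2 ->]]]; apply: (ID).
      move: V1; apply: ideal_gen_sub (ideal_gen_ideal s) _ _.
      by move=> t /mapP[k _ ->].
    by move: L2; apply: ideal_gen_mono => t tL; rewrite mem_cat tL.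
  have [V0 VD VM] := ideal_gen_ideal (net_forms A).
  have [L0 LD LM] := ideal_gen_ideal (linforms L).
  have lift_form B (y : 'rV_2) : R (qform B) = y 0 0 *: f + y 0 1 *: g ->
      scheme_inter (V8_ideal A) (ideal_gen (linforms L)) (qform B).
    move=> eB; have : (y <= M)%MS by apply: submx_full; rewrite /row_full rM.
    case/submxP => z ez; exists (qform (member A z)), (qform B - qform (member A z)).
    split; [exact: V8Q| |by rewrite addrC subrK].
    by apply/kerP; rewrite RB RM -ez eB subrr.
  move: h; apply: ideal_gen_sub; first by apply: scheme_inter_ideal.
  move=> h; rewrite mem_cat !inE => /orP[hL|/orP[/eqP ->|/eqP ->]].
  - by exists 0, h; split; [|exact: ideal_gen_mem|rewrite add0r].
  - apply: (lift_form _ (delta_mx 0 0)); rewrite !mxE /=.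
    by rewrite scale1r scale0r addr0.
  apply: (lift_form _ (delta_mx 0 1)); rewrite !mxE /=.
  by rewrite scale1r scale0r add0r.
exists L, Q; split=> //.
- move=> h; rewrite sJ; split=> -[d hd]; exists d => m hm; by apply/inter/hd.
- by split; [exact: symM|exact: rank_isotropic fW (iso x xM) (hA x x0)].
- apply/subscheme_of_sub/(ideal_gen_sub (ideal_gen_ideal _)) => h; rewrite inE => /eqP ->.
  by apply/kerP; rewrite RM xM !mxE !scale0r addr0.
apply/subscheme_of_sub/(ideal_gen_sub (ideal_gen_ideal _)) => h; rewrite inE => /eqP ->.
exact: V8Q.
Qed.

End ThreeSpace.

(** * The general prime Fano threefold of genus 5 *)

Lemma general_of_generic (K : numFieldType) (M P : ('I_3 -> 'M[K]_7) -> Prop) :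
  (forall A, M A -> symmetric_net A) -> generic M -> generic (fun A => M A -> P A) ->
  general_member (@net_coords K) M P.
Proof.
move=> sM gM gP; have [E [[e eE] [A sA EA] hE]] := generic_and gM gP.
exists (fun x => peval e x != 0); split.
- exists (fun f => f = e) => x; split=> [ex|[f -> //]]; by exists e.
- by exists A; rewrite -eE; split=> //; have [] := hE A sA EA.
- move=> U' [F hF] [B [MB /hF[f Ff fB]]].
  have hf : net_alg K (fun C => peval f (net_coords C)) by exists f.
  have hE' : net_alg K E by exists e.
  have [C [sC EC fC]] := net_irreducible hE' hf sA (sM B MB) EA fB.
  exists C; rewrite -eE; split=> //; first by have [] := hE C sC EC.
  by apply/hF; exists f.
move=> B MB; rewrite -eE => EB; have [_ hP] := hE B (sM B MB) EB.
exact: hP.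
Qed.

Lemma generic_V8 (K : numClosedFieldType) : generic (@is_V8 K).
Proof.
have [E [hE hw hs]] := generic_and (generic_regular K) (generic_smooth K).
by exists E; split=> // A sA /(hs A sA)[].
Qed.

Theorem mainTheorem4 (R : realType) :
  general_member (@net_coords R[i]) (@is_V8 R[i]) (fun A : 'I_3 -> 'M[R[i]]_7 =>
    (exists C : {mpoly R[i][7]} -> Prop,
       [/\ elliptic_curve C 4, projectively_normal C
         & subscheme C (V8_ideal A)])
    /\
    (forall C : {mpoly R[i][7]} -> Prop,
       elliptic_quartic_on (V8_ideal A) C ->
       exists (L : 'M[R[i]]_(3, 7)) (Q : 'M[R[i]]_7),
         [/\ \rank L = 3%N,
             same_scheme C (scheme_inter (V8_ideal A) (ideal_gen (linforms L))),
             symmetric_mx Q /\ \rank Q = 6%N,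
             subscheme (ideal_gen (linforms L)) (ideal_gen [:: qform Q])
           & subscheme (V8_ideal A) (ideal_gen [:: qform Q])])).
Proof.
apply: general_of_generic; [by move=> A []|exact: generic_V8|].
have [E [hE hw hs]] := generic_and (generic_curve R[i]) (generic_rank R[i]).
exists E; split=> // A sA /(hs A sA)[hC hA] [_ _ smA]; split=> // C.
exact: quartic_3space.
Qed.
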